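(* Let $(L,q_L)$ be a quadratic lattice of rank $n$ over $\mathfrak{o}$ and $k\ge n$ an integer. Let $n_0$ be the number of zero entries of $\mathrm{GK}(L)$ and $|\mathrm{GK}(L)|$ the sum of its entries. Then \[ \alpha(L,H_k)=(1-f^{-k})\sum_{0\le b\le |\mathrm{GK}(L)|/2}\ \sum_{n_0\le a\le n}\ \sum_{\pm}\#\mathcal{S}_{(L,a^{\pm},b)}\, f^{b(n+1-2k)}\bigl(1+\chi(a^{\pm})f^{\,n-a/2-k}\bigr)\prod_{\substack{i\in\mathbb{Z}\\1\le i<n-a/2}}(1-f^{2i-2k}), \] where the innermost sum is the single term with $\mathcal{S}_{(L,a,b)}$ when $a$ is odd or $0$, and the two terms with $\mathcal{S}_{(L,a^+,b)}$ and $\mathcal{S}_{(L,a^-,b)}$ when $a$ is even and positive.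
   Context: $F$ is a finite extension of $\mathbb{Q}_p$, $\mathfrak{o}$ its ring of integers, $\pi$ a uniformizer, $\kappa=\mathfrak{o}/\pi$, $f=\#\kappa$, $\mathrm{ord}(\pi)=1$. A quadratic lattice $(L,q_L)$ is a free $\mathfrak{o}$-module of rank $n$ with a quadratic form $q_L:L\to\mathfrak{o}$ such that $V=L\otimes F$ is nondegenerate. Gram matrix of a basis: $b_{ii}=q_L(e_i)$, $b_{ij}=\tfrac12(q_L(e_i+e_j)-q_L(e_i)-q_L(e_j))$. $S(B)$: non-decreasing $(a_i)\in\mathbb{Z}^n_{\ge0}$ with $\mathrm{ord}(b_{ii})\ge a_i$, $\mathrm{ord}(2b_{ij})\ge(a_i+a_j)/2$; $\mathrm{GK}(L)$ is the lexicographically greatest element of $\bigcup_{U\in\mathrm{GL}_n(\mathfrak{o})}S({}^tUBU)$. $H_k=\mathfrak{o}^{2k}$ with $q_k=\sum_{i=1}^k x_iy_i$. The local density $\alpha(L,H_k)$ equals $\lim_{N\to\infty}f^{-N(2kn-n(n+1)/2)}\#\{\varphi:L/\pi^N L\to H_k/\pi^NH_k\text{ linear}: q_k\circ\varphi\equiv q_L \bmod \pi^N\}$. $[L':L]$ denotes the length of $L'/L$. For a lattice $L\subseteq L'\subseteq V$ with $q_L\otimes F$ integral on $L'$, write $L'/\pi L'=\bar L'_0\perp\bar L'_1$ (reduced form), $\bar L'_1$ the radical and $\bar L'_0$ nonsingular, $a=\dim\bar L'_0$; for $a$ even positive attach $a^+$ if $\bar L'_0$ is split, $a^-$ otherwise;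 for $a$ odd or $0$ the symbol is $a$. $\mathcal{S}_{(L,a^\pm,b)}$ is the set of such $L'\supseteq L$ in $V$ with integral form, $[L':L]=b$ and symbol $a^\pm$. $\chi(a^\pm)=0$ for $a$ odd, $1$ for $a=0$ or symbol $a^+$ with $a$ even, $-1$ for symbol $a^-$ with $a>0$ even. *)

(* Defs.v *)
From HB Require Import structures.
From mathcomp Require Import all_boot all_order all_algebra all_field.
From mathcomp Require Import finmap.
From mathcomp Require Import all_classical all_reals all_analysis.
Set Implicit Arguments.
Unset Strict Implicit.
Unset Printing Implicit Defensive.
Import Order.TTheory GRing.Theory Num.Theory.
Import numFieldNormedType.Exports.
Local Open Scope classical_set_scope.
Local Open Scope quotient_scope.
Local Open Scope ring_scope.

(* 0 when A is infinite. *)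
Definition ncard {T : choiceType} (A : set T) : nat := #|` fset_set A|.

(* Normalized: the values are Z u {+oo}, -oo being excluded by ord_fin. *)
Record discrete_valuation (F : fieldType) := DiscreteValuation {
  ord :> F -> \bar int;
  ord_0 : ord 0 = +oo%E;
  ord_fin : forall x, x != 0 -> ord x \is a fin_num;
  ord_mul : forall x y, ord (x * y) = (ord x + ord y)%E;
  ord_add : forall x y, (Order.min (ord x) (ord y) <= ord (x + y)%R)%E;
  ord_uniformizer : exists x, ord x = 1%E
}.

Definition cauchy_val (F : fieldType) (v : discrete_valuation F)
    (u : nat -> F) : Prop :=
  forall m : int, exists N, forall i j,
    (N <= i)%N -> (N <= j)%N -> (m%:E <= v (u i - u j)%R)%E.

Definition cvg_val (F : fieldType) (v : discrete_valuation F)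
    (u : nat -> F) (l : F) : Prop :=
  forall m : int, exists N, forall i, (N <= i)%N -> (m%:E <= v (u i - l)%R)%E.

(* Q_p as the completion of Q for the p-adic valuation: the normalized valuation
   has v p = 1, so it restricts to the p-adic one on Q (and K has
   characteristic 0); Q is dense in K; K is complete. *)
Definition is_Qp (p : nat) (K : fieldType) (v : discrete_valuation K) : Prop :=
  [/\ v p%:R = 1%E,
      forall (x : K) (m : int), exists r : rat, (m%:E <= v (x - ratr r)%R)%E
    & forall u, cauchy_val v u -> exists l, cvg_val v u l].

Section ValuationRing.
Variables (F : fieldType) (v : discrete_valuation F).

Definition is_integral : {pred F} := fun x => (0 <= v x)%E.

Lemma ord_1 : v 1 = 0%E.
Proof.
have := ord_mul v 1 1; rewrite mulr1; have := ord_fin v (oner_neq0 F).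
case: (v 1) => // r _ [] /eqP; rewrite -subr_eq0 opprD addNKr oppr_eq0.
by move=> /eqP ->.
Qed.

Lemma ord_inv x : x != 0 -> (v x + v x^-1%R = 0)%E.
Proof. by move=> x0; rewrite -ord_mul mulfV// ord_1. Qed.

Lemma ord_opp x : v (- x) = v x.
Proof.
suff N1 : v (- 1) = 0%E by rewrite -mulN1r ord_mul N1 add0e.
have := ord_mul v (-1) (-1); rewrite mulrNN mulr1 ord_1.
have : v (-1) \is a fin_num by apply: ord_fin; rewrite oppr_eq0 oner_neq0.
case: (v (-1)) => // r _ [] /eqP; rewrite eq_sym -mulr2n mulrn_eq0 /=.
by move=> /eqP ->.
Qed.

Lemma is_integral_subring : subring_closed is_integral.
Proof.
rewrite /is_integral; split => [|x y|x y]; rewrite !unfold_in.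
- by rewrite ord_1.
- move=> hx hy; apply: le_trans (ord_add v x (- y)).
  by rewrite le_min hx ord_opp.
- by move=> hx hy; rewrite ord_mul adde_ge0.
Qed.

HB.instance Definition _ :=
  GRing.isSubringClosed.Build F is_integral is_integral_subring.

Record integers := Integer { int_val :> F; _ : int_val \in is_integral }.

HB.instance Definition _ := [isSub for int_val].
HB.instance Definition _ := [Choice of integers by <:].
HB.instance Definition _ := [SubChoice_isSubComNzRing of integers by <:].

(* The element x of F seen in o; only meaningful when x is integral. *)
Definition to_int (x : F) : integers := insubd 0 x.

Definition int_unit : {pred integers} := fun x => v (val x) == 0%E.
Definition int_inv (x : integers) : integers :=
  if int_unit x then to_int (val x)^-1 else x.

Lemma int_unit_neq0 (x : integers) : int_unit x -> val x != 0.
Proof.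
by rewrite /int_unit; apply: contraTneq => ->; rewrite ord_0.
Qed.

Lemma int_mulVx : {in int_unit, left_inverse 1 int_inv *%R}.
Proof.
move=> x ux; have {}ux : int_unit x by []; rewrite /int_inv ux; apply: val_inj.
rewrite rmorphM /= insubdK ?mulVf ?int_unit_neq0//.
have := ord_inv (int_unit_neq0 ux); rewrite (eqP ux) add0e => vV.
by change (0 <= v (val x)^-1%R)%E; rewrite vV.
Qed.

Lemma int_unitP (x y : integers) : y * x = 1 -> int_unit x.
Proof.
move=> /(congr1 val) /(congr1 v); rewrite rmorphM ord_mul rmorph1 ord_1.
have : (0 <= v (val x))%E := valP x.
have : (0 <= v (val y))%E := valP y.
rewrite /int_unit => hy hx /eqP; rewrite padde_eq0//.
by case/andP.
Qed.

Lemma int_inv_out : {in [predC int_unit], int_inv =1 id}.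
Proof.
move=> x xNu; have {}xNu : ~~ int_unit x by [].
by rewrite /int_inv (negPf xNu).
Qed.

HB.instance Definition _ := GRing.ComNzRing_hasMulInverse.Build integers
  int_mulVx int_unitP int_inv_out.

(* The ideal (pi^(N+1)), pi being any uniformizer. *)
Definition max_ideal_pow (N : nat) : {pred integers} :=
  fun x => (N.+1%:Z%:E <= v (val x))%E.

Lemma max_ideal_pow_closed N : idealr_closed (max_ideal_pow N).
Proof.
rewrite /max_ideal_pow; split.
- by rewrite unfold_in rmorph0 ord_0 leey.
- by rewrite unfold_in rmorph1 ord_1 lee_fin.
- move=> a x y; rewrite !unfold_in => hx hy.
  rewrite rmorphD rmorphM; apply: le_trans (ord_add v _ _).
  rewrite le_min hy andbT ord_mul -[leLHS]add0e leeD//.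
  exact: valP a.
Qed.

HB.instance Definition _ N :=
  isIdealr.Build integers (max_ideal_pow N) (max_ideal_pow_closed N).

(* o / (pi^(N+1)): the exponent is positive, so that this is a nonzero ring. *)
Definition int_mod (N : nat) := {ideal_quot max_ideal_pow N}.
HB.instance Definition _ N := GRing.ComNzRing.on (int_mod N).

Definition reduce (N : nat) (x : integers) : int_mod N := \pi_(int_mod N) x.

(* kappa = o / (pi) *)
Definition residue_field := int_mod 0.
HB.instance Definition _ := GRing.ComNzRing.on residue_field.

Definition residue_inv (x : residue_field) : residue_field :=
  if x == 0 then 0 else reduce 0 (int_inv (repr x)).

Lemma residue_mulVf (x : residue_field) : x != 0 -> residue_inv x * x = 1.
Proof.
move=> x0; rewrite /residue_inv (negPf x0).
have ux : int_unit (repr x).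
  have : ~~ (max_ideal_pow 0 (repr x)).
    apply: contra x0 => hx; rewrite -[x]reprK.
    rewrite (_ : 0 = \pi_(residue_field) 0) ?piE//.
    by rewrite Quotient.equivE subr0.
  have : (0 <= v (val (repr x)))%E := valP (repr x).
  rewrite /int_unit /max_ideal_pow; case: (v _) => // r.
  rewrite !lee_fin => r0; rewrite -ltNge -[X in _ < X]add0r ltzD1 => r1.
by rewrite eqe eq_le r1.
rewrite -[X in _ * X]reprK /reduce.
have -> : 1 = \pi_(residue_field) 1 by rewrite piE.
rewrite -(rmorphM (\pi_{ideal_quot max_ideal_pow 0})) /=.
by rewrite int_mulVx.
Qed.

Lemma residue_inv0 : residue_inv 0 = 0.
Proof. by rewrite /residue_inv eqxx. Qed.

HB.instance Definition _ :=
  GRing.ComNzRing_isField.Build residue_field residue_mulVf residue_inv0.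

Definition residue_card : nat := ncard [set: residue_field].

End ValuationRing.

Section QuadraticForms.
Variables (A : comNzRingType) (V : lmodType A).

Definition polar (q : V -> A) (x y : V) : A := q (x + y) - q x - q y.

Definition quadratic_form (q : V -> A) : Prop :=
  (forall c x, q (c *: x) = c ^+ 2 * q x) /\ (forall y, scalar (polar q y)).

Definition nondegenerate_form (q : V -> A) : Prop :=
  forall x, (forall y, polar q x y = 0) -> x = 0.

(* In residue characteristic 2 the radical is not the radical of the polar form:
   q is also required to vanish on it. *)
Definition in_radical (q : V -> A) (U : set V) (x : V) : Prop :=
  [/\ U x, q x = 0 & forall y, U y -> polar q x y = 0].

Definition nonsingular_on (q : V -> A) (U : set V) : Prop :=
  forall x, in_radical q U x -> x = 0.

End QuadraticForms.

(* q_k = x_1 y_1 + ... + x_k y_k, the coordinates being listed as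
   x_1, ..., x_k, y_1, ..., y_k *)
Definition hyperbolic_form {A : comNzRingType} (k : nat) (z : 'rV[A]_(k + k)) : A :=
  \sum_(i < k) z 0 (lshift k i) * z 0 (rshift k i).

Definition split_form {K : fieldType} {W : vectType K} (q : W -> K)
    (U : {vspace W}) : Prop :=
  exists (m : nat) (g : 'Hom('rV[K]_(m + m), W)),
    [/\ lker g = 0%VS, limg g = U & forall z, q (g z) = hyperbolic_form z].

Section Lattices.
Variables (F : fieldType) (v : discrete_valuation F).
Variables (V : vectType F) (q : V -> F).

Definition comb (n : nat) (e : n.-tuple V) (x : 'rV[integers v]_n) : V :=
  \sum_(i < n) val (x 0 i) *: tnth e i.

Definition lattice_basis (n : nat) (e : n.-tuple V) (M : set V) : Prop :=
  basis_of fullv e /\ M = range (comb e).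

Definition submodule (M : set V) : Prop :=
  [/\ M 0, forall x y, M x -> M y -> M (x + y)
    & forall (c : integers v) x, M x -> M (val c *: x)].

Definition integral_on (M : set V) : Prop :=
  forall x, M x -> q x \in is_integral v.

Definition strict_chain (M M' : set V) (m : nat) : Prop :=
  exists c : nat -> set V,
    [/\ c 0%N = M, c m = M', forall i, (i <= m)%N -> submodule (c i)
      & forall i, (i < m)%N -> c i `<` c i.+1].

Definition has_length (M M' : set V) (b : nat) : Prop :=
  strict_chain M M' b /\ forall m, strict_chain M M' m -> (m <= b)%N.

Definition gram (n : nat) (e : n.-tuple V) : 'M[F]_n :=
  \matrix_(i, j) if i == j then q (tnth e i)
                 else 2^-1 * polar q (tnth e i) (tnth e j).

(* The quadratic form q mod pi on M/(pi M), M having o-basis e, in the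
   coordinates given by the basis e mod pi. *)
Definition reduced_form (n : nat) (e : n.-tuple V)
    (y : 'rV[residue_field v]_n) : residue_field v :=
  reduce 0 (to_int v (q (comb e (\row_i repr (y 0 i))))).

Definition radical_decomposition (K : fieldType) (W : vectType K) (Q : W -> K)
    (W0 W1 : {vspace W}) : Prop :=
  [/\ (W0 + W1)%VS = fullv, (W0 :&: W1)%VS = 0%VS,
      forall x y, x \in W0 -> y \in W1 -> polar Q x y = 0,
      forall x, x \in W1 <-> in_radical Q setT x
    & nonsingular_on Q [set x | x \in W0]].

(* Symbols: (a, None) for a odd or 0, (a, Some true) for a^+ and
   (a, Some false) for a^-. *)
Definition signs (a : nat) : seq (option bool) :=
  if odd a || (a == 0)%N then [:: None] else [:: Some true; Some false].

Definition has_symbol (n : nat) (M : set V) (a : nat) (s : option bool) : Prop :=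
  exists e : n.-tuple V, lattice_basis e M /\
  exists W0 W1 : {vspace 'rV[residue_field v]_n},
    [/\ radical_decomposition (reduced_form e) W0 W1,
        \dim W0 = a
      & s = if odd a || (a == 0)%N then None
            else Some `[< split_form (reduced_form e) W0 >]].

(* S_(L, a^s, b), n being the rank of L *)
Definition overlattices (n : nat) (L : set V) (a : nat) (s : option bool)
    (b : nat) : set (set V) :=
  [set M | [/\ L `<=` M, exists e : n.-tuple V, lattice_basis e M,
               integral_on M, has_length L M b & has_symbol n M a s]].

(* Linear maps L/(pi^N' L) -> H_k/(pi^N' H_k), with N' = N+1, compatible with
   the quadratic forms mod pi^N'; L has o-basis e, in which maps are written as
   matrices acting on row vectors. *)
Definition isometries_mod (n k : nat) (e : n.-tuple V) (N : nat) :
    set 'M[int_mod v N]_(n, k + k) :=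
  [set phi | forall x : 'rV[integers v]_n,
     hyperbolic_form (map_mx (reduce N) x *m phi)
     = reduce N (to_int v (q (comb e x)))].

(* The N-th term is the one of exponent N+1 in the definition of alpha. *)
Definition density_seq (R : realType) (n k : nat) (e : n.-tuple V) (N : nat) : R :=
  (residue_card v)%:R
    ^ (- (N.+1%:Z * ((2 * k * n)%N%:Z - (n * n.+1)%N./2%:Z)))
  * (ncard (@isometries_mod n k e N))%:R.

Definition local_density (R : realType) (n k : nat) (e : n.-tuple V) : R :=
  limn (density_seq R k e).

End Lattices.

Definition chi (R : realType) (a : nat) (s : option bool) : R :=
  match s with
  | None => if odd a then 0 else 1
  | Some true => 1
  | Some false => -1
  end.

Section GrossKeating.
Variables (F : fieldType) (v : discrete_valuation F) (n : nat).

(* The condition ord (2 b_ij) >= (a_i + a_j) / 2 is cleared of its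
   denominator. *)
Definition GK_S (B : 'M[F]_n) : set (n.-tuple nat) :=
  [set a : n.-tuple nat | [/\ sorted leq a,
      forall i, ((tnth a i)%:Z%:E <= v (B i i))%E
    & forall i j, ((tnth a i + tnth a j)%N%:Z%:E
                   <= v (2 * B i j)%R + v (2 * B i j)%R)%E]].

Definition GK_union (B : 'M[F]_n) : set (n.-tuple nat) :=
  \bigcup_(U in [set U : 'M[integers v]_n | U \in unitmx])
    GK_S ((map_mx val U)^T *m B *m map_mx val U).

Definition lex_le (a b : n.-tuple nat) : bool :=
  ((a : n.-tuplelexi nat) <= (b : n.-tuplelexi nat))%O.

Definition GK (B : 'M[F]_n) : n.-tuple nat :=
  xget [tuple of nseq n 0%N]
    [set a | GK_union B a /\ forall a', GK_union B a' -> lex_le a' a].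

End GrossKeating.

(* Main.v *)
(* For N large, each isometry phi : L/pi^N -> H_k/pi^N factors through exactly one
   integral lattice M containing L as a map that is injective modulo pi, so the
   isometries are counted lattice by lattice. In bases adapted to L in M the
   inclusion is diag(pi^c_i), and Hensel lifting reduces the count for M to that of the
   injective isometries of M/pi M into the hyperbolic space over the residue field.
   The latter is computed by splitting off radical vectors and hyperbolic planes one
   at a time (the isometries of H_k are transitive on nonzero isotropic vectors) until
   an anisotropic form of dimension at most 2 remains; it depends on the symbol of M
   only. Hence the density sequence is eventually constant.

   For the ranges of a and b, GK(L) is realized by a basis f of L, which defines the
   norm w(x) = min_i (2 v(x_i) + GK_i). Lexicographic maximality makes w tight for q
   and its polar form, and comparing w with the norm attached to M in a basis splitting
   both gives 2b <= |GK(L)|; an exchange argument gives n_0 <= a. *)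
Require Import Defs.
From HB Require Import structures.
From mathcomp Require Import all_boot all_order all_algebra all_field.
From mathcomp Require Import perm zify ring lra.
From mathcomp Require Import finmap.
From mathcomp Require Import all_classical all_reals all_analysis.
Set Implicit Arguments.
Unset Strict Implicit.
Unset Printing Implicit Defensive.
Import Order.TTheory GRing.Theory Num.Theory.
Import numFieldNormedType.Exports.
Local Open Scope ring_scope.

(** Residue characteristic 2 is allowed, so Gram matrices with halves are useless modulo powers of
    pi. A form is recorded by its upper triangular matrix of coefficients, and being an isometry
    becomes one matrix equation over the quotient ring. The factor f^(b(n+1-2k)) has two sources. If
    D = diag(pi^c_i) is the inclusion of L in M and b the sum of the c_i, then f^(2kb) maps Phi
    share the same D Phi, while f^((n+1)b) forms of Phi are compatible with a given form of D Phi.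
    How large N must be is governed by a constant C with the dual lattice of L inside pi^-C L:
    integral overlattices have denominators at most pi^C. Two apparent prerequisites come out of the
    counts themselves: the sign of M is independent of the basis because isometry numbers are, and
    there are finitely many overlattices because each one carries an isometry. The bound 2b <=
    |GK(L)| does not follow from determinants: in residue characteristic 2 the determinant of the
    polar form can have valuation above |GK(L)|, already for x^2. Hence the comparison of norms. *)

(** * Polar forms and coefficient matrices of quadratic forms *)

Section PolarTheory.
Variables (A : comNzRingType) (V : lmodType A) (q : V -> A).
Hypothesis qQ : quadratic_form q.

Lemma polarC x y : polar q x y = polar q y x.
Proof. by rewrite /polar (addrC x y) addrAC. Qed.

Lemma polarDr x y z : polar q x (y + z) = polar q x y + polar q x z.
Proof. by have := qQ.2 x 1 y z; rewrite !scale1r mul1r. Qed.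

Lemma qform0 : q 0 = 0.
Proof. by have := qQ.1 0 0; rewrite scale0r expr2 !mul0r. Qed.

Lemma polar0r x : polar q x 0 = 0.
Proof. by rewrite /polar addr0 qform0 subr0 subrr. Qed.

Lemma polarZr c x y : polar q x (c *: y) = c * polar q x y.
Proof. by have := qQ.2 x c y 0; rewrite !addr0 polar0r addr0. Qed.

Lemma polarDl x y z : polar q (x + y) z = polar q x z + polar q y z.
Proof. by rewrite !(polarC _ z) polarDr. Qed.

Lemma polarZl c x y : polar q (c *: x) y = c * polar q x y.
Proof. by rewrite !(polarC _ y) polarZr. Qed.

Lemma qformD x y : q (x + y) = q x + q y + polar q x y.
Proof. by rewrite /polar -!addrA [RHS]addrA; ring. Qed.

Lemma polar_self x : polar q x x = 2 * q x.
Proof. by rewrite /polar -mulr2n -scaler_nat qQ.1 -natrX; ring. Qed.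

Lemma qformN x : q (- x) = q x.
Proof. by rewrite -scaleN1r qQ.1 sqrrN expr1n mul1r. Qed.

Lemma polarNr x y : polar q x (- y) = - polar q x y.
Proof. by rewrite -scaleN1r polarZr mulN1r. Qed.

Lemma polar_sumr (I : Type) (r : seq I) (P : pred I) (F : I -> V) x :
  polar q x (\sum_(i <- r | P i) F i) = \sum_(i <- r | P i) polar q x (F i).
Proof. exact: (big_morph _ (polarDr x) (polar0r x)). Qed.

Lemma polar_suml (I : Type) (r : seq I) (P : pred I) (F : I -> V) x :
  polar q (\sum_(i <- r | P i) F i) x = \sum_(i <- r | P i) polar q (F i) x.
Proof. by rewrite polarC polar_sumr; apply: eq_bigr => i _; rewrite polarC. Qed.

(** These are the coefficients of q as a polynomial in the coordinates along u; unlike the symmetric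
    Gram matrix they need no division by 2. *)
Definition tri_gram n (u : 'I_n -> V) : 'M[A]_n :=
  \matrix_(i, j) if i == j then q (u i)
                 else if (i < j)%N then polar q (u i) (u j) else 0.

Lemma qform_sum n (u : 'I_n -> V) (x : 'rV[A]_n) :
  q (\sum_i x 0 i *: u i) = (x *m tri_gram u *m x^T) 0 0.
Proof.
have -> : (x *m tri_gram u *m x^T) 0 0 =
    \sum_i \sum_j x 0 i * x 0 j * tri_gram u i j.
  rewrite mxE exchange_big /=; apply: eq_bigr => j _; rewrite !mxE mulr_suml.
  by apply: eq_bigr => i _; rewrite mulrAC.
elim: n u x => [|n IH] u x; first by rewrite !big_ord0 qform0.
rewrite big_ord_recr qformD (qQ.1) polar_suml.
pose w := widen_ord (leqnSn n).
have := IH (u \o w) (\row_i x 0 (w i)).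
rewrite /= (eq_bigr (fun i => x 0 (w i) *: u (w i))); last first.
  by move=> i _; rewrite mxE.
move=> ->; rewrite big_ord_recr /=.
under [X in _ = X + _]eq_bigr => i _ do rewrite big_ord_recr /=.
rewrite [X in _ = X + _]big_split -!addrA; congr (_ + _).
  apply: eq_bigr => i _; apply: eq_bigr => j _; rewrite !mxE; congr (_ * _).
rewrite addrC big_ord_recr /=; congr (_ + _).
  apply: eq_bigr => i _; rewrite !mxE -!(inj_eq val_inj) /= ltn_eqF ?ltn_ord//=.
  rewrite polarZl// polarZr//; exact: mulrA.
rewrite big1 ?add0r; first by rewrite mxE eqxx expr2.
move=> i _; rewrite !mxE -(inj_eq val_inj) /= gtn_eqF ?ltn_ord//= ltnNge.
by rewrite ltnW ?ltn_ord//= mulr0.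
Qed.

End PolarTheory.

(** * Upper triangular matrices as quadratic forms over a commutative ring *)

Section Fold.
Variables (A : comNzRingType).

Definition is_tri n (T : 'M[A]_n) : bool :=
  [forall i : 'I_n, forall j : 'I_n, (j < i)%N ==> (T i j == 0)].

(* The coefficients of the quadratic form x |-> x C x^T. *)
Definition fold n (C : 'M[A]_n) : 'M[A]_n :=
  \matrix_(i, j) if i == j then C i i
                 else if (i < j)%N then C i j + C j i else 0.

Lemma is_triP n (T : 'M[A]_n) :
  reflect (forall i j : 'I_n, (j < i)%N -> T i j = 0) (is_tri T).
Proof.
apply: (iffP forallP) => [h i j ji|h i].
  by have /forallP/(_ j)/implyP/(_ ji)/eqP := h i.
by apply/forallP => j; apply/implyP => /h ->.
Qed.

Lemma fold_tri n (C : 'M[A]_n) : is_tri (fold C).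
Proof.
apply/is_triP => i j ji; rewrite mxE -(inj_eq val_inj) /= gtn_eqF//.
by rewrite ltnNge ltnW.
Qed.

Lemma fold_id n (T : 'M[A]_n) : is_tri T -> fold T = T.
Proof.
move=> /is_triP hT; apply/matrixP => i j; rewrite mxE.
have [->//|ij] := eqVneq i j; case: ltngtP => [lt|gt|e].
- by rewrite (hT j i) ?addr0.
- by rewrite hT.
- by move/eqP: ij; case; apply: val_inj.
Qed.

Lemma foldD n (C D : 'M[A]_n) : fold (C + D) = fold C + fold D.
Proof.
apply/matrixP => i j; rewrite !mxE; case: eqP => // _; case: ifP => _.
  ring.
by rewrite addr0.
Qed.

Lemma fold_is_semi_additive n :  semi_additive (@fold n).
Proof.
split; last exact: foldD.
by apply/matrixP => i j; rewrite !mxE; case: eqP => // _; case: ifP; rewrite ?addr0.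
Qed.

Lemma foldZ n c (C : 'M[A]_n) : fold (c *: C) = c *: fold C.
Proof.
apply/matrixP => i j; rewrite !mxE; case: eqP => // _; case: ifP => _.
  by rewrite mulrDr.
by rewrite mulr0.
Qed.

Lemma fold_tr n (C : 'M[A]_n) : fold C^T = fold C.
Proof.
apply/matrixP => i j; rewrite !mxE; case: eqP => // _; case: ifP => // _.
exact: addrC.
Qed.

HB.instance Definition _ n := GRing.isSemiAdditive.Build _ _ (@fold n)
  (@fold_is_semi_additive n).

Definition tform n (T : 'M[A]_n) (x : 'rV[A]_n) : A := (x *m T *m x^T) 0 0.

Lemma tformE n (T : 'M[A]_n) x :
  tform T x = \sum_i \sum_j x 0 i * x 0 j * T i j.
Proof.
rewrite /tform mxE exchange_big /=; apply: eq_bigr => j _; rewrite !mxE mulr_suml.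
by apply: eq_bigr => i _; rewrite mulrAC.
Qed.

Lemma tform_add n (T : 'M[A]_n) x y :
  tform T (x + y) = tform T x + tform T y + (x *m (T + T^T) *m y^T) 0 0.
Proof.
have E : x *m T^T *m y^T = (y *m T *m x^T)^T by rewrite !trmx_mul trmxK mulmxA.
rewrite /tform [(x + y)^T]linearD /= !(mulmxDl, mulmxDr) E !mxE; ring.
Qed.

Lemma tform_polar n (T : 'M[A]_n) x y :
  polar (tform T) x y = (x *m (T + T^T) *m y^T) 0 0.
Proof. by rewrite /polar tform_add; ring. Qed.

Lemma tform_quadratic n (T : 'M[A]_n) : quadratic_form (tform T).
Proof.
split=> [c x|x c y z].
  by rewrite /tform [(c *: x)^T]linearZ /= -!scalemxAl -scalemxAr !mxE expr2 mulrA.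
by rewrite !tform_polar [(c *: y + z)^T]linearP /= mulmxDr -scalemxAr !mxE.
Qed.

Lemma tform_delta n (T : 'M[A]_n) i j :
  ((delta_mx 0 i : 'rV_n) *m T *m (delta_mx 0 j : 'rV_n)^T) 0 0 = T i j.
Proof.
by rewrite trmx_delta -rowE -colE !mxE.
Qed.

Lemma tri_gram_tform n (C : 'M[A]_n) : tri_gram (tform C) (delta_mx 0) = fold C.
Proof.
apply/matrixP => i j; rewrite !mxE; case: eqP => [->|_].
  exact: tform_delta.
by case: ifP => // _; rewrite tform_polar tform_delta !mxE.
Qed.

Lemma eq_tri_gram n (V : lmodType A) (q q' : V -> A) (u : 'I_n -> V) :
  q =1 q' -> tri_gram q u = tri_gram q' u.
Proof. by move=> e; apply/matrixP => i j; rewrite !mxE /polar !e. Qed.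

Lemma quadratic_tform n (q : 'rV[A]_n -> A) :
  quadratic_form q -> q =1 tform (tri_gram q (delta_mx 0)).
Proof. by move=> qQ x; rewrite {1}[x]row_sum_delta qform_sum. Qed.

Lemma tform_fold n (C : 'M[A]_n) : tform (fold C) =1 tform C.
Proof.
move=> x; rewrite -tri_gram_tform -quadratic_tform//; exact: tform_quadratic.
Qed.

Lemma tri_gram_is_tri n (V : lmodType A) (q : V -> A) (u : 'I_n -> V) :
  is_tri (tri_gram q u).
Proof.
apply/is_triP => i j ji; rewrite mxE -(inj_eq val_inj) /= gtn_eqF//.
by rewrite ltnNge ltnW.
Qed.

Lemma hyperbolic_mul n k (phi : 'M[A]_(n, k + k)) (x : 'rV[A]_n) :
  hyperbolic_form (x *m phi) = tform (lsubmx phi *m (rsubmx phi)^T) x.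
Proof.
rewrite /tform mulmxA -mulmxA -trmx_mul mxE; apply: eq_bigr => i _.
by rewrite -{1 2}[phi]hsubmxK mul_mx_row row_mxEl row_mxEr [_^T i 0]mxE.
Qed.

Definition gram_of n k (phi : 'M[A]_(n, k + k)) : 'M[A]_n :=
  fold (lsubmx phi *m (rsubmx phi)^T).

(** The values of a form at basis vectors and at their pairwise sums determine its triangular matrix
    over any commutative ring. A condition on all x thus becomes a matrix equation that can be
    counted and lifted. *)
Lemma gram_ofP n k (phi : 'M[A]_(n, k + k)) (T : 'M[A]_n) : is_tri T ->
  (forall x, hyperbolic_form (x *m phi) = tform T x) <-> gram_of phi = T.
Proof.
move=> hT; split => [h|<- x]; last by rewrite tform_fold hyperbolic_mul.
rewrite -(fold_id hT) /gram_of -!tri_gram_tform; apply: eq_tri_gram => x.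
by rewrite -h hyperbolic_mul.
Qed.

Lemma quadratic_ext (V : lmodType A) (q q' : V -> A) :
  q =1 q' -> quadratic_form q -> quadratic_form q'.
Proof.
by move=> e [q1 q2]; split=> [c x|x c y z]; rewrite /polar -!e ?q1//; apply: q2.
Qed.

Lemma hyperbolic_quadratic k : quadratic_form (@hyperbolic_form A k).
Proof.
apply: quadratic_ext (tform_quadratic (lsubmx 1%:M *m (rsubmx 1%:M)^T)) => x.
by rewrite -hyperbolic_mul mulmx1.
Qed.

End Fold.

(** * Counting matrices and solutions of linear systems *)

Section Counting.

Lemma card_mx_family (A : finType) m n (P : 'I_m -> 'I_n -> pred A) :
  #|[set Z : 'M[A]_(m, n) | [forall i, forall j, P i j (Z i j)]]|
    = (\prod_i \prod_j #|P i j|)%N.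
Proof.
rewrite pair_big /=.
pose F (p : 'I_m * 'I_n) := P p.1 p.2.
transitivity #|family F|.
  pose h (g : {ffun 'I_m * 'I_n -> A}) : 'M[A]_(m, n) := \matrix_(i, j) g (i, j).
  pose h' (M : 'M[A]_(m, n)) : {ffun 'I_m * 'I_n -> A} := [ffun p => M p.1 p.2].
  have hK : cancel h h' by move=> g; apply/ffunP => -[i j]; rewrite ffunE mxE.
  have h'K : cancel h' h by move=> M; apply/matrixP => i j; rewrite mxE ffunE.
  rewrite -(card_imset _ (can_inj hK)); apply: eq_card => M.
  rewrite inE; apply/forallP/imsetP => [hM|[g /familyP gF ->] i].
    exists (h' M); rewrite ?h'K//; apply/familyP => -[i j]; rewrite ffunE.
    by have /forallP/(_ j) := hM i.
  by apply/forallP => j; rewrite mxE; apply: (gF (i, j)).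
by rewrite card_family foldrE big_map big_enum.
Qed.

(** All nonempty fibers of an additive map are translates of one another; [S] is its image. *)
Lemma card_fiber (U W : finZmodType) (g : {additive U -> W}) (S : {set W}) :
  (forall u, g u \in S) -> (forall w, w \in S -> exists u, g u = w) ->
  forall w, w \in S -> (#|[set u | g u == w]| * #|S| = #|U|)%N.
Proof.
move=> gS Sg w /[dup] wS /Sg [u0 gu0].
have E w' : w' \in S -> #|[set u | g u == w']| = #|[set u | g u == w]|.
  move=> /Sg[u1 gu1]; rewrite -(card_imset _ (addIr (u0 - u1))).
  apply: eq_card => u; rewrite inE; apply/imsetP/eqP => [[x]|guw].
    by rewrite inE => /eqP gx ->; rewrite raddfD raddfB gu0 gu1 gx /= addrC subrK.
  exists (u - (u0 - u1)); rewrite ?subrK// inE !raddfB guw gu0 gu1.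
  by rewrite /= opprK addNKr.
rewrite -[#|U|]sum1_card (partition_big g (mem S))//=.
transitivity (\sum_(w' in S) #|[set u | g u == w]|)%N.
  by rewrite sum_nat_const mulnC.
by apply: eq_bigr => w' w'S; rewrite -(E w' w'S) sum1dep_card.
Qed.

Lemma sum_leq_nat n : (\sum_(i < n) \sum_(j < n) (i <= j) = (n * n.+1)./2)%N.
Proof.
elim: n => [|n IH]; first by rewrite big_ord0.
have -> : ((n.+1 * n.+2)./2 = (n * n.+1)./2 + n.+1)%N.
  rewrite (_ : n.+1 * n.+2 = n * n.+1 + n.+1.*2)%N; last by lia.
  by rewrite halfD odd_double andbF add0n doubleK.
rewrite -IH big_ord_recr (eq_bigr (fun i : 'I_n => \sum_(j < n) (i <= j) + 1)%N).
  rewrite big_split sum1_card card_ord big_ord_recr /= leqnn -addnA; congr addn.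
  by rewrite big1 ?add0n ?addn1// => i _; rewrite leqNgt ltn_ord.
by move=> i _; rewrite big_ord_recr /= ltnW.
Qed.

(** This sum is the exponent for triangular matrices whose (i, j) entry is killed by pi^(c_i + c_j);
    it is the origin of n + 1 in b(n + 1 - 2k). *)
Lemma sum_tri_weight n (c : 'I_n -> nat) :
  (\sum_(i < n) \sum_(j < n | (i <= j)%N) (c i + c j) = n.+1 * \sum_i c i)%N.
Proof.
elim: n c => [|n IH] c; first by rewrite !big_ord0.
rewrite big_ord_recr /=.
rewrite (eq_bigr (fun i : 'I_n => \sum_(j < n | (i <= j)%N)
   (c (widen_ord (leqnSn n) i) + c (widen_ord (leqnSn n) j))
   + (c (widen_ord (leqnSn n) i) + c ord_max))%N).
  rewrite big_split /= (IH (c \o widen_ord (leqnSn n))) /=.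
  rewrite big_split /= sum_nat_const card_ord.
  rewrite (big_pred1 ord_max) => [|j]; last first.
    apply/idP/eqP => [h|->//]; apply/val_inj/eqP.
    by rewrite eqn_leq h -ltnS ltn_ord.
  rewrite big_ord_recr /=; set s := (\sum_(i < n) _)%N; lia.
by move=> i _; rewrite big_mkcond big_ord_recr /= -big_mkcond /= ltnW.
Qed.

Lemma card_tri (A : finComNzRingType) n :
  #|[set T : 'M[A]_n | is_tri T]| = (#|A| ^ (n * n.+1)./2)%N.
Proof.
pose P (i j : 'I_n) : pred A := if (i <= j)%N then predT else pred1 0.
rewrite (_ : [set T | _] = [set Z : 'M[A]_n | [forall i, forall j, P i j (Z i j)]]).
  rewrite card_mx_family -sum_leq_nat expn_sum; apply: eq_bigr => i _.
  rewrite expn_sum; apply: eq_bigr => j _; rewrite /P; case: leqP => _.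
    by rewrite expn1.
  by rewrite card1.
apply/setP => T; rewrite !inE; apply: eq_forallb => i; apply: eq_forallb => j.
by rewrite /P; case: leqP.
Qed.

Variable K : finFieldType.

(** A right inverse of [l] makes Y |-> fold (l Y^T) onto the triangular matrices, so every
    right-hand side has equally many solutions. Both the anisotropic count and Hensel lifting rest
    on this. *)
Lemma lin_count n m (l : 'M[K]_(n, m)) (T : 'M[K]_n) :
  row_free l -> is_tri T ->
  (#|[set Y : 'M[K]_(n, m) | fold (l *m Y^T) == T]| * #|K| ^ (n * n.+1)./2
     = #|K| ^ (n * m))%N.
Proof.
move=> /row_freeP[r lr] hT.
pose g := @fold K n \o (mulmx l \o (@trmx K n m)).
have := @card_fiber _ _ (g : {additive _ -> _}) [set T | is_tri T].
rewrite card_tri card_mx => -> //; last by rewrite inE.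
  by move=> u; rewrite inE fold_tri.
move=> w; rewrite inE => hw; exists (r *m w)^T.
by rewrite /g /= trmxK mulmxA lr mul1mx fold_id.
Qed.

End Counting.

(** * Isotropic vectors of the hyperbolic space over a finite field *)

Section IsometryCount.
Variable K : finFieldType.
Implicit Types (k m n : nat).

Definition isoms n k (Q : 'rV[K]_n -> K) : {set 'M[K]_(n, k + k)} :=
  [set phi | row_free phi && [forall x, hyperbolic_form (x *m phi) == Q x]].

Lemma row_freeP0 m n (M : 'M[K]_(m, n)) :
  row_free M <-> (forall x : 'rV_m, x *m M = 0 -> x = 0).
Proof.
split=> [h x xM|h]; first by apply: (row_free_inj h); rewrite xM mul0mx.
by apply: inj_row_free => x /h.
Qed.

Lemma isomsP n k (Q : 'rV[K]_n -> K) (phi : 'M[K]_(n, k + k)) :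
  phi \in isoms k Q <-> row_free phi /\ forall x, hyperbolic_form (x *m phi) = Q x.
Proof.
rewrite inE; split=> [/andP[-> /forallP h]|[-> h]]; first by split=> // x; apply/eqP.
by apply/forallP => x; apply/eqP.
Qed.

Lemma eq_isoms n k (Q Q' : 'rV[K]_n -> K) : Q =1 Q' -> isoms k Q = isoms k Q'.
Proof.
by move=> e; apply/setP => phi; rewrite !inE; under eq_forallb do rewrite e.
Qed.

Lemma card_isoms_basis n1 n k (Q : 'rV[K]_n -> K) (M : 'M[K]_(n1, n)) :
  row_free M -> n1 = n ->
  #|isoms k (fun x => Q (x *m M))| = #|isoms k Q|.
Proof.
move=> + e; subst n1 => Mf; have Mu : M \in unitmx by rewrite -row_free_unit.
rewrite -[RHS](card_imset _ (can_inj (mulKmx Mu))); apply: eq_card => phi.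
apply/idP/imsetP => [/isomsP[pf hp]|[psi /isomsP[pf hp] ->]].
  exists (invmx M *m phi); last by rewrite mulKVmx.
  apply/isomsP; split.
    rewrite /row_free eqmxMfull ?row_full_unit ?unitmx_inv//; exact: pf.
  by move=> x; rewrite mulmxA hp mulmxKV.
apply/isomsP; split; last by move=> x; rewrite mulmxA hp.
by rewrite /row_free eqmxMfull ?row_full_unit//; exact: pf.
Qed.

Definition cone k : {set 'rV[K]_(k + k)} :=
  [set x | (x != 0) && (hyperbolic_form x == 0)].

Lemma hyperbolic_row k (X Y : 'rV[K]_k) :
  hyperbolic_form (row_mx X Y) = (X *m Y^T) 0 0.
Proof.
by rewrite mxE; apply: eq_bigr => i _; rewrite row_mxEl row_mxEr mxE.
Qed.

(** For fixed first half X, every second half is allowed if X = 0, and a hyperplane of them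
    otherwise. *)
Lemma card_cone k : (#|cone k.+1| = (#|K| ^ k.+1 - 1) * (#|K| ^ k + 1))%N.
Proof.
set f := #|K|; have f0 : (0 < f)%N by apply/card_gt0P; exists 0.
pose B : {set 'rV[K]_(k.+1 + k.+1)} := [set x | hyperbolic_form x == 0].
have -> : cone k.+1 = B :\ 0.
  by apply/setP => x; rewrite !inE.
have B0 : 0 \in B by rewrite inE (qform0 (hyperbolic_quadratic _ _)).
have := cardsD1 0 B; rewrite B0.
suff -> : (#|B| = f ^ k.+1 + (f ^ k.+1 - 1) * f ^ k)%N.
  have : (0 < f ^ k.+1)%N by rewrite expn_gt0 f0.
  case: (f ^ k.+1)%N => // F _; rewrite !subn1 /=.
  by move: #|B :\ 0| (f ^ k)%N => c g; nia.
rewrite -sum1dep_card (partition_big (@lsubmx _ _ _ _) predT)//=.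
pose S (X : 'rV[K]_k.+1) := [set Y : 'rV[K]_k.+1 | (X *m Y^T) 0 0 == 0].
transitivity (\sum_(X : 'rV[K]_k.+1) #|S X|)%N.
  apply: eq_bigr => X _; rewrite sum1dep_card.
  rewrite -(card_imset _ (can_inj (@row_mxKr _ 1 k.+1 k.+1 X))).
  apply: eq_card => x; rewrite inE; apply/andP/imsetP => [[hx /eqP <-]|[Y + ->]].
    exists (rsubmx x); rewrite ?hsubmxK// inE.
    by rewrite -hyperbolic_row hsubmxK.
  by rewrite inE hyperbolic_row row_mxKl eqxx.
rewrite (bigD1 0)//= (eq_bigr (fun=> (f ^ k)%N)); last first.
  move=> X X0; apply/eqP; rewrite -(eqn_pmul2l f0) -expnS mulnC -[X in (_ ^ X)%N]mul1n.
  rewrite -(@lin_count K 1 k.+1 X 0).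
  - apply/eqP; congr (_ * _)%N; apply: eq_card => Y; rewrite !inE.
    apply/eqP/eqP => [h|/matrixP/(_ 0 0)]; last by rewrite !mxE eqxx.
    by rewrite [LHS]mx11_scalar mxE eqxx h raddf0.
  - by rewrite /row_free rank_rV X0.
  - by apply/is_triP => i j _; rewrite mxE.
rewrite sum_nat_const; congr (_ + _ * _)%N.
  rewrite -[k.+1 in RHS]mul1n -card_mx; apply: eq_card => Y.
  by rewrite !inE mul0mx mxE eqxx.
rewrite (_ : #|_| = #|predC1 (0 : 'rV[K]_k.+1)|); last by apply: eq_card.
by rewrite cardC1 card_mx mul1n subn1.
Qed.

Definition e1 k : 'rV[K]_(k.+1 + k.+1) := row_mx (delta_mx 0 0) 0.

(** Witt's theorem for one vector, by an explicit isometry valid in every characteristic: a linear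
    change on one half with its contragredient on the other, then a shear by an alternating
    matrix. *)
Lemma cone_transitive k (x : 'rV[K]_(k.+1 + k.+1)) : x \in cone k.+1 ->
  exists2 g, g \in unitmx & [/\ e1 k *m g = x &
    forall y, hyperbolic_form (y *m g) = hyperbolic_form y].
Proof.
have main (X Y : 'rV[K]_k.+1) : X != 0 -> (X *m Y^T) 0 0 = 0 ->
  exists2 g, g \in unitmx & [/\ e1 k *m g = row_mx X Y &
    forall y, hyperbolic_form (y *m g) = hyperbolic_form y].
  move=> X0 XY.
  have [A Au EA] : exists2 A, A \in unitmx & delta_mx 0 0 *m A = X.
    have := mulmx_ebase X; rewrite rank_rV X0 => eX.
    have cu := col_ebase_unit X.
    pose c := col_ebase X 0 0.
    have cE : col_ebase X = c%:M by exact: mx11_scalar.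
    have c0 : c != 0.
      by move: cu; rewrite cE unitmxE det_scalar expr1 unitfE.
    exists (c *: row_ebase X); first by rewrite unitmxZ ?unitfE// row_ebase_unit.
    rewrite -{2}eX cE mul_scalar_mx -scalemxAl -scalemxAr; congr (_ *: (_ *m _)).
    apply/matrixP => i j; rewrite !mxE !ord1 /=.
    by rewrite -(inj_eq val_inj) /= andbT eq_sym.
  have [u Xu] : exists u : 'rV[K]_k.+1, X *m u^T = 1%:M.
    have /row_freeP[r Xr] : row_free X by rewrite /row_free rank_rV X0.
    by exists r^T; rewrite trmxK.
  (* Z is alternating, and X Z = Y because X pairs to 1 with u and to 0 with Y. *)
  pose Z := u^T *m Y - Y^T *m u.
  have XZ : X *m Z = Y.
    rewrite mulmxBr !mulmxA Xu mul1mx.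
    by rewrite (_ : X *m Y^T = 0) ?mul0mx ?subr0// [LHS]mx11_scalar XY raddf0.
  have Zalt (w : 'rV[K]_k.+1) : w *m Z^T *m w^T = 0.
    rewrite [Z^T]linearB /= !trmx_mul !trmxK mulmxBr mulmxBl.
    have -> : w *m (u^T *m Y) *m w^T = (w *m (Y^T *m u) *m w^T)^T.
      by rewrite !trmx_mul !trmxK !mulmxA.
    by apply/matrixP => i j; rewrite !mxE !ord1 subrr.
  pose ga := block_mx A 0 0 (invmx A)^T.
  pose gb := block_mx 1%:M Z 0 1%:M.
  exists (ga *m gb).
    rewrite unitmx_mul !unitmxE !det_ublock !det1 mulr1 unitr1 andbT.
    by rewrite det_tr -det_mulmx mulmxV ?det1 ?unitr1.
  split.
    rewrite mulmxA /e1 mul_row_block !mulmx0 !mul0mx !addr0 EA.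
    by rewrite mul_row_block !mulmx0 !mul0mx mulmx1 !addr0 XZ.
  move=> y; rewrite -[y]hsubmxK; set P := lsubmx y; set R := rsubmx y.
  rewrite mulmxA !mul_row_block !mulmx0 !mulmx1 !addr0 !add0r !hyperbolic_row.
  rewrite linearD /= trmx_mul mulmxDr mulmxA Zalt add0r trmx_mul trmxK.
  by rewrite mulmxA mulmxK.
move=> /[!inE] /andP[x0]; rewrite -[x]hsubmxK hyperbolic_row => /eqP hx.
have [X0|X0] := eqVneq (lsubmx x) 0; last exact: main.
have Y0 : rsubmx x != 0.
  by apply: contra x0 => /eqP Y0; rewrite -[x]hsubmxK X0 Y0 row_mx0.
have [||g gu [eg hg]] := main (rsubmx x) (lsubmx x) => //.
  by rewrite X0 trmx0 mulmx0 mxE.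
(* Exchanging the two halves is an isometry that brings the case X = 0 back to [main]. *)
pose s : 'M[K]_(k.+1 + k.+1) := block_mx 0 1%:M 1%:M 0.
have sE (P R : 'rV[K]_k.+1) : row_mx P R *m s = row_mx R P.
  by rewrite mul_row_block !mulmx0 !mulmx1 addr0 add0r.
exists (g *m s).
  rewrite unitmx_mul gu /=; suff /mulmx1_unit[] : s *m s = 1%:M by [].
  by rewrite mulmx_block !mul0mx !mulmx0 !mulmx1 !addr0 !add0r -scalar_mx_block.
split; first by rewrite mulmxA eg sE.
move=> y; rewrite mulmxA -[RHS]hg -[y *m g]hsubmxK sE.
rewrite !hyperbolic_row !mxE; apply: eq_bigr => i _; by rewrite !mxE mulrC.
Qed.

End IsometryCount.

(** * Splitting off one radical vector or one hyperbolic plane *)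

Section IsometryReduction.
Variable K : finFieldType.
Implicit Types (k m n : nat).
Local Notation e1 := (e1 K).

(** An injective isometry sends the isotropic first vector into the cone; by transitivity the number
    of extensions does not depend on its image, and [e1] serves as the standard one. *)
Lemma card_isoms_first m k (Q : 'rV[K]_(1 + m) -> K) :
  Q (row_mx 1%:M 0) = 0 ->
  #|isoms k.+1 Q| = (#|cone K k.+1| *
    #|[set phi : 'M[K]_(m, k.+1 + k.+1) | (col_mx (e1 k) phi \in isoms k.+1 Q)%R]|)%N.
Proof.
move=> Q0; pose S (x : 'rV[K]_(k.+1 + k.+1)) :=
  [set phi : 'M[K]_(m, k.+1 + k.+1) | col_mx x phi \in isoms k.+1 Q].
have uE (phi : 'M[K]_(1 + m, k.+1 + k.+1)) :
    row_mx 1%:M 0 *m phi = usubmx phi.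
  by rewrite -{1}[phi]vsubmxK mul_row_col mul1mx mul0mx addr0.
rewrite -sum1_card (partition_big (@usubmx _ 1 m _) (mem (cone K k.+1))) /=.
  transitivity (\sum_(x in cone K k.+1) #|S (e1 k)|)%N; last by rewrite sum_nat_const.
  apply: eq_bigr => x xC; transitivity #|S x|.
    rewrite sum1dep_card -(card_imset _ (can_inj (@col_mxKd _ 1 m _ x))).
    apply: eq_card => phi; rewrite inE.
    apply/andP/imsetP => [[hx /eqP <-]|[psi + ->]].
      by exists (dsubmx phi); rewrite ?vsubmxK// inE vsubmxK.
    by rewrite inE => ->; rewrite col_mxKu.
  have [g gu [<- hg]] := cone_transitive xC.
  rewrite -[RHS](card_imset _ (can_inj (mulmxK gu))); apply: eq_card => phi.
  have step psi : (col_mx (e1 k) psi \in isoms k.+1 Q) =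
     (col_mx (e1 k *m g) (psi *m g) \in isoms k.+1 Q).
    rewrite -mul_col_mx; rewrite !inE /row_free mxrankMfree ?row_free_unit//.
    by under [in RHS]eq_forallb do rewrite mulmxA hg.
  rewrite inE; apply/idP/imsetP => [h|[psi + ->]].
    exists (phi *m invmx g); last by rewrite mulmxKV.
    by rewrite inE step mulmxKV.
  by rewrite inE -step.
move=> phi /isomsP[pf hp]; rewrite inE -uE hp Q0 eqxx andbT.
apply/eqP => e; have /(congr1 lsubmx)/matrixP/(_ 0 0)/eqP := (row_freeP0 phi).1 pf _ e.
by rewrite row_mxKl !mxE oner_eq0.
Qed.

(** Coordinates for the decomposition of H_(k+1) into a hyperbolic plane and H_k: [a] and [b] are
    the components along [e1] and along its dual vector, [Psi] the component in H_k. *)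
Definition emb m k (a b : 'cV[K]_m) (Psi : 'M[K]_(m, k + k)) :
    'M[K]_(m, k.+1 + k.+1) :=
  row_mx (row_mx a (lsubmx Psi) : 'M[K]_(m, 1 + k)) (row_mx b (rsubmx Psi) : 'M[K]_(m, 1 + k)).

Lemma embE m k (phi : 'M[K]_(m, k.+1 + k.+1)) :
  exists a b, exists Psi : 'M[K]_(m, k + k), phi = emb a b Psi.
Proof.
exists (lsubmx (lsubmx phi : 'M[K]_(m, 1 + k))), (lsubmx (rsubmx phi : 'M[K]_(m, 1 + k))).
exists (row_mx (rsubmx (lsubmx phi : 'M[K]_(m, 1 + k))) (rsubmx (rsubmx phi : 'M[K]_(m, 1 + k)))).
by rewrite /emb row_mxKl row_mxKr !hsubmxK.
Qed.

Lemma emb_inj m k (a b a' b' : 'cV[K]_m) (Psi Psi' : 'M[K]_(m, k + k)) :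
  emb a b Psi = emb a' b' Psi' -> [/\ a = a', b = b' & Psi = Psi'].
Proof.
move=> /(@eq_row_mx _ m (1 + k) (1 + k))[].
move=> /(@eq_row_mx _ m 1 k)[-> e] /(@eq_row_mx _ m 1 k)[-> e']; split=> //.
by rewrite -[Psi]hsubmxK e e' hsubmxK.
Qed.

Lemma mul_emb m n k (x : 'M[K]_(n, m)) a b (Psi : 'M[K]_(m, k + k)) :
  x *m emb a b Psi = emb (x *m a) (x *m b) (x *m Psi).
Proof.
rewrite /emb (@mul_mx_row _ n m (1 + k) (1 + k)) !(@mul_mx_row _ n m 1 k).
by rewrite -mulmx_lsub -mulmx_rsub.
Qed.

Lemma add_emb m k a b a' b' (Psi Psi' : 'M[K]_(m, k + k)) :
  emb a b Psi + emb a' b' Psi' = emb (a + a') (b + b') (Psi + Psi').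
Proof.
rewrite /emb (@add_row_mx _ m (1 + k) (1 + k)) !(@add_row_mx _ m 1 k).
by rewrite [lsubmx (_ + _)]linearD [rsubmx (_ + _)]linearD.
Qed.

Lemma e1E k : e1 k = emb 1%:M 0 0.
Proof.
rewrite /e1 /emb !linear0 row_mx0; congr row_mx.
apply/matrixP => i j; rewrite !mxE !ord1 /=; case: splitP => j' ej.
  by rewrite mxE -[j == 0](inj_eq val_inj) /= ej !ord1.
by rewrite mxE -(inj_eq val_inj) /= ej.
Qed.

Lemma hyperbolic_emb k (a b : 'M[K]_1) (z : 'rV[K]_(k + k)) :
  hyperbolic_form (emb a b z) = a 0 0 * b 0 0 + hyperbolic_form z.
Proof.
rewrite /emb hyperbolic_row (@tr_row_mx _ 1 1 k) (@mul_row_col _ 1 1 k 1) mxE; congr (_ + _).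
  by rewrite mxE big_ord1 mxE.
by rewrite -hyperbolic_row hsubmxK.
Qed.

(** Pairing with [e1] reads off the component [b], which is therefore forced to be the column [l] of
    polar values of the first vector. The component [a] can be absorbed by [e1], so injectivity
    concerns only [l] and [Psi]. *)
Lemma e1_isoms m k (Q : 'rV[K]_(1 + m) -> K) (Q' : 'rV[K]_m -> K) (l : 'cV[K]_m)
    a b (Psi : 'M[K]_(m, k + k)) :
  (forall (s : 'M[K]_1) x, Q (row_mx s x) = s 0 0 * (x *m l) 0 0 + Q' x) ->
  (col_mx (e1 k) (emb a b Psi) \in isoms k.+1 Q) <->
  [/\ b = l,
      forall x, (x *m a) 0 0 * (x *m l) 0 0 + hyperbolic_form (x *m Psi) = Q' x
    & forall x : 'rV_m, x *m l = 0 -> x *m Psi = 0 -> x = 0].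
Proof.
move=> QE; have mulE (s : 'M[K]_1) x : row_mx s x *m col_mx (e1 k) (emb a b Psi) =
    emb (s + x *m a) (x *m b) (x *m Psi).
  rewrite mul_row_col e1E !mul_emb add_emb mulmx1 !mulmx0 !add0r //.
split=> [/isomsP[/row_freeP0 pf hp]|[bl hQ hl]].
  have H (s : 'M[K]_1) x := hp (row_mx s x).
  have bl : b = l.
    have h1 (x : 'rV[K]_m) : (x *m b) 0 0 = (x *m l) 0 0.
      have := H 1%:M x; have := H 0 x.
      rewrite !mulE !hyperbolic_emb !QE add0r [(1%:M + x *m a) 0 0]mxE [1%:M 0 0]mxE.
      rewrite [(0 : 'M[K]_1) 0 0]mxE eqxx /=.
      move: ((x *m a) 0 0) ((x *m b) 0 0) ((x *m l) 0 0) (hyperbolic_form _) (Q' x).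
      move=> u w L c d e0 e1.
      have -> : w = ((1%:R + u) * w + c) - (u * w + c) by ring.
      by rewrite e1 e0; ring.
    apply/matrixP => i j; rewrite ord1; have := h1 (delta_mx 0 i).
    by rewrite -!rowE !mxE.
  split=> // [x|x xl xP].
    by have := H 0 x; rewrite mulE hyperbolic_emb QE add0r [(0 : 'M[K]_1) 0 0]mxE mul0r add0r bl.
  have /pf : row_mx (- (x *m a)) x *m col_mx (e1 k) (emb a b Psi) = 0.
    by rewrite mulE addNr bl xl xP /emb !linear0 !row_mx0.
  by rewrite -[0 in X in X -> _]row_mx0; case/eq_row_mx.
apply/isomsP; split.
  apply/row_freeP0 => z; rewrite -[z](@hsubmxK _ _ 1 m) mulE bl => e.
  have : emb (lsubmx z + rsubmx z *m a) (rsubmx z *m l) (rsubmx z *m Psi)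
     = emb 0 0 0 by rewrite e /emb !linear0 !row_mx0.
  by move=> /emb_inj[+ /hl h /h r0]; rewrite r0 mul0mx addr0 => ->; rewrite row_mx0.
move=> z; rewrite -[z](@hsubmxK _ _ 1 m) mulE bl hyperbolic_emb QE -hQ.
by rewrite [(lsubmx z + _) 0 0]mxE mulrDl -addrA.
Qed.

(** Here the column [l] of [e1_isoms] is 0: [a] is free, which gives f^m, and [Psi] is any injective
    isometry of Q'. *)
Lemma card_isoms_radical m k (Q : 'rV[K]_(1 + m) -> K) (Q' : 'rV[K]_m -> K) :
  Q' 0 = 0 -> (forall s x, Q (row_mx s x) = Q' x) ->
  #|isoms k.+1 Q| = (#|cone K k.+1| * (#|K| ^ m * #|isoms k Q'|))%N.
Proof.
move=> Q'0 QE; rewrite card_isoms_first ?QE//; congr (_ * _)%N.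
have QE' (s : 'M[K]_1) x : Q (row_mx s x) = s 0 0 * (x *m (0 : 'cV[K]_m)) 0 0 + Q' x.
  by rewrite mulmx0 mxE mulr0 add0r.
pose h (p : 'cV[K]_m * 'M[K]_(m, k + k)) := emb p.1 0 p.2.
have hI : injective h by move=> [a P] [a' P'] /emb_inj[/= -> _ ->].
rewrite -[X in (_ ^ X)%N]muln1 -(card_mx K m 1) -cardsT -cardsX -(card_imset _ hI); apply: eq_card => phi.
rewrite inE; have [a [b [P ->]]] := embE phi.
apply/idP/imsetP => [/(e1_isoms _ _ _ QE')[-> hp hl]|[[a' P'] + ->]].
  exists (a, P) => //; rewrite inE /= inE /=; apply/isomsP; split.
    by apply/row_freeP0 => x; apply: hl; rewrite mulmx0.
  by move=> x; rewrite -hp mulmx0 [(0 : 'M[K]_1) 0 0]mxE mulr0 add0r.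
rewrite inE /= inE /= => /isomsP[/row_freeP0 pf hp].
apply/(e1_isoms _ _ _ QE'); split=> // [x|x _]; last exact: pf.
by rewrite mulmx0 [(0 : 'M[K]_1) 0 0]mxE mulr0 add0r hp.
Qed.

(** Here [l] is the first coordinate. The H_k-component z of the second vector is free, which gives
    f^(2k), and then [a] is forced. *)
Lemma card_isoms_hyperbolic m k (Q : 'rV[K]_(1 + (1 + m)) -> K)
    (Q' : 'rV[K]_m -> K) :
  quadratic_form Q' ->
  (forall (s t : 'M[K]_1) x, Q (row_mx s (row_mx t x)) = s 0 0 * t 0 0 + Q' x) ->
  #|isoms k.+1 Q| = (#|cone K k.+1| * (#|K| ^ (k + k) * #|isoms k Q'|))%N.
Proof.
move=> Q'Q QE; have Q'0 := qform0 Q'Q.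
have Hq := @hyperbolic_quadratic K k.
rewrite card_isoms_first; last first.
  by rewrite -row_mx0 QE [(0 : 'M[K]_1) 0 0]mxE mulr0 add0r.
congr (_ * _)%N.
pose l : 'cV[K]_(1 + m) := col_mx 1%:M 0.
have lE (t : 'M[K]_1) (x : 'rV_m) : row_mx t x *m l = t.
  by rewrite mul_row_col mulmx1 mulmx0 addr0.
pose Q1 (x : 'rV[K]_(1 + m)) := Q' (rsubmx x).
have QE' (s : 'M[K]_1) x : Q (row_mx s x) = s 0 0 * (x *m l) 0 0 + Q1 x.
  have -> : x *m l = lsubmx (x : 'M[K]_(1, 1 + m)).
    by rewrite -{1}[x](@hsubmxK _ _ 1 m) lE.
  by rewrite -{1}[x](@hsubmxK _ _ 1 m) QE.
(* The solution a of t a(t, x) + q(t z + x P) = Q'(x), once q(x P) = Q'(x). *)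
pose ah (z : 'rV[K]_(k + k)) (P : 'M[K]_(m, k + k)) : 'cV[K]_(1 + m) :=
  col_mx (- (hyperbolic_form z)%:M)
         (\col_i - polar (@hyperbolic_form K k) z (row i P)).
have ahE (t : 'M[K]_1) (x : 'rV_m) z P : (row_mx t x *m ah z P) 0 0 =
   - (t 0 0 * hyperbolic_form z) - polar (@hyperbolic_form K k) z (x *m P).
  rewrite mul_row_col mxE; congr (_ + _).
    by rewrite mulmxN !mxE big_ord1 !mxE.
  rewrite [x *m P]mulmx_sum_row (polar_sumr Hq) mxE -sumrN; apply: eq_bigr => i _.
  by rewrite polarZr// !mxE mulrN.
pose h (p : 'rV[K]_(k + k) * 'M[K]_(m, k + k)) :=
  emb (ah p.1 p.2) l (col_mx p.1 p.2 : 'M[K]_(1 + m, _)).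
have hI : injective h.
  by move=> [a P] [a' P'] /emb_inj[/= _ _ /eq_col_mx[-> ->]].
rewrite -[X in (_ ^ X)%N]mul1n -(card_mx K 1 (k + k)) -cardsT -cardsX -(card_imset _ hI).
apply: eq_card => phi.
rewrite inE; have [a [b [P ->]]] := embE phi.
have hypE (t : 'M[K]_1) (x : 'rV_m) z (R : 'M[K]_(m, k + k)) :
   hyperbolic_form (row_mx t x *m col_mx z R) =
   t 0 0 ^+ 2 * hyperbolic_form z + hyperbolic_form (x *m R)
   + t 0 0 * polar (@hyperbolic_form K k) z (x *m R).
  rewrite mul_row_col qformD// [t in LHS]mx11_scalar mul_scalar_mx Hq.1.
  by rewrite polarZl.
apply/idP/imsetP => [/(e1_isoms _ _ _ QE')[-> + hl]|[[a' P'] + ->]].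
  rewrite -[P](@vsubmxK _ 1 m) in hl *.
  move: (usubmx P) (dsubmx P) hl => z R hl hp.
  have hR (x : 'rV_m) : hyperbolic_form (x *m R) = Q' x.
    have := hp (row_mx 0 x); rewrite lE [(0 : 'M[K]_1) 0 0]mxE mulr0 add0r hypE [(0 : 'M[K]_1) 0 0]mxE expr2 !mul0r.
    by rewrite add0r addr0 /Q1 row_mxKr.
  exists (z, R) => /=.
    rewrite inE /= inE /=; apply/isomsP; split=> //; apply/row_freeP0 => x xR.
    have := hl (row_mx 0 x); rewrite lE mul_row_col mul0mx xR addr0.
    by move=> /(_ erefl erefl)/(congr1 rsubmx); rewrite row_mxKr linear0.
  rewrite /h /=; congr (emb _ _ _); apply/matrixP => i j; rewrite ord1.
  have E (x : 'rV_m) (s : 'M[K]_1) : s 0 0 = 1 ->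
     (row_mx s x *m a) 0 0 = (row_mx s x *m ah z R) 0 0.
    move=> s1; have := hp (row_mx s x); rewrite lE hypE /Q1 row_mxKr ahE s1 hR.
    rewrite mulr1 expr1n !mul1r => e; apply/eqP; rewrite -subr_eq0; apply/eqP.
    move: e; set u := (_ *m a) 0 0; set p := polar _ _ _; set c := hyperbolic_form z.
    move=> e; have : u + (c + Q' x + p) - Q' x = 0 by rewrite e subrr.
    by move=> <-; ring.
  have E1 := E 0 1%:M.
  have [/eqP i0|i0] := boolP (i == 0).
    have := E1; rewrite mxE eqxx => /(_ erefl).
    have -> : row_mx 1%:M 0 = delta_mx 0 i :> 'rV[K]_(1 + m).
      rewrite i0; apply/matrixP => a0 b0; rewrite !mxE !ord1.
      by case: splitP => j' ej; rewrite mxE -[b0 == 0](inj_eq val_inj) /= ej ?ord1.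
    by rewrite -!rowE !mxE.
  have := E1; rewrite mxE eqxx => /(_ erefl) e0.
  have [j' ij] : exists j', i = rshift 1 j'.
    case: (splitP i) => j' ej; last by exists j'; apply: val_inj.
    by move/eqP: i0; case; apply: val_inj; rewrite /= ej !ord1.
  have := E (delta_mx 0 j') 1%:M; rewrite mxE eqxx => /(_ erefl) e2.
  (* The relation determines a only where t is nonzero, so the remaining entries are obtained as
     differences of two values at t = 1. *)
  have dE (c : 'cV[K]_(1 + m)) : c i 0 =
     (row_mx 1%:M (delta_mx 0 j') *m c) 0 0 - (row_mx 1%:M 0 *m c) 0 0.
    rewrite -[c](@vsubmxK _ 1 m) !mul_row_col ij col_mxEd mul0mx addr0.
    have mE (A B : 'M[K]_1) : (A + B) 0 0 = A 0 0 + B 0 0 by rewrite mxE.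
    by rewrite mE addrAC subrr add0r -rowE !mxE.
  by rewrite dE e0 e2 -dE.
rewrite inE /= inE /= => /isomsP[/row_freeP0 pf hp].
apply/(e1_isoms _ _ _ QE'); split=> // x.
  rewrite -[x](@hsubmxK _ _ 1 m) lE ahE hypE /Q1 row_mxKr hp.
  by ring.
rewrite -[x](@hsubmxK _ _ 1 m) lE => ->; rewrite mul_row_col mul0mx add0r.
by move=> /pf ->; rewrite row_mx0.
Qed.

End IsometryReduction.

(** * Anisotropic forms and hyperbolic splittings over a finite field *)

Section Anisotropic.
Variable K : finFieldType.
Implicit Types (k m n : nat).

Lemma card_row_free n k : #|[set l : 'M[K]_(n.+1, k) | row_free l]| =
  (#|[set l : 'M[K]_(n, k) | row_free l]| * (#|K| ^ k - #|K| ^ n))%N.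
Proof.
rewrite -sum1_card (partition_big (@dsubmx _ 1 n _) (fun l => row_free l)) /=.
  rewrite -[X in (X * _)%N]sum1_card big_distrl /=.
  rewrite [RHS](eq_bigl (fun l => row_free l)); last by move=> l; rewrite inE.
  apply: eq_bigr => l lf; rewrite mul1n sum1dep_card.
  have -> : (#|K| ^ n)%N = #|[set x : 'rV[K]_k | (x <= l)%MS]|.
    rewrite -[n in LHS]mul1n -(card_mx K 1 n) -cardsT.
    rewrite -(card_imset _ (row_free_inj lf)); apply: eq_card => x.
    rewrite inE; apply/imsetP/submxP => [[z _ ->]|[z ->]]; first by exists z.
    by exists z; rewrite ?inE.
  have -> : (#|K| ^ k)%N = #|[set: 'rV[K]_k]| by rewrite cardsT card_mx mul1n.
  rewrite -cardsDS ?subsetT// -(card_imset _ (can_inj (@col_mxKu _ 1 n k ^~ l))).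
  have rfE (x : 'rV[K]_k) : row_free (col_mx x l) = ~~ (x <= l)%MS.
    apply/idP/idP => [/row_freeP0 h|h].
      apply/submxP => -[z xz]; have := h (row_mx 1%:M (- z)).
      rewrite mul_row_col mul1mx mulNmx xz subrr => /(_ erefl).
      move=> /(congr1 lsubmx); rewrite row_mxKl linear0 => /matrixP/(_ 0 0)/eqP.
      by rewrite !mxE oner_eq0.
    apply/row_freeP0 => z; rewrite -[z](@hsubmxK _ _ 1 n) mul_row_col.
    set s := lsubmx z; set r := rsubmx z => e.
    have s0 : s = 0.
      apply: contraNeq h => s0; have s00 : s 0 0 != 0.
        by apply: contra s0 => /eqP s00; rewrite [s]mx11_scalar s00 raddf0.
      apply/submxP; exists (- (s 0 0)^-1 *: r).
      move/eqP: e; rewrite addr_eq0 {1}[s]mx11_scalar mul_scalar_mx => /eqP e.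
      rewrite -scalemxAl scaleNr -scalerN -e scalerA mulVf// scale1r //.
    move: e; rewrite s0 mul0mx add0r => e.
    by rewrite ((row_freeP0 l).1 lf _ e) row_mx0.
  apply: eq_card => M; rewrite inE; apply/andP/imsetP => [[]|[x]].
    rewrite inE -{1 3}[M](@vsubmxK _ 1 n) => + /eqP e; rewrite e rfE => h.
    by exists (usubmx M) => //; rewrite !inE andbT.
  by case/setDP=> _; rewrite inE => h ->; rewrite inE rfE h col_mxKd eqxx.
move=> M; rewrite inE -{1}[M](@vsubmxK _ 1 n) => /row_freeP0 h.
apply/row_freeP0 => z e; have := h (row_mx (0 : 'M[K]_1) z).
rewrite (@mul_row_col _ 1 1 n k) mul0mx e addr0 => /(_ erefl)/(congr1 (@rsubmx _ 1 1 n)).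
by rewrite (@row_mxKr _ 1 1 n) linear0.
Qed.

(** If x is killed by the first half l of an isometry, its image is isotropic, so x = 0: l is
    automatically injective. For each such l the second half solves the linear system of
    [lin_count]. *)
Lemma card_isoms_anisotropic n k (Q : 'rV[K]_n -> K) :
  quadratic_form Q -> (forall x, Q x = 0 -> x = 0) ->
  (#|isoms k Q| * #|K| ^ (n * n.+1)./2 =
   #|[set l : 'M[K]_(n, k) | row_free l]| * #|K| ^ (n * k))%N.
Proof.
move=> Qq Q0; pose T := tri_gram Q (delta_mx 0).
have Ttri : is_tri T by apply: tri_gram_is_tri.
have QT := quadratic_tform Qq.
have isoE phi : (phi \in isoms k Q) =
    row_free (lsubmx phi) && (gram_of phi == T).
  apply/idP/andP => [/isomsP[pf hp]|[lf /eqP /(gram_ofP _ Ttri) hp]].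
    split; last by apply/eqP/(gram_ofP _ Ttri) => x; rewrite hp QT.
    apply/row_freeP0 => x xl; apply: Q0; rewrite -hp -[phi]hsubmxK mul_mx_row xl.
    by rewrite hyperbolic_row mul0mx mxE.
  apply/isomsP; split; last by move=> x; rewrite hp QT.
  apply/row_freeP0 => x; rewrite -[phi]hsubmxK mul_mx_row -[0 in X in X -> _]row_mx0.
  by case/eq_row_mx => /((row_freeP0 _).1 lf).
rewrite -[#|isoms k Q|]sum1_card (partition_big (@lsubmx _ _ _ _) (fun l => row_free l)).
  rewrite -[X in (_ = X * _)%N]sum1_card !big_distrl /=.
  rewrite [RHS](eq_bigl (fun l => row_free l)); last by move=> l; rewrite inE.
  apply: eq_bigr => l lf; rewrite mul1n -(lin_count lf Ttri); congr (_ * _)%N.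
  rewrite sum1dep_card -(card_imset _ (can_inj (@row_mxKr _ n k k l))).
  apply: eq_card => phi; rewrite inE isoE; apply/andP/imsetP => [[]|[Y]].
    move=> /andP[_ h] /eqP e; exists (rsubmx phi); last by rewrite -e hsubmxK.
    by rewrite inE -e.
  by rewrite inE => e ->; rewrite row_mxKl lf eqxx /= /gram_of row_mxKl row_mxKr.
by move=> phi; rewrite isoE => /andP[].
Qed.

(** Squaring is at most two-to-one and 0 has a single root, so the squares fill more than half of
    K. *)
Lemma card_squares : (#|K| < 2 * #|[set x ^+ 2 | x in [set: K]]|)%N.
Proof.
set S := [set x ^+ 2 | x in [set: K]].
have S0 : 0 \in S by apply/imsetP; exists 0; rewrite ?inE// expr2 mul0r.
rewrite -[X in (X < _)%N]sum1_card (partition_big (fun x => x ^+ 2) (mem S)) /=; last first.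
  by move=> x _; apply/imsetP; exists x; rewrite ?inE.
rewrite (bigD1 0)//= (eq_bigl (pred1 0)); last by move=> x; rewrite /= expf_eq0.
rewrite big_pred1_eq [#|S|](cardsD1 0) S0.
pose S' := S :\ 0; rewrite -/S'; apply: (@leq_ltn_trans (1 + \sum_(s in S') 2)%N); last first.
  by rewrite sum_nat_const mulnDr [(#|S'| * 2)%N]mulnC ltn_add2r.
rewrite leq_add2l [X in (X <= _)%N](eq_bigl (fun s => s \in S')).
  apply: leq_sum => s; rewrite !inE => /andP[_ /imsetP[x _ ->]].
  rewrite sum1dep_card; apply: (@leq_trans #|[set x; - x]|).
    by apply: subset_leq_card; apply/fintype.subsetP => y; rewrite !inE eqf_sqr.
  by rewrite cards2; case: (_ != _).
by move=> s; rewrite !inE andbC.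
Qed.

(** Pigeonhole for a S and c - b S, where S is the set of squares. *)
Lemma sum_two_squares (a b c : K) : a != 0 -> b != 0 ->
  exists s t, a * s ^+ 2 + b * t ^+ 2 = c.
Proof.
move=> a0 b0; set S := [set x ^+ 2 | x in [set: K]].
pose A := [set a * x | x in S]; pose B := [set c - b * x | x in S].
have cA : #|A| = #|S| by rewrite card_imset//; apply: mulfI.
have cB : #|B| = #|S|.
  by rewrite card_imset// => x y /addrI/oppr_inj; apply: mulfI.
have : A :&: B != finset.set0.
  apply/eqP => AB; have := cardsUI A B; rewrite AB cards0 addn0 cA cB addnn -mul2n.
  have := card_squares; rewrite -/S => h e; have := max_card (mem (A :|: B)).
  by rewrite e leqNgt h.
case/set0Pn => z /setIP[/imsetP[_ /imsetP[s _ ->] zs] /imsetP[_ /imsetP[t _ ->] zt]].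
by exists s, t; rewrite -zs zt subrK.
Qed.

Lemma polar_orth_exists n m (Q : 'rV[K]_n -> K) (u : 'M[K]_(m, n)) :
  quadratic_form Q -> exists C : 'M[K]_n, [/\ forall i (z : 'rV_n), (z <= C)%MS ->
     polar Q (row i u) z = 0, forall z : 'rV_n,
     (forall i, polar Q (row i u) z = 0) -> (z <= C)%MS & (n - m <= \rank C)%N].
Proof.
move=> Qq; pose T := tri_gram Q (delta_mx 0).
have pE x y : polar Q x y = (y *m (T + T^T) *m x^T) 0 0.
  have QT := quadratic_tform Qq.
  by rewrite polarC {1}/polar !QT -tform_polar.
pose D := (T + T^T) *m u^T.
have DE i (z : 'rV_n) : polar Q (row i u) z = (z *m D) 0 i.
  by rewrite pE tr_row colE mulmxA -colE mxE /D mulmxA.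
exists (kermx D); split.
- by move=> i z /sub_kermxP h; rewrite DE h mxE.
- by move=> z h; apply/sub_kermxP/matrixP => i j; rewrite ord1 -DE h mxE.
- by rewrite mxrank_ker leq_sub2l// rank_leq_col.
Qed.

(** In odd characteristic three orthogonal vectors and [sum_two_squares] give an isotropic vector;
    in characteristic 2 two orthogonal vectors suffice. *)
Lemma anisotropic_dim n (Q : 'rV[K]_n -> K) :
  quadratic_form Q -> (forall x, Q x = 0 -> x = 0) -> (n <= 2)%N.
Proof.
move=> Qq Q0; rewrite leqNgt; apply/negP => n3.
pose x : 'rV[K]_n := delta_mx 0 (Ordinal (ltnW (ltnW n3))).
have x0 : x != 0.
  apply/eqP => /matrixP/(_ 0 (Ordinal (ltnW (ltnW n3))))/eqP.
  by rewrite !mxE !eqxx oner_eq0.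
have [C [Cx _ rC]] := polar_orth_exists x Qq.
have [y yC yx] : exists2 y : 'rV[K]_n, (y <= C)%MS & ~~ (y <= x)%MS.
  have /row_subPn[i hi] : ~~ (C <= x)%MS.
    apply/negP => /mxrankS; rewrite leqNgt.
    by rewrite (leq_ltn_trans (rank_leq_row _))//; apply: leq_trans rC; lia.
  by exists (row i C); rewrite ?row_sub.
have y0 : y != 0 by apply: contraNneq yx => ->; rewrite sub0mx.
have xy : polar Q x y = 0 by rewrite -(Cx 0 y yC) row_id.
have Qx : Q x != 0 by apply: contra x0 => /eqP/Q0 ->.
have Qy : Q y != 0 by apply: contra y0 => /eqP/Q0 ->.
have Qxy s t : Q (s *: x + t *: y) = Q x * s ^+ 2 + Q y * t ^+ 2.
  rewrite qformD !(Qq.1) polarZl// polarZr// xy !mulr0 addr0.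
  by rewrite (mulrC (s ^+ 2)) (mulrC (t ^+ 2)).
have [D [Dx _ rD]] := polar_orth_exists (col_mx x y) Qq.
have [z zD z0] : exists2 z : 'rV[K]_n, (z <= D)%MS & z != 0.
  have /rowV0Pn[z] : D != 0 by rewrite -mxrank_eq0 -lt0n; apply: leq_trans rD; lia.
  by exists z.
have xz : polar Q x z = 0.
  have := Dx (lshift 1 0) z zD; rewrite (@rowKu _ 1 1 n) row_id//.
have yz : polar Q y z = 0.
  have := Dx (rshift 1 0) z zD; rewrite (@rowKd _ 1 1 n) row_id//.
(* In characteristic 2 squaring is bijective, so the plane of x and y already contains an isotropic
   vector. *)
have [two0|two0] := eqVneq (2 : K) 0.
  have sqI : injective (fun w : K => w ^+ 2).
    move=> u w /eqP; rewrite eqf_sqr => /orP[/eqP//|/eqP ->].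
    by apply/eqP; rewrite -subr_eq0 -opprD oppr_eq0 -mulr2n -mulr_natl two0 mul0r.
  have [h _ hK] := injF_bij sqI.
  have : Q (h (- Q y / Q x) *: x + 1 *: y) = 0.
    by rewrite Qxy (hK (- Q y / Q x)) mulrCA mulfV// mulr1 expr1n mulr1 addNr.
  move=> /Q0/eqP; rewrite addrC addr_eq0 scale1r -scaleNr => /eqP e.
  by move: yx; rewrite e scalemx_sub.
have [s [t st]] := sum_two_squares (- Q z) Qx Qy.
have pz : polar Q (s *: x + t *: y) z = 0.
  by rewrite polarDl// !polarZl// xz yz !mulr0 addr0.
have : Q (s *: x + t *: y + z) = 0 by rewrite qformD Qxy st pz addNr addr0.
(* Anisotropy forces s x + t y = -z, so z is orthogonal to itself and 2 Q(z) = 0. *)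
move=> /Q0/eqP; rewrite addr_eq0 => /eqP e.
move: pz; rewrite e polarC polarNr// polar_self// => /eqP.
rewrite oppr_eq0 mulf_eq0 (negPf two0) /= => /eqP/Q0 zz.
by rewrite zz eqxx in z0.
Qed.

(** The polar form itself may be degenerate: in characteristic 2 its radical may contain vectors on
    which Q does not vanish. *)
Definition nonsingular n (Q : 'rV[K]_n -> K) :=
  forall x, Q x = 0 -> (forall y, polar Q x y = 0) -> x = 0.

Lemma quadratic_mul m n (Q : 'rV[K]_n -> K) (M : 'M[K]_(m, n)) :
  quadratic_form Q -> quadratic_form (fun x => Q (x *m M)).
Proof.
move=> Qq; split=> [c x|x c y z]; first by rewrite -scalemxAl Qq.1.
by rewrite /polar !mulmxDl -!scalemxAl -!/(polar Q _ _) polarDr// polarZr.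
Qed.

(** An isotropic x is not in the radical of the polar form, by nonsingularity, so it has a partner;
    the orthogonal complement of the plane they span inherits nonsingularity. *)
Lemma hyperbolic_splitting n (Q : 'rV[K]_n -> K) (x : 'rV[K]_n) :
  quadratic_form Q -> nonsingular Q -> x != 0 -> Q x = 0 ->
  exists m, exists2 M : 'M[K]_(1 + (1 + m), n),
    row_free M /\ m.+2 = n & exists Q' : 'rV[K]_m -> K,
    [/\ quadratic_form Q', nonsingular Q' & forall (s t : 'M[K]_1) w,
       Q (row_mx s (row_mx t w) *m M) = s 0 0 * t 0 0 + Q' w].
Proof.
move=> Qq Qns x0 Qx.
have [y1 xy1] : exists y, polar Q x y != 0.
  apply/existsP; apply: contraT => /existsPn h.
  move: x0; rewrite (Qns x)// ?eqxx// => y; apply/eqP; have := h y.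
  by rewrite negbK.
pose y2 := (polar Q x y1)^-1 *: y1.
have xy2 : polar Q x y2 = 1 by rewrite polarZr// mulVf.
(* Since B(x, y2) = 1, subtracting Q(y2) x makes the partner isotropic without dividing by 2. *)
pose y := y2 - Q y2 *: x.
have xx : polar Q x x = 0 by rewrite polar_self// Qx mulr0.
have xy : polar Q x y = 1 by rewrite polarDr// polarNr// (polarZr Qq (Q y2)) xx mulr0 subr0.
have Qy : Q y = 0.
  rewrite qformD polarNr// qformN// (Qq.1 (Q y2)) Qx mulr0 addr0.
  by rewrite (polarZr Qq (Q y2)) (polarC _ y2) xy2 mulr1 subrr.
have yy : polar Q y y = 0 by rewrite polar_self// Qy mulr0.
clearbody y.
have [C [Cx xC rC]] := polar_orth_exists (col_mx x y) Qq.
pose m := \rank C; pose B := row_base C : 'M[K]_(m, n).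
have BC (w : 'rV[K]_m) : (w *m B <= C)%MS by rewrite -(eq_row_base C) submxMl.
have xB w : polar Q x (w *m B) = 0.
  by have := Cx (lshift 1 0) _ (BC w); rewrite (@rowKu _ 1 1 n) row_id.
have yB w : polar Q y (w *m B) = 0.
  by have := Cx (rshift 1 0) _ (BC w); rewrite (@rowKd _ 1 1 n) row_id.
pose M : 'M[K]_(1 + (1 + m), n) := col_mx x (col_mx y B).
have ME (s t : 'M[K]_1) w : row_mx s (row_mx t w) *m M =
    s 0 0 *: x + (t 0 0 *: y + w *m B).
  by rewrite !mul_row_col {1}[s]mx11_scalar {1}[t]mx11_scalar !mul_scalar_mx.
have Mf : row_free M.
  apply/row_freeP0 => z; rewrite -[z](@hsubmxK _ _ 1 (1 + m)).
  rewrite -[rsubmx z](@hsubmxK _ _ 1 m) ME.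
  set s := lsubmx z; set t := lsubmx _; set w := rsubmx _ => e.
  have := congr1 (polar Q x) e; have := congr1 (polar Q y) e.
  rewrite !(polar0r Qq) !polarDr// !polarZr// (polarC Q y x) xy xx yy xB yB.
  rewrite !(mulr0, mulr1, addr0, add0r) => s0 t0.
  move: e; rewrite s0 t0 !scale0r !add0r => /((row_freeP0 B).1 (row_base_free C)) ->.
  by rewrite [s]mx11_scalar [t]mx11_scalar s0 t0 raddf0 !row_mx0.
have mn : m.+2 = n.
  apply/eqP; rewrite eqn_leq; apply/andP; split.
    by have := rank_leq_col M; rewrite (eqP Mf).
  by move: rC; rewrite -/m; lia.
exists m, M; first by [].
exists (fun w => Q (w *m B)); split; first exact: quadratic_mul.
  move=> w Qw hw; apply: ((row_freeP0 B).1 (row_base_free C)).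
  apply: Qns => // v.
  have [r ->] : exists r, v = r *m M.
    have /submxP[r ->] : (v <= M)%MS; last by exists r.
    by rewrite submx_full// /row_full (eqP Mf) add1n add1n mn.
  rewrite -[r](@hsubmxK _ _ 1 (1 + m)) -[rsubmx r](@hsubmxK _ _ 1 m) ME.
  rewrite !polarDr// !polarZr// (polarC _ _ x) (polarC _ _ y) xB yB !mulr0 !add0r.
  by have := hw (rsubmx (rsubmx r)); rewrite /polar -mulmxDl.
move=> s t w; rewrite ME 2!qformD !Qq.1 Qx Qy !mulr0 !add0r polarDr//.
by rewrite !polarZl// polarZr// yB xB xy !mulr0 mulr1 !addr0 addrC.
Qed.

End Anisotropic.

(** * Closed form of the number of injective isometries *)

Section ClosedForm.
Variables (R : realType) (K : finFieldType).
Implicit Types (d j k m n r t : nat).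
Local Notation f := (#|K|%:R : R).

Lemma card_gt1 : 1 < f.
Proof. by rewrite ltr1n card_finNzRing_gt1. Qed.

Lemma card_gt0 : 0 < f.
Proof. exact: lt_trans card_gt1. Qed.

Lemma card_neq0 : f != 0.
Proof. by rewrite gt_eqF// card_gt0. Qed.

Hint Resolve card_neq0 : core.

Lemma fexpD (a b : int) : f ^ (a + b) = f ^ a * f ^ b.
Proof. exact: expfzDr. Qed.

(* The density of primitive isometries into the hyperbolic space of dimension
   2k from the sum of j hyperbolic planes, an anisotropic space of dimension d
   and a radical of dimension r depends only on d and t = j + r. *)
Definition prim_density d t k : R :=
  if (d == 0%N) && (t == 0%N) then 1 else
  (1 - f ^ (- k%:Z)) *
  (if d == 0%N then 1 + f ^ (t%:Z - k%:Z)
   else if d == 1%N then 1 else 1 - f ^ (t.+1%:Z - k%:Z)) *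
  \prod_(1 <= i < if d == 0%N then t else t.+1) (1 - f ^ (2 * i%:Z - 2 * k%:Z)).

Lemma prod_shift t k :
  \prod_(1 <= i < t.+2) (1 - f ^ (2 * i%:Z - 2 * k.+1%:Z)) =
  (1 - f ^ (- k%:Z)) * (1 + f ^ (- k%:Z)) *
  \prod_(1 <= i < t.+1) (1 - f ^ (2 * i%:Z - 2 * k%:Z)).
Proof.
rewrite big_ltn// big_add1 /=; congr (_ * _).
  rewrite (_ : 2 * 1%:Z - 2 * k.+1%:Z = - k%:Z + - k%:Z); last by lia.
  by rewrite fexpD; ring.
by apply: eq_bigr => i _; congr (1 - f ^ _); lia.
Qed.

(** Splitting off a hyperbolic plane and splitting off a radical vector both lower t and k by 1 and
    contribute this same factor; hence the dependence on t = j + r alone. *)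
Lemma prim_densityS d t k : prim_density d t.+1 k.+1 =
  (1 - f ^ (- k.+1%:Z)) * (1 + f ^ (- k%:Z)) * prim_density d t k.
Proof.
rewrite /prim_density andbF; have [_|_] /= := eqVneq d 0%N.
  case: t => [|t] /=.
    by rewrite big_geq// mulr1 mulr1 (_ : 1%:Z - k.+1%:Z = - k%:Z)//; lia.
  rewrite prod_shift (_ : t.+2%:Z - k.+1%:Z = t.+1%:Z - k%:Z); last by lia.
  ring.
rewrite prod_shift (_ : t.+2%:Z - k.+1%:Z = t.+1%:Z - k%:Z); last by lia.
by case: ifP => _; ring.
Qed.

(** Number of unknowns minus number of equations; the exponent that normalizes the local density. *)
Definition dim_exp n k : int := (2 * k * n)%N%:Z - (n * n.+1)./2%:Z.

Lemma dim_exp_base n k : dim_exp n k + (n * n.+1)./2%:Z = (n * k + n * k)%N%:Z.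
Proof. by rewrite /dim_exp; lia. Qed.

Lemma halfS n : ((n.+1 * n.+2)./2 = (n * n.+1)./2 + n.+1)%N.
Proof.
rewrite (_ : n.+1 * n.+2 = n * n.+1 + n.+1.*2)%N; last by lia.
by rewrite halfD odd_double andbF add0n doubleK.
Qed.

(** The cardinality (f^(k+1) - 1)(f^k + 1) of the cone, divided by f^(2k+1), is the factor of
    [prim_densityS]; f^c stands for the free parameters of either reduction. *)
Lemma cone_step k c (N : nat) (E E' : int) (D : R) :
  E' = (k.+1 + k + c)%N%:Z + E -> N%:R = f ^ E * D ->
  (#|cone K k.+1| * (#|K| ^ c * N))%N%:R =
  f ^ E' * ((1 - f ^ (- k.+1%:Z)) * (1 + f ^ (- k%:Z)) * D).
Proof.
move=> -> ND; rewrite card_cone !natrM ND natrD natrB ?expn_gt0 ?(ltnW (card_finNzRing_gt1 K))//.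
rewrite !natrX !exprnP fexpD !PoszD !fexpD.
rewrite -!invr_expz; field.
by rewrite !expfz_neq0.
Qed.

(** Induction on the dimension: [j] hyperbolic planes are split off until an anisotropic kernel of
    dimension [d] is left. *)
Lemma nonsingular_count n (Q : 'rV[K]_n -> K) :
  quadratic_form Q -> nonsingular Q ->
  exists j d, [/\ n = (j + j + d)%N, (d <= 2)%N & forall k, (j <= k)%N ->
    #|isoms k Q|%:R = f ^ (dim_exp n k) * prim_density d j k].
Proof.
have [N] := ubnP n; elim: N n Q => // N IH n Q; rewrite ltnS => nN Qq Qns.
have [/existsP[x /andP[x0 /eqP Qx]]|/existsPn h] :=
    boolP [exists x, (x != 0) && (Q x == 0)].
  have [m [M [Mf mn] [Q' [Q'q Q'ns QE]]]] := hyperbolic_splitting Qq Qns x0 Qx.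
  have [|j [d [mE d2 hk]]] := IH m Q' _ Q'q Q'ns; first by apply: leq_trans nN; lia.
  exists j.+1, d; split=> //; first by rewrite -mn mE; lia.
  case=> // k jk.
  rewrite -(card_isoms_basis k.+1 Q Mf) ?add1n//.
  rewrite (card_isoms_hyperbolic k Q'q QE) prim_densityS.
  apply: cone_step (hk _ jk).
  by rewrite -mn /dim_exp !halfS; lia.
have Qan x : Q x = 0 -> x = 0.
  by move=> Qx; have := h x; rewrite Qx eqxx andbT negbK => /eqP.
have n2 := anisotropic_dim Qq Qan.
exists 0%N, n; split=> // k _.
have := card_isoms_anisotropic k Qq Qan.
move=> /(congr1 (fun z : nat => z%:R : R)); rewrite !natrM !natrX => e.
apply: (@mulIf _ (f ^+ (n * n.+1)./2)); first by rewrite expf_neq0.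
rewrite e -mulrA [prim_density _ _ _ * _]mulrC mulrA [in RHS]exprnP -fexpD dim_exp_base.
rewrite PoszD fexpD -!exprnP -mulrA mulrC; congr (_ * _).
have rf0 : #|[set l : 'M[K]_(0, k) | row_free l]| = 1%N.
  rewrite -[RHS](expn0 #|K|) -(card_mx K 0 k) -cardsT; apply: eq_card => l.
  by rewrite !inE /row_free; apply/eqP; rewrite [l]flatmx0 mxrank0.
have kE : f ^+ k * f ^ (- k%:Z) = 1 by rewrite exprnP -fexpD subrr.
have B1 : (#|K| ^ k - 1)%N%:R = f ^+ k * (1 - f ^ (- k%:Z)).
  by rewrite natrB ?expn_gt0 ?(ltnW (card_finNzRing_gt1 K))// natrX mulrBr kE mulr1.
case: n n2 {Q Qq Qns nN h Qan e} => [|[|[|//]]] _.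
- by rewrite rf0 mul0n expr0 mul1r.
- rewrite card_row_free rf0 mul1n expn0 mul1n /prim_density /= big_geq// !mulr1.
  exact: B1.
- rewrite !card_row_free rf0 mul1n expn0 expn1 /prim_density /= big_geq// mulr1.
  rewrite natrM B1 mul2n -addnn exprD.
  (* For k = 0 the natural subtraction f^k - f is truncated, but both sides vanish through 1 -
     f^0. *)
  case: k rf0 kE B1 => [|k] rf0 kE B1.
    by rewrite oppr0 expr0z subrr !(mul0r, mulr0).
  rewrite natrB; last by rewrite -{1}[#|K|]expn1 leq_exp2l// card_finNzRing_gt1.
  rewrite natrX -!mulrA; congr (_ * _); rewrite mulrCA; congr (_ * _).
  rewrite mulrBr mulr1 exprnP -fexpD; congr (_ - _).
  by rewrite -[LHS]expr1z; congr (_ ^ _); lia.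
Qed.

Lemma radical_count r a j d (Q : 'rV[K]_(r + a) -> K) (Q0 : 'rV[K]_a -> K) :
  Q0 0 = 0 -> (forall x, Q x = Q0 (rsubmx x)) ->
  (forall k, (j <= k)%N ->
    #|isoms k Q0|%:R = f ^ (dim_exp a k) * prim_density d j k) ->
  forall k, (j + r <= k)%N ->
    #|isoms k Q|%:R = f ^ (dim_exp (r + a) k) * prim_density d (j + r) k.
Proof.
move=> Q00; elim: r Q => [|r IH] Q QE hQ0 k.
  rewrite addn0 => /hQ0 <-; congr (_%:R); congr #|pred_of_set _|.
  apply: eq_isoms => x; rewrite QE; congr Q0; apply/matrixP => i i'.
  by rewrite mxE; congr (x _ _); apply: val_inj.
case: k => [|k]; rewrite addnS // ltnS => jk.
pose Q1 (x : 'rV[K]_(r + a)) := Q0 (rsubmx x).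
have Q1E (s : 'M[K]_1) x : Q (row_mx s x) = Q1 x.
  rewrite QE; congr Q0; apply/matrixP => i i'; rewrite !mxE.
  case: splitP => l /= e; first by have := ltn_ord l; rewrite -e.
  by congr (x _ _); apply: val_inj; move: e => /= [].
rewrite (@card_isoms_radical _ (r + a) k Q Q1) //; last by rewrite /Q1 linear0.
rewrite prim_densityS; apply: cone_step (IH Q1 (fun=> erefl) hQ0 k jk).
by rewrite /dim_exp addSn halfS; lia.
Qed.

End ClosedForm.

(** * From Witt index and radical to the symbol of a form *)

Section Symbols.
Variables (R : realType) (K : finFieldType).
Local Notation f := (#|K|%:R : R).

(** With a = 2j + d and n = a + r, the number n - a/2 equals j + r, j + r + 1/2 or j + r + 1 for d =
    0, 1, 2, which matches the cases of [prim_density]. Whether the nonsingular part is split is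
    read off the counts instead of using Witt cancellation. *)
Lemma isoms_symbol n k (Q : 'rV[K]_n -> K) (W0 W1 : {vspace 'rV[K]_n}) :
  (0 < n)%N -> (n <= k)%N -> quadratic_form Q -> radical_decomposition Q W0 W1 ->
  let a := \dim W0 in
  let s := if odd a || (a == 0)%N then None else Some `[< split_form Q W0 >] in
  #|isoms k Q|%:R = f ^ (dim_exp n k) * ((1 - f ^ (- k%:Z)) *
   ((1 + chi R a s * f `^ (n%:R - a%:R / 2 - k%:R))
    * \prod_(1 <= i < n | i%:R < n%:R - a%:R / 2 :> R)
              (1 - f ^ (2 * i%:Z - 2 * k%:Z)))).
Proof.
move=> n0 nk Qq [W01 W010 Worth W1P W0ns] a.
pose r := \dim W1.
have arn : (r + a)%N = n.
  have := dimv_disjoint_sum W010; rewrite W01 dimvf /dim /= mul1n.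
  by move=> ->; rewrite addnC.
pose B1 : 'M[K]_(r, n) := \matrix_i tnth (vbasis W1) i.
pose B0 : 'M[K]_(a, n) := \matrix_i tnth (vbasis W0) i.
have BE p (X : p.-tuple 'rV[K]_n) (x : 'rV_p) :
    x *m (\matrix_i tnth X i) = \sum_i x 0 i *: X`_i.
  rewrite mulmx_sum_row; apply: eq_bigr => i _; rewrite rowK.
  by rewrite (tnth_nth 0).
have B1W x : x *m B1 \in W1.
  rewrite BE//; apply: memv_suml => i _; apply: memvZ.
  by rewrite -tnth_nth vbasis_mem// mem_tnth.
have B0W x : x *m B0 \in W0.
  rewrite BE//; apply: memv_suml => i _; apply: memvZ.
  by rewrite -tnth_nth vbasis_mem// mem_tnth.
have Bfree p (X : p.-tuple 'rV[K]_n) (x : 'rV_p) :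
    free X -> x *m (\matrix_i tnth X i) = 0 -> x = 0.
  move=> fX; rewrite BE// => e; apply/matrixP => i i'; rewrite ord1 mxE.
  by have /freeP := fX; apply; rewrite -[RHS]e; apply: eq_bigr.
have B1f (x : 'rV[K]_r) : x *m B1 = 0 -> x = 0.
  by apply: Bfree; apply: basis_free (vbasisP W1).
have B0f (x : 'rV[K]_a) : x *m B0 = 0 -> x = 0.
  by apply: Bfree; apply: basis_free (vbasisP W0).
have B0s w : w \in W0 -> exists x, w = x *m B0.
  move=> wW; exists (\row_i coord (vbasis W0) i w); rewrite BE//.
  by rewrite {1}(coord_vbasis wW); apply: eq_bigr => i _; rewrite mxE.
pose Q0 (x : 'rV[K]_a) := Q (x *m B0).
have Q0q : quadratic_form Q0 by apply: quadratic_mul.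
have Q0ns : nonsingular Q0.
  move=> x Qx hx; apply: B0f; apply: W0ns; split=> //; first exact: B0W.
  move=> y yW; have [z ->] := B0s _ yW.
  by have := hx z; rewrite /polar /Q0 -mulmxDl.
have [j [d [aE d2 hk]]] := nonsingular_count R Q0q Q0ns.
have hn k' : (j + r <= k')%N -> #|isoms k' Q|%:R =
    f ^ (dim_exp n k') * prim_density R K d (j + r) k'.
  have Mf : row_free (col_mx B1 B0).
    apply/row_freeP0 => z; rewrite -[z]hsubmxK mul_row_col => e.
    have e0 : rsubmx z *m B0 \in W1.
      by move/eqP: e; rewrite addrC addr_eq0 => /eqP ->; rewrite memvN B1W.
    have : rsubmx z *m B0 \in (W0 :&: W1)%VS by rewrite memv_cap B0W.
    rewrite W010 memv0 => /eqP z0; move: e; rewrite z0 addr0 => /B1f ->.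
    by rewrite (B0f _ z0) row_mx0.
  rewrite -(card_isoms_basis k' Q Mf arn) -[X in dim_exp X _]arn.
  apply: (@radical_count R K r a j d _ Q0) => //; first exact: qform0.
  move=> z; rewrite /Q0 -{1}[z]hsubmxK mul_row_col qformD.
  have /W1P[_ -> h] := B1W (lsubmx z).
  by rewrite h// addr0 add0r.
have fg0 := card_gt0 R K; have fn0 := card_neq0 R K; have fg1 := card_gt1 R K.
have nonempty k' : (#|isoms k' Q0| != 0)%N = (#|isoms k' Q0|%:R != 0 :> R).
  by rewrite pnatr_eq0.
(* For d = 0 the count at k = j is nonzero, and an injective isometry into H_j is onto by
   dimension. *)
have splitP0 : a = (j + j)%N -> split_form Q W0.
  move=> aj; have d0 : d = 0%N by lia.
  have : (#|isoms j Q0| != 0)%N.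
    rewrite nonempty hk// mulf_neq0 ?expfz_neq0// d0 /prim_density /=.
    have [_|j0] := eqVneq j 0%N; first exact: oner_neq0.
    apply/negP => /eqP e; have : (0:R) < 0; last by rewrite ltxx.
    rewrite -[X in _ < X]e !mulr_gt0//.
      by rewrite subr_gt0 -invr_expz invf_lt1 ?exprz_gt0// -exprnP exprn_egt1.
    rewrite big_nat; apply: prodr_gt0 => i /andP[_ ij]; rewrite subr_gt0.
    rewrite (_ : 2 * i%:Z - 2 * j%:Z = - (2 * (j - i))%N%:Z); last by lia.
    by rewrite -invr_expz invf_lt1 ?exprz_gt0// -exprnP exprn_egt1//; lia.
  rewrite -lt0n => /card_gt0P[phi /isomsP[pf hp]].
  have /row_fullP[B Bphi] : row_full phi by rewrite /row_full (eqP pf) aj.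
  have gl : linear (fun z : 'rV[K]_(j + j) => z *m B *m B0).
    by move=> c x y; rewrite !mulmxDl -!scalemxAl.
  pose g0 := GRing.isLinear.Build _ _ _ _ _ gl.
  pose g : {linear _ -> _} := HB.pack (fun z : 'rV[K]_(j + j) => z *m B *m B0) g0.
  exists j, (linfun g).
  have k0 : lker (linfun g) = 0%VS.
    apply/eqP/lker0P => x y; rewrite !lfunE /= => /eqP; rewrite -subr_eq0 -!mulmxBl.
    move=> /eqP/B0f e; apply/eqP; rewrite -subr_eq0.
    by rewrite -[x - y]mulmx1 -Bphi mulmxA e mul0mx.
  split=> //; last first.
    by move=> z; rewrite lfunE /= -/(Q0 _) -hp -mulmxA Bphi mulmx1.
  apply/eqP; rewrite eqEdim; apply/andP; split.
    by apply/subvP => _ /memv_imgP[x _ ->]; rewrite lfunE /=.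
  rewrite limg_dim_eq ?k0 ?capv0// dimvf /dim /= mul1n -/a aj.
  by [].
(* For d = 2 a splitting would give an isometry into H_(j+1), but the count at k = j + 1 contains
   the factor 1 - f^0. *)
have splitP2 : d = 2%N -> ~ split_form Q W0.
  move=> dE [m [g [g0 gW hg]]].
  have am : a = (m + m)%N.
    by rewrite /a -gW limg_dim_eq ?g0 ?capv0// dimvf /dim /= mul1n.
  have mj : m = j.+1 by lia.
  have : (#|isoms m Q0| != 0)%N; last first.
    rewrite nonempty mj hk//.
    by rewrite dE /prim_density /= subrr expr0z subrr mulr0 mul0r mulr0 eqxx.
  pose phi : 'M[K]_(a, m + m) := \matrix_i (g^-1)%VF (tnth (vbasis W0) i).
  have phiE (x : 'rV_a) : x *m phi = (g^-1)%VF (x *m B0).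
    rewrite mulmx_sum_row mulmx_sum_row linear_sum; apply: eq_bigr => i _.
    by rewrite linearZ !rowK.
  have gphi (x : 'rV_a) : g (x *m phi) = x *m B0.
    by rewrite phiE limg_lfunVK// gW.
  rewrite -lt0n; apply/card_gt0P; exists phi; apply/isomsP; split.
    apply/row_freeP0 => x e; apply: B0f; rewrite -gphi e linear0 //.
  by move=> x; rewrite -hg gphi.
move=> s; rewrite hn; last by apply: leq_trans nk; lia.
congr (_ * _); rewrite /prim_density.
have powE (z : int) (x : R) : x = z%:~R -> f `^ x = f ^ z.
  by move=> ->; rewrite powR_intmul// ltW.
have prodE (t : nat) : (t <= n)%N ->
    (forall i, (i%:R < n%:R - a%:R / 2 :> R) = (i < t)%N) ->
    \prod_(1 <= i < n | i%:R < n%:R - a%:R / 2 :> R)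
              (1 - f ^ (2 * i%:Z - 2 * k%:Z)) =
    \prod_(1 <= i < t) (1 - f ^ (2 * i%:Z - 2 * k%:Z)).
  move=> tn ht; rewrite (big_nat_widen _ _ _ _ _ tn); apply: eq_bigl => i.
  by rewrite ht.
case: d d2 aE {hk hn} splitP0 splitP2 => [|[|[|//]]] _ aE splitP0 splitP2 /=.
- have aE' : a = (j + j)%N by lia.
  have nE : n%:R - a%:R / 2 = (j + r)%:R :> R.
    by rewrite -arn aE' !natrD; field.
  have -> : chi R a s = 1.
    rewrite /s; have -> : odd a = false by rewrite aE' addnn odd_double.
    case: eqP => [->//|_] /=; have -> : `[< split_form Q W0 >] = true; last by [].
    by apply/asboolP; apply: splitP0.
  rewrite (prodE (j + r)%N); [|lia|by move=> i; rewrite nE ltr_nat].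
  have -> : (j + r == 0)%N = false by apply/eqP; lia.
  by rewrite nE mul1r -mulrA (powE ((j + r)%:Z - k%:Z)) // rmorphB /= !pmulrn.
- have nE : n%:R - a%:R / 2 = (j + r)%:R + 2^-1 :> R.
    by rewrite -arn aE !natrD; field.
  have -> : chi R a s = 0.
    by rewrite /s /chi; have -> : odd a by rewrite aE addn1 /= addnn odd_double.
  rewrite (prodE (j + r).+1); [|lia|].
    by rewrite mul0r addr0 mul1r mulr1.
  move=> i; rewrite nE; apply/idP/idP => [h|h].
    have : (i%:R < (j + r).+1%:R :> R) by rewrite -natr1; lra.
    by rewrite ltr_nat.
  have : (i%:R <= (j + r)%:R :> R) by rewrite ler_nat.
  lra.
- have nE : n%:R - a%:R / 2 = (j + r).+1%:R :> R.
    by rewrite -arn aE -natr1 !natrD; field.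
  have -> : chi R a s = -1.
    rewrite /s; have -> : odd a = false by rewrite aE addn2 /= negbK addnn odd_double.
    have -> : (a == 0%N) = false by rewrite aE addn2.
    rewrite /=; have -> : `[< split_form Q W0 >] = false; last by [].
    by apply/asboolP; apply: splitP2.
  rewrite (prodE (j + r).+1); [|lia|by move=> i; rewrite nE ltr_nat].
  by rewrite nE mulN1r -mulrA (powE ((j + r).+1%:Z - k%:Z)) // rmorphB /= !pmulrn.
Qed.

End Symbols.

(** * The Gram equation under ring maps, perturbation and scaling *)

Section GramMorphism.

Lemma map_fold (A B : comNzRingType) (g : {rmorphism A -> B}) n (C : 'M[A]_n) :
  fold (map_mx g C) = map_mx g (fold C).
Proof.
apply/matrixP => i j; rewrite !mxE; case: eqP => // _.
by case: ifP => _; rewrite ?rmorphD ?rmorph0.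
Qed.

Lemma map_gram_of (A B : comNzRingType) (g : {rmorphism A -> B}) n k
    (phi : 'M[A]_(n, k + k)) :
  gram_of (map_mx g phi) = map_mx g (gram_of phi).
Proof. by rewrite /gram_of -map_fold map_mxM -map_trmx map_lsubmx map_rsubmx. Qed.

(** The polar form of the hyperbolic form pairs each half with the other, so phi (swap_mx Y)^T is
    the matrix of polar values between the rows of phi and those of Y. *)
Definition swap_mx (A : Type) n k (Y : 'M[A]_(n, k + k)) : 'M[A]_(n, k + k) :=
  row_mx (rsubmx Y) (lsubmx Y).

Lemma swap_mxK (A : Type) n k : involutive (@swap_mx A n k).
Proof. by move=> Y; rewrite /swap_mx row_mxKl row_mxKr hsubmxK. Qed.

(** Taylor expansion: for c = pi^(N+1) the last term vanishes modulo pi^(N+2), which leaves a linear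
    condition on Y. *)
Lemma gram_of_perturb (A : comNzRingType) n k (phi Y : 'M[A]_(n, k + k)) c :
  gram_of (phi + c *: Y) = gram_of phi + c *: fold (phi *m (swap_mx Y)^T)
     + (c * c) *: gram_of Y.
Proof.
have -> : fold (phi *m (swap_mx Y)^T) =
    fold (lsubmx phi *m (rsubmx Y)^T) + fold (lsubmx Y *m (rsubmx phi)^T).
  rewrite -{1}[phi]hsubmxK /swap_mx tr_row_mx mul_row_col foldD; congr (_ + _).
  by rewrite -fold_tr trmx_mul trmxK.
rewrite /gram_of scalerDr -!foldZ -!foldD; congr fold.
rewrite [lsubmx (_ + _)]linearD [rsubmx (_ + _)]linearD /=.
rewrite [lsubmx (c *: _)]linearZ [rsubmx (c *: _)]linearZ /=.
have -> : (rsubmx phi + c *: rsubmx Y)^T = (rsubmx phi)^T + c *: (rsubmx Y)^T.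
  by apply/matrixP => i j; rewrite !mxE.
by rewrite !(mulmxDl, mulmxDr) -!scalemxAl -!scalemxAr scalerA !addrA.
Qed.

Lemma mx_lin2E (A : comNzRingType) n (G F : 'M[A]_n) c i j :
  (G + c *: F) i j = G i j + c * F i j.
Proof. by rewrite !mxE. Qed.

Lemma mx_lin3E (A : comNzRingType) n (G F H : 'M[A]_n) c d i j :
  (G + c *: F + d *: H) i j = G i j + c * F i j + d * H i j.
Proof. by rewrite !mxE. Qed.

Lemma gram_of_scale (A : comNzRingType) n k (d : 'rV[A]_n) (phi : 'M[A]_(n, k + k)) :
  gram_of (diag_mx d *m phi) = \matrix_(i, j) (d 0 i * d 0 j * gram_of phi i j).
Proof.
apply/matrixP => i j; rewrite /gram_of -mulmx_lsub -mulmx_rsub trmx_mul tr_diag_mx.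
set X := lsubmx phi; set Z := (rsubmx phi)^T.
have -> : diag_mx d *m X *m (Z *m diag_mx d) =
    \matrix_(i, j) (d 0 i * d 0 j * (X *m Z) i j).
  apply/matrixP => a b; rewrite mulmxA mul_mx_diag -mulmxA mul_diag_mx !mxE.
  by ring.
rewrite !mxE; case: eqP => [->//|_]; case: ifP => _; last by rewrite mulr0.
by ring.
Qed.

End GramMorphism.

(** * Hensel lifting along the quotients by powers of pi *)

Section Tower.
Variables (o : comNzRingType) (pi : o) (K : finFieldType).
Variables (A : nat -> finComNzRingType).
Variables (red : forall N, {rmorphism o -> A N}) (res : {rmorphism o -> K}).
Hypothesis red_surj : forall N a, exists x, red N x = a.
Hypothesis red_ker : forall N x, red N x = 0 <-> exists y, x = pi ^+ N.+1 * y.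
Hypothesis res_surj : forall a, exists x, res x = a.
Hypothesis res_ker : forall x, res x = 0 <-> exists y, x = pi * y.
Hypothesis pi_reg : forall x y, pi * x = pi * y -> x = y.
Local Notation f := #|K|.

Definition lft N (a : A N) : o := projT1 (cid (red_surj a)).
Lemma lftK N a : red N (lft a) = a.
Proof. by rewrite /lft; case: cid. Qed.

Definition klft (a : K) : o := projT1 (cid (res_surj a)).
Lemma klftK a : res (klft a) = a.
Proof. by rewrite /klft; case: cid. Qed.

Lemma piX_reg m x y : pi ^+ m * x = pi ^+ m * y -> x = y.
Proof.
by elim: m => [|m IH]; rewrite ?expr0 ?mul1r// exprS -!mulrA => /pi_reg/IH.
Qed.

Lemma red_eq N x y : red N x = red N y <-> exists z, x = y + pi ^+ N.+1 * z.
Proof.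
split=> [e|[z ->]]; last first.
  by rewrite rmorphD (_ : red N (_ * z) = 0) ?addr0//; apply/red_ker; exists z.
have /red_ker[z hz] : red N (x - y) = 0 by rewrite rmorphB e subrr.
by exists z; rewrite -hz addrC subrK.
Qed.

Lemma res_eq x y : res x = res y <-> exists z, x = y + pi * z.
Proof.
split=> [e|[z ->]]; last first.
  by rewrite rmorphD (_ : res (_ * z) = 0) ?addr0//; apply/res_ker; exists z.
have /res_ker[z hz] : res (x - y) = 0 by rewrite rmorphB e subrr.
by exists z; rewrite -hz addrC subrK.
Qed.

Lemma red_le N M x y : (M <= N)%N -> red N x = red N y -> red M x = red M y.
Proof.
move=> MN /red_eq[z ->]; apply/red_eq; exists (pi ^+ (N - M) * z).
by rewrite mulrA -exprD addSn subnKC.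
Qed.

Lemma res_red N x y : red N x = red N y -> res x = res y.
Proof.
by move=> /red_eq[z ->]; apply/res_eq; exists (pi ^+ N * z); rewrite mulrA -exprS.
Qed.

Definition rs N (a : A N) : K := res (lft a).

Lemma rsE N x : rs (red N x) = res x.
Proof. by apply: (@res_red N); rewrite lftK. Qed.

Lemma map_rsE N m n (X : 'M[o]_(m, n)) : map_mx (@rs N) (map_mx (red N) X) = map_mx res X.
Proof. by apply/matrixP => i j; rewrite !mxE rsE. Qed.

Definition mlft N m n (X : 'M[A N]_(m, n)) := map_mx (@lft N) X.
Lemma mlftK N m n (X : 'M[A N]_(m, n)) : map_mx (red N) (mlft X) = X.
Proof. by apply/matrixP => i j; rewrite !mxE lftK. Qed.

(** [A N] is the quotient by pi^(N+1); an element of the next quotient is a class with one more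
    residue digit. *)
Definition extend N m n (p : 'M[A N]_(m, n) * 'M[K]_(m, n)) : 'M[A N.+1]_(m, n) :=
  map_mx (red N.+1) (mlft p.1 + pi ^+ N.+1 *: map_mx klft p.2).

Lemma extend_inj N m n : injective (@extend N m n).
Proof.
move=> [X Y] [X' Y'] /matrixP e.
have XX : X = X'.
  apply/matrixP => i j; have := e i j; rewrite !mxE /= => /(@red_le _ N _ _ (leqnSn N)).
  rewrite !rmorphD /= !lftK.
  have z x : red N (pi ^+ N.+1 * x) = 0 by apply/red_ker; exists x.
  by rewrite !z !addr0.
subst X'; congr (_, _); apply/matrixP => i j; have := e i j; rewrite !mxE /=.
move=> /red_eq[z]; rewrite -addrA => /addrI; rewrite (exprSr pi N.+1) -mulrA -mulrDr.
move=> /piX_reg ez; rewrite -[LHS]klftK -[RHS]klftK; apply/res_eq; exists z.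
exact: ez.
Qed.

Lemma extend_surj N m n (Z : 'M[A N.+1]_(m, n)) : exists p, Z = extend p.
Proof.
have h i j : exists y : K, Z i j = red N.+1 (lft (red N (lft (Z i j))) + pi ^+ N.+1 * klft y).
  have /red_eq[y hy] : red N (lft (Z i j)) = red N (lft (red N (lft (Z i j)))).
    by rewrite lftK.
  exists (res y); rewrite -{1}[Z i j]lftK {1}hy; apply/red_eq.
  have /res_eq[w hw] : res y = res (klft (res y)) by rewrite klftK.
  by exists w; rewrite {1}hw mulrDr addrA (exprSr pi N.+1) mulrA.
exists (\matrix_(i, j) red N (lft (Z i j)), \matrix_(i, j) projT1 (cid (h i j))).
by apply/matrixP => i j; rewrite !mxE; case: cid.
Qed.

Lemma card_A N : #|A N| = (f ^ N.+1)%N.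
Proof.
elim: N => [|N IH].
  have bij : bijective (@rs 0).
    exists (fun y => red 0 (klft y)) => [a|y]; last by rewrite rsE klftK.
    rewrite -[RHS]lftK; apply/red_eq.
    have /res_eq[z ->] : res (klft (rs a)) = res (lft a) by rewrite klftK.
    by exists z.
  by rewrite (bij_eq_card bij) expn1.
have := card_mx (A N.+1) 1 1; rewrite mul1n expn1 => <-.
rewrite expnSr -IH -[#|A N|]expn1 -[X in (_ * X)%N]expn1 -(card_mx (A N) 1 1) -(card_mx K 1 1).
rewrite -card_prod -(card_codom (@extend_inj N 1 1)); apply: eq_card => Z.
by rewrite !inE; apply/esym/codomP; have [p ->] := extend_surj Z; exists p.
Qed.

(** Being killed by pi^c modulo pi^(N+1) means vanishing modulo pi^(N+1-c), so this is the kernel of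
    the map from A N to A (N - c). *)
Lemma card_ann N c : (c <= N)%N ->
  #|[pred z : A N | red N (pi ^+ c) * z == 0]| = (f ^ c)%N.
Proof.
move=> cN; pose g (z : A N) := red (N - c) (lft z).
have gE x : g (red N x) = red (N - c) x.
  by apply: (@red_le N); rewrite ?leq_subr// lftK.
have ga : semi_additive g.
  split=> [|x y]; first by rewrite -(rmorph0 (red N)) gE rmorph0.
  by rewrite -[x]lftK -[y]lftK -rmorphD !gE rmorphD.
pose G : {additive A N -> A (N - c)%N} :=
  HB.pack g (GRing.isSemiAdditive.Build _ _ _ ga).
have := @card_fiber _ _ G [set: A (N - c)%N].
have gS x : x \in [set: A (N - c)%N] by rewrite inE.
move=> /(_ (fun=> gS _)) /(_ _ 0 (gS _)); rewrite cardsT !card_A.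
have -> : (f ^ N.+1 = f ^ c * f ^ (N - c).+1)%N.
  by rewrite -expnD addnS subnKC.
move=> /(_ _)/eqP; rewrite eqn_pmul2r ?expn_gt0 ?(ltnW (card_finNzRing_gt1 K))//.
move=> /(_ _)/eqP <-; last first.
  by move=> w _; have [x <-] := red_surj w; exists (red N x); rewrite /= gE.
apply: eq_card => z; rewrite !inE /= -[z]lftK gE -rmorphM.
apply/eqP/eqP => /red_ker[y].
  rewrite (_ : N.+1 = c + (N - c).+1)%N; last by rewrite addnS subnKC.
  by rewrite exprD -mulrA => /piX_reg ->; apply/red_ker; exists y.
move=> ->; apply/red_ker; exists y.
by rewrite mulrA -exprD addnS subnKC.
Qed.

Variables (n k : nat).

Definition prim N (phi : 'M[A N]_(n, k + k)) := row_free (map_mx (@rs N) phi).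

Definition sols N (T : 'M[o]_n) : {set 'M[A N]_(n, k + k)} :=
  [set phi | prim phi && (gram_of phi == map_mx (red N) T)].

Definition ksols (T : 'M[K]_n) : {set 'M[K]_(n, k + k)} :=
  [set phi | row_free phi && (gram_of phi == T)].

(** Hensel's lemma as a count: the lifts of phi are parametrized by Y over K, and the equation for a
    lift is linear in Y with the reduction of phi as matrix. Primitivity makes its solution number
    independent of the right-hand side. *)
Lemma sols_step N (T : 'M[o]_n) : is_tri T ->
  (#|sols N.+1 T| * f ^ (n * n.+1)./2 = #|sols N T| * f ^ (n * (k + k)))%N.
Proof.
move=> Ttri.
pose S := [set p | extend p \in sols N.+1 T].
have inS p : (p \in S) = (extend p \in sols N.+1 T) by rewrite [LHS]inE.
have -> : #|sols N.+1 T| = #|S|.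
  rewrite -(card_imset _ (@extend_inj N n (k + k))); apply: eq_card => Z.
  have [p ->] := extend_surj Z; apply/idP/imsetP => [h|[p']].
    by exists p; rewrite ?inS.
  by rewrite inS => h /extend_inj ->.
(* The right-hand side is (T - gram) / pi^(N+1). The default 0 of [xget] does no harm, since the
   first conjunct guarantees divisibility. *)
have SE phi Y : ((phi, Y) \in S) = (phi \in sols N T) &&
    (fold (map_mx res (mlft phi) *m (swap_mx Y)^T) ==
     map_mx res (\matrix_(i, j) xget 0 [set y |
        T i j = gram_of (mlft phi) i j + pi ^+ N.+1 * y]%classic)).
  set E := (\matrix_(i, j) _).
  pose Y' := map_mx klft Y.
  have Y'E : map_mx res Y' = Y by apply/matrixP => i j; rewrite !mxE klftK.
  rewrite inS !inE /= /prim /extend /= map_rsE.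
  have -> : map_mx res (mlft phi + pi ^+ N.+1 *: Y') = map_mx (@rs N) phi.
    apply/matrixP => i j; rewrite !mxE; apply/res_eq; exists (pi ^+ N * Y' i j).
    by rewrite [Y' i j]mxE mulrA -exprS.
  rewrite -andbA; congr (_ && _); rewrite map_gram_of gram_of_perturb.
  have entry i j : (map_mx (red N) T i j = gram_of phi i j) ->
      T i j = gram_of (mlft phi) i j + pi ^+ N.+1 * E i j.
    rewrite -[in gram_of phi](mlftK phi) map_gram_of mxE [in RHS]mxE.
    move=> /red_eq ex; rewrite [E i j]mxE; exact: (@xgetPex _ 0 (fun y => _ = _) ex).
  have eqN : (gram_of phi == map_mx (red N) T) ->
     T = gram_of (mlft phi) + pi ^+ N.+1 *: E.
    by move=> /eqP h; apply/matrixP => i j; rewrite entry ?h// !mxE.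
  apply/eqP/andP => [h|[/eqN hT /eqP hE]].
    have hN : gram_of phi == map_mx (red N) T.
      apply/eqP/matrixP => i j; have /matrixP/(_ i j) hij := h.
      rewrite [LHS]mxE [RHS]mxE in hij; rewrite [RHS]mxE -(red_le (leqnSn N) hij).
      rewrite -[in LHS](mlftK phi) map_gram_of [LHS]mxE; apply/red_eq.
      rewrite mx_lin3E.
      exists (- (fold (mlft phi *m (swap_mx Y')^T) i j + pi ^+ N.+1 * gram_of Y' i j)).
      by ring.
    split=> //; apply/eqP; have hT := eqN hN; rewrite {}hT in h.
    apply/matrixP => i j; have /matrixP/(_ i j) hij := h.
    rewrite [LHS]mxE [RHS]mxE in hij; move: hij => /red_eq[z].
    rewrite mx_lin3E mx_lin2E.
    rewrite -!addrA => /addrI; rewrite -mulrA -mulrDr (exprSr pi N.+1) -mulrA -mulrDr.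
    move=> /piX_reg ez; rewrite -Y'E.
    rewrite (_ : swap_mx (map_mx res Y') = map_mx res (swap_mx Y')); last first.
      by rewrite /swap_mx map_row_mx map_lsubmx map_rsubmx.
    rewrite map_trmx -map_mxM map_fold [LHS]mxE [RHS]mxE; apply/res_eq.
    exists (z - pi ^+ N * gram_of Y' i j).
    apply/eqP; rewrite -subr_eq0; move/eqP: ez; rewrite -subr_eq0 => /eqP <-.
    by apply/eqP; rewrite exprS; ring.
  rewrite hT; apply/matrixP => i j.
  have : map_mx res (fold (mlft phi *m (swap_mx Y')^T)) i j = map_mx res E i j.
    rewrite -hE -map_fold map_mxM -map_trmx /swap_mx map_row_mx map_lsubmx map_rsubmx.
    by rewrite Y'E.
  rewrite [LHS]mxE [RHS]mxE => /res_eq[z hz].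
  rewrite [LHS]mxE [RHS]mxE; apply/red_eq.
  exists (z + pi ^+ N * gram_of Y' i j).
  rewrite mx_lin3E mx_lin2E.
  by rewrite hz !exprS; ring.
rewrite -[#|S|]sum1_card (partition_big fst (mem (sols N T))) /=; last first.
  by move=> [phi Y]; rewrite SE => /andP[].
rewrite -[X in (_ = X * _)%N]sum1_card !big_distrl /=.
apply: eq_bigr => phi hphi; rewrite mul1n.
move: (hphi); rewrite inE => /andP[pf _].
have lf : row_free (map_mx res (mlft phi)) by rewrite -(map_rsE N) mlftK.
set E := (\matrix_(i, j) xget 0 [set y | T i j = gram_of (mlft phi) i j + pi ^+ N.+1 * y]%classic).
have Etri : is_tri (map_mx res E).
  apply/is_triP => i j ji.
  have /is_triP/(_ i j ji) T0 := Ttri.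
  have /is_triP/(_ i j ji) g0 := fold_tri (lsubmx (mlft phi) *m (rsubmx (mlft phi))^T).
  have ex : exists y, T i j = gram_of (mlft phi) i j + pi ^+ N.+1 * y.
    by exists 0; rewrite T0 g0 mulr0 addr0.
  have := @xgetPex _ 0 (fun y => _ = _) ex.
  rewrite [map_mx res E i j]mxE [E i j]mxE; set w := xget _ _.
  rewrite T0 g0 add0r -{1}(mulr0 (pi ^+ N.+1)) => /piX_reg <-.
  exact: rmorph0.
rewrite -(lin_count lf Etri); congr (_ * _)%N.
rewrite sum1dep_card -(card_imset _ (can_inj (@swap_mxK K n k))).
have pI : injective (fun Y : 'M[K]_(n, k + k) => (phi, Y)) by move=> Y Y' [].
rewrite -(card_imset _ pI); apply: eq_card => -[phi' Y]; rewrite inE SE.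
apply/andP/imsetP => [[/andP[_ h] /eqP /= e]|[Y1 /imsetP[Y2 + ->] [-> ->]]].
  rewrite e in h *; exists Y => //; apply/imsetP; exists (swap_mx Y); rewrite ?swap_mxK//.
  by rewrite inE.
by rewrite inE swap_mxK => h; rewrite hphi h eqxx.
Qed.

Lemma sols_count N (T : 'M[o]_n) : is_tri T ->
  (#|sols N T| * f ^ (N * (n * n.+1)./2) =
   #|ksols (map_mx res T)| * f ^ (N * (n * (k + k))))%N.
Proof.
move=> Ttri; elim: N => [|N IH].
  rewrite !mul0n !muln1.
  pose h (phi : 'M[A 0]_(n, k + k)) := map_mx (@rs 0) phi.
  have rs0 : injective (@rs 0).
    move=> a b; rewrite -[a]lftK -[b]lftK !rsE => /res_eq[z hz]; apply/red_eq.
    by exists z; rewrite expr1.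
  have hI : injective h.
    by move=> X Y /matrixP e; apply/matrixP => i j; have := e i j; rewrite !mxE => /rs0.
  rewrite -(card_imset _ hI); apply: eq_card => phi; rewrite inE.
  apply/imsetP/andP => [[psi + ->]|[pf /eqP hp]].
    rewrite inE => /andP[pf /eqP hp]; split=> //; apply/eqP.
    by rewrite -(mlftK psi) /h map_rsE map_gram_of -[in RHS](map_rsE 0) -hp
      -{2}(mlftK psi) map_gram_of map_rsE.
  have phiE : phi = h (map_mx (red 0) (map_mx klft phi)).
    by rewrite /h map_rsE; apply/matrixP => i j; rewrite !mxE klftK.
  exists (map_mx (red 0) (map_mx klft phi)) => //.
  rewrite inE /prim -/(h _) -phiE pf /=; apply/eqP; rewrite map_gram_of.
  have klE : map_mx res (map_mx klft phi) = phi.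
    by apply/matrixP => i j; rewrite !mxE klftK.
  move: hp; rewrite -{1}klE map_gram_of => /matrixP hp.
  apply/matrixP => i j; rewrite [LHS]mxE [RHS]mxE; apply: rs0; rewrite !rsE.
  by have := hp i j; rewrite [LHS]mxE [RHS]mxE.
rewrite !mulSn !expnD mulnA sols_step// [LHS]mulnAC IH.
by rewrite -mulnA [(f ^ (N * (n * (k + k))) * _)%N]mulnC.
Qed.

(** Consequently primitivity is constant on the fibers of multiplication by diag(pi^c_i). *)
Lemma ann_mult N c (z : A N) : (c <= N)%N -> red N (pi ^+ c) * z = 0 -> rs z = 0.
Proof.
move=> cN; rewrite -{1}[z]lftK -rmorphM => /red_ker[y].
rewrite (_ : N.+1 = c + (N - c).+1)%N; last by rewrite addnS subnKC.
rewrite exprD -mulrA => /piX_reg e; apply/res_ker.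
by exists (pi ^+ (N - c) * y); rewrite mulrA -exprS.
Qed.

Lemma rs_add N (x y : A N) : rs (x + y) = rs x + rs y.
Proof. by rewrite -[x]lftK -[y]lftK -rmorphD !rsE rmorphD. Qed.

Variables (c : 'I_n -> nat) (T : 'M[o]_n).

Definition dpi : 'M[o]_n := diag_mx (\row_i pi ^+ c i).
Definition scaled : 'M[o]_n := \matrix_(i, j) (pi ^+ c i * pi ^+ c j * T i j).

Definition dsols N : {set 'M[A N]_(n, k + k)} :=
  [set psi | (gram_of psi == map_mx (red N) scaled) &&
     `[< exists phi : 'M[o]_(n, k + k), row_free (map_mx res phi) /\
                                        psi = map_mx (red N) (dpi *m phi) >]].

(** The primitive phi for which D phi has the prescribed form, D = diag(pi^c_i), are counted in two
    ways. Over each D phi they form a coset of a group of order f^(2k sum c). Sorted by the defect Z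
    = gram phi - T, with pi^(c_i + c_j) Z_ij = 0, they fall into f^((n+1) sum c) classes of equal
    size. The bound c_i + c_j <= N makes Z vanish modulo pi. *)
Lemma dsols_count N : is_tri T -> (forall i j, c i + c j <= N)%N ->
  (#|dsols N| * f ^ ((k + k) * \sum_i c i) * f ^ (N * (n * n.+1)./2) =
   f ^ (n.+1 * \sum_i c i) * (#|ksols (map_mx res T)| * f ^ (N * (n * (k + k)))))%N.
Proof.
move=> Ttri cN.
have cN1 i : (c i <= N)%N by apply: leq_trans (cN i i); apply: leq_addr.
pose D := map_mx (red N) dpi.
have DE (phi : 'M[A N]_(n, k + k)) i j : (D *m phi) i j = red N (pi ^+ c i) * phi i j.
  by rewrite /D /dpi map_diag_mx mul_diag_mx !mxE.
pose P := [set phi : 'M[A N]_(n, k + k) |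
   prim phi && (gram_of (D *m phi) == map_mx (red N) scaled)].
have PD : #|P| = (#|dsols N| * f ^ ((k + k) * \sum_i c i))%N.
  rewrite -sum1_card (partition_big (mulmx D) (mem (dsols N))) /=; last first.
    move=> phi; rewrite inE => /andP[pf hp]; rewrite inE hp; apply/asboolP.
    exists (mlft phi); rewrite map_mxM mlftK; split=> //.
    by rewrite -(map_rsE N) mlftK.
  rewrite -[X in (X * _)%N]sum1_card big_distrl /=.
  apply: eq_bigr => psi; rewrite inE mul1n => /andP[hpsi /asboolP[Phi [pf psiE]]].
  pose phi0 := map_mx (red N) Phi.
  have psi0 : psi = D *m phi0 by rewrite psiE map_mxM.
  pose Ann := [set Z : 'M[A N]_(n, k + k) |
    [forall i, forall j, [pred z | red N (pi ^+ c i) * z == 0] (Z i j)]].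
  transitivity #|Ann|.
    rewrite sum1dep_card -[RHS](card_imset _ (addrI phi0)); apply: eq_card => phi.
    rewrite inE; apply/andP/imsetP => [[_ /eqP e]|[Z + ->]].
      exists (phi - phi0); last by rewrite addrC subrK.
      rewrite inE; apply/forallP => i; apply/forallP => j /=.
      move: e; rewrite psi0 => /matrixP/(_ i j); rewrite !DE !mxE mulrBr => ->.
      by rewrite subrr.
    rewrite inE => /forallP hZ.
    have hZ' i j : red N (pi ^+ c i) * Z i j = 0.
      by have /forallP/(_ j)/= /eqP := hZ i.
    have DZ : D *m (phi0 + Z) = psi.
      rewrite psi0; apply/matrixP => i j; rewrite !DE mxE mulrDr hZ' addr0//.
    rewrite inE DZ hpsi andbT /prim; split=> //.
    rewrite (_ : map_mx _ _ = map_mx (@rs N) phi0) ?map_rsE//.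
    by apply/matrixP => i j; rewrite !mxE rs_add (ann_mult (cN1 i) (hZ' i j)) addr0 rsE.
  rewrite (card_mx_family (fun i _ => [pred z | red N (pi ^+ c i) * z == 0])) big_distrr /= expn_sum; apply: eq_bigr => i _.
  by rewrite prod_nat_const card_ord card_ann// -expnM mulnC.
rewrite -PD.
pose PX (i j : 'I_n) : pred (A N) :=
   if (i <= j)%N then [pred z | red N (pi ^+ (c i + c j)) * z == 0] else pred1 0.
pose X := [set Z : 'M[A N]_n | [forall i, forall j, PX i j (Z i j)]].
have XP Z : Z \in X <-> (forall i j : 'I_n, (j < i)%N -> Z i j = 0) /\
    (forall i j : 'I_n, red N (pi ^+ (c i + c j)) * Z i j = 0).
  rewrite inE; split=> [/forallP hZ|[h1 h2]].
    have h1 (i j : 'I_n) : (j < i)%N -> Z i j = 0.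
      move=> ji; have /forallP/(_ j) := hZ i; rewrite /PX leqNgt ji /=.
      by move/eqP.
    split=> // i j; have [ij|/h1 ->] := leqP i j; last by rewrite mulr0.
    by have /forallP/(_ j) := hZ i; rewrite /PX ij /= => /eqP.
  apply/forallP => i; apply/forallP => j; rewrite /PX; case: ifP => [ij|/negbT]; rewrite /=.
    by rewrite h2.
  by rewrite -ltnNge => /h1 ->.
have cardX : #|X| = (f ^ (n.+1 * \sum_i c i))%N.
  rewrite card_mx_family -sum_tri_weight expn_sum; apply: eq_bigr => i _.
  rewrite [in RHS]big_mkcond expn_sum; apply: eq_bigr => j _.
  rewrite /PX; case: ifP => _; first by rewrite card_ann.
  by rewrite card1.
rewrite -cardX -sum1_card.
rewrite (partition_big (fun phi => gram_of phi - map_mx (red N) T) (mem X)) /=.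
  rewrite -[X in (_ = X * _)%N]sum1_card !big_distrl /=.
  apply: eq_bigr => Z /XP[Zt ZX]; rewrite mul1n.
  (* T' lifts T + Z and has the residue of T, so [sols_count] gives the same number for every Z. *)
  pose T' := T + \matrix_(i, j) (if (i <= j)%N then lft (Z i j) else 0).
  have T't : is_tri T'.
    apply/is_triP => i j ji; rewrite !mxE leqNgt ji addr0.
    by have /is_triP/(_ i j ji) := Ttri.
  have T'r : map_mx (red N) T' = map_mx (red N) T + Z.
    apply/matrixP => i j; rewrite !mxE rmorphD /=; congr (_ + _).
    by case: leqP => [_|/Zt ->]; rewrite ?lftK ?rmorph0.
  have T'k : map_mx res T' = map_mx res T.
    apply/matrixP => i j; rewrite !mxE rmorphD /= -[RHS]addr0; congr (_ + _).
    case: leqP => [_|_]; last by rewrite rmorph0.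
    exact: ann_mult (cN i j) (ZX i j).
  rewrite -T'k -(sols_count N T't); congr (_ * _)%N.
  rewrite sum1dep_card; apply: eq_card => phi; rewrite !inE -andbA; congr (_ && _).
  rewrite T'r subr_eq addrC; apply/andP/idP => [[]//|h]; split=> //.
  rewrite /D /dpi map_diag_mx gram_of_scale (eqP h); apply/eqP/matrixP => i j.
  rewrite !mxE -!rmorphM mulrDr -!rmorphM [X in _ + X](_ : _ = 0) ?addr0//.
  by rewrite -exprD ZX.
move=> phi; rewrite inE => /andP[_ /eqP]; rewrite /D /dpi map_diag_mx gram_of_scale.
move=> /matrixP h; apply/XP; split=> i j.
  move=> ji; rewrite !mxE -(inj_eq val_inj) /= gtn_eqF// ltnNge (ltnW ji) /=.
  by have /is_triP/(_ i j ji) -> := Ttri; rewrite rmorph0 subr0.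
have := h i j; rewrite !mxE !rmorphM /= -!rmorphM -exprD => e.
by rewrite mulrBr e rmorphM subrr.
Qed.

End Tower.

Lemma unitmx_block1 (R : comUnitRingType) n (M : 'M[R]_n) :
  (block_mx (1%:M : 'M[R]_1) 0 0 M \in unitmx) = (M \in unitmx).
Proof. by rewrite !unitmxE det_ublock det1 mul1r. Qed.

(** * Valuations, weighted norms and diagonalization *)

Section Valuation.
Variables (F : fieldType) (v : discrete_valuation F).
Local Notation o := (integers v).

Definition vge (m : int) (x : F) : bool := (m%:E <= v x)%E.
(** Stands for 2 v(x) >= m: half-integral bounds without division, with 0 included since its
    valuation is infinite. *)
Definition vge2 (m : int) (x : F) : bool := vge m (x ^+ 2).
Definition ordz (x : F) : int := fine (v x).

Lemma vE x : x != 0 -> v x = (ordz x)%:E.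
Proof. by move=> x0; rewrite /ordz fineK// ord_fin. Qed.

Lemma vgeE m x : x != 0 -> vge m x = (m <= ordz x).
Proof. by move=> x0; rewrite /vge vE// lee_fin. Qed.

Lemma vge_0 m : vge m 0.
Proof. by rewrite /vge ord_0 leey. Qed.

Lemma ordzM x y : x != 0 -> y != 0 -> ordz (x * y) = ordz x + ordz y.
Proof.
move=> x0 y0; have := ord_mul v x y; rewrite !vE ?mulf_neq0// -EFinD.
by case.
Qed.

Lemma ordz1 : ordz 1 = 0.
Proof. by rewrite /ordz ord_1. Qed.

Lemma ordzV x : x != 0 -> ordz x^-1 = - ordz x.
Proof.
move=> x0; have := ordzM x0 (invr_neq0 x0); rewrite mulfV// ordz1 => /esym/eqP.
by rewrite addrC addr_eq0 => /eqP.
Qed.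

Lemma ordzX x n : x != 0 -> ordz (x ^+ n) = ordz x *+ n.
Proof.
move=> x0; elim: n => [|n IH]; first by rewrite expr0 ordz1 mulr0n.
by rewrite exprS ordzM ?expf_neq0// IH mulrS.
Qed.

Lemma ordzXz x (n : int) : x != 0 -> ordz (x ^ n) = n * ordz x.
Proof.
move=> x0; case: n => n; first by rewrite -exprnP ordzX// -mulr_natl natz.
by rewrite NegzE -exprnN ordzV ?expf_neq0// ordzX// -mulr_natl natz mulNr.
Qed.

Lemma vgeD m x y : vge m x -> vge m y -> vge m (x + y).
Proof.
by rewrite /vge => hx hy; apply: le_trans (ord_add v x y); rewrite le_min hx.
Qed.

Lemma vgeN m x : vge m (- x) = vge m x.
Proof. by rewrite /vge ord_opp. Qed.

Lemma vgeB m x y : vge m x -> vge m y -> vge m (x - y).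
Proof. by move=> hx hy; rewrite vgeD ?vgeN. Qed.

Lemma vge_sum m (I : Type) (r : seq I) (P : pred I) (E : I -> F) :
  (forall i, P i -> vge m (E i)) -> vge m (\sum_(i <- r | P i) E i).
Proof. by move=> h; elim/big_ind: _ => //; [exact: vge_0|exact: vgeD]. Qed.

Lemma vgeM a b x y : vge a x -> vge b y -> vge (a + b) (x * y).
Proof. by rewrite /vge ord_mul EFinD => hx hy; apply: leeD. Qed.

Lemma vge_le a b x : a <= b -> vge b x -> vge a x.
Proof. by rewrite /vge -lee_fin => ab; apply: le_trans. Qed.

Lemma vge_val (x : o) : vge 0 (val x).
Proof. exact: valP x. Qed.

Lemma vge_to_int x : vge 0 x -> val (to_int v x) = x.
Proof. by move=> h; rewrite insubdK. Qed.

Lemma ordz_ge0 (x : o) : val x != 0 -> 0 <= ordz (val x).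
Proof. by move=> x0; rewrite -vgeE// vge_val. Qed.

Lemma vge2E m x : x != 0 -> vge2 m x = (m <= 2 * ordz x).
Proof. by move=> x0; rewrite /vge2 vgeE ?expf_neq0// ordzX// mulr2n; apply/idP/idP; lia. Qed.

Lemma vge2_0 m : vge2 m 0.
Proof. by rewrite /vge2 expr2 mul0r vge_0. Qed.

Lemma vge2M a b x y : vge2 a x -> vge2 b y -> vge2 (a + b) (x * y).
Proof. by rewrite /vge2 exprMn; apply: vgeM. Qed.

Lemma vge2N m x : vge2 m (- x) = vge2 m x.
Proof. by rewrite /vge2 sqrrN. Qed.

(* 2v(x) >= m says v(x) >= ceil(m/2), so [vge2 m] is again an additive condition *)
Lemma vge2_vge m x : vge2 m x = vge (- ((- m) %/ 2)%Z) x.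
Proof.
have [->|x0] := eqVneq x 0; first by rewrite vge2_0 vge_0.
by rewrite vge2E// vgeE//; apply/idP/idP; lia.
Qed.

Lemma vge2_double m x : vge2 (2 * m) x = vge m x.
Proof. by rewrite vge2_vge; congr vge; lia. Qed.

Lemma vge2D m x y : vge2 m x -> vge2 m y -> vge2 m (x + y).
Proof. by rewrite !vge2_vge; apply: vgeD. Qed.

Lemma vge2_le a b x : a <= b -> vge2 b x -> vge2 a x.
Proof. by move=> ab; apply: vge_le. Qed.

Lemma vge2_sum m (I : Type) (r : seq I) (P : pred I) (E : I -> F) :
  (forall i, P i -> vge2 m (E i)) -> vge2 m (\sum_(i <- r | P i) E i).
Proof.
by move=> h; rewrite vge2_vge; apply: vge_sum => i /h; rewrite vge2_vge.
Qed.

Lemma unit_val (x : o) : (x \is a GRing.unit) = (v (val x) == 0%E).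
Proof. by []. Qed.

Lemma unit_ordz (x : o) : (x \is a GRing.unit) = (val x != 0) && (ordz (val x) == 0).
Proof.
rewrite unit_val; have [->|x0] /= := eqVneq (val x) 0; first by rewrite ord_0.
by rewrite vE.
Qed.

Lemma uniformizer_exists : exists x, v x = 1%E.
Proof. exact: ord_uniformizer. Qed.

Definition unif : F := projT1 (cid uniformizer_exists).

Lemma v_unif : v unif = 1%E.
Proof. by rewrite /unif; case: cid. Qed.

Lemma unif_neq0 : unif != 0.
Proof. by apply/eqP => e; have := v_unif; rewrite e ord_0. Qed.

Lemma ordz_unif : ordz unif = 1.
Proof. by rewrite /ordz v_unif. Qed.

Lemma unifz_neq0 m : unif ^ m != 0.
Proof. by rewrite expfz_neq0// unif_neq0. Qed.

Lemma ordz_unifz m : ordz (unif ^ m) = m.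
Proof. by rewrite ordzXz ?unif_neq0// ordz_unif mulr1. Qed.

Lemma vge_unif m : vge m (unif ^ m).
Proof. by rewrite vgeE ?unifz_neq0// ordz_unifz. Qed.

Lemma vge_unifM m a x : vge m (unif ^ a * x) = vge (m - a) x.
Proof.
have [->|x0] := eqVneq x 0; first by rewrite mulr0 !vge_0.
by rewrite !vgeE ?mulf_neq0 ?unifz_neq0// ordzM ?unifz_neq0// ordz_unifz; lia.
Qed.

Lemma unifzD a b : unif ^ (a + b) = unif ^ a * unif ^ b.
Proof. by rewrite expfzDr// unif_neq0. Qed.

Definition piI : o := to_int v unif.

Lemma val_piI : val piI = unif.
Proof. by rewrite vge_to_int// (vge_le _ (vge_unif 1)). Qed.

Lemma val_mul (x y : o) : val (x * y) = val x * val y.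
Proof. exact: rmorphM. Qed.

Lemma val_exp (x : o) N : val (x ^+ N) = val x ^+ N.
Proof. exact: rmorphXn. Qed.

Lemma vge_piX N (x : o) : vge N%:Z (val x) <-> exists y, x = piI ^+ N * y.
Proof.
split=> [h|[y ->]]; last first.
  by rewrite val_mul val_exp val_piI exprnP vge_unifM subrr vge_val.
exists (to_int v (unif ^ (- N%:Z) * val x)); apply: val_inj.
rewrite val_mul val_exp val_piI vge_to_int; last first.
  by rewrite vge_unifM opprK add0r.
by rewrite mulrA exprnP -unifzD subrr mul1r.
Qed.

Lemma piI_reg (x y : o) : piI * x = piI * y -> x = y.
Proof.
move=> /(congr1 val); rewrite !val_mul val_piI => /(mulfI unif_neq0)/val_inj.
exact.
Qed.

Definition mval m n (X : 'M[o]_(m, n)) : 'M[F]_(m, n) := map_mx val X.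

Lemma mvalM m n p (X : 'M[o]_(m, n)) (Y : 'M[o]_(n, p)) :
  mval (X *m Y) = mval X *m mval Y.
Proof. exact: (map_mxM [the {rmorphism _ -> _} of \val : o -> F]). Qed.

Definition mint m n (X : 'M[F]_(m, n)) : bool := [forall i, forall j, vge 0 (X i j)].

Lemma mintP m n (X : 'M[F]_(m, n)) :
  reflect (forall i j, vge 0 (X i j)) (mint X).
Proof.
apply: (iffP forallP) => [h i j|h i]; first by have /forallP/(_ j) := h i.
by apply/forallP.
Qed.

Lemma mint_mval m n (X : 'M[o]_(m, n)) : mint (mval X).
Proof. by apply/mintP => i j; rewrite mxE vge_val. Qed.

Lemma mintE m n (X : 'M[F]_(m, n)) : mint X -> X = mval (map_mx (to_int v) X).
Proof. by move/mintP => h; apply/matrixP => i j; rewrite !mxE vge_to_int. Qed.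

Lemma mvalP m n (X : 'M[F]_(m, n)) : mint X <-> exists Y, X = mval Y.
Proof.
split=> [/mintE ->|[Y ->]]; [by eexists|exact: mint_mval].
Qed.

Lemma mval_inj m n : injective (@mval m n).
Proof.
by move=> X Y /matrixP e; apply/matrixP => i j; have := e i j; rewrite !mxE => /val_inj.
Qed.

Lemma mintM m n p (X : 'M[F]_(m, n)) (Y : 'M[F]_(n, p)) :
  mint X -> mint Y -> mint (X *m Y).
Proof. by move=> /mintE -> /mintE ->; rewrite -mvalM mint_mval. Qed.

Lemma mintD m n (X Y : 'M[F]_(m, n)) : mint X -> mint Y -> mint (X + Y).
Proof. by move=> /mintP h /mintP h'; apply/mintP => i j; rewrite mxE vgeD. Qed.

Lemma mval1 n : mval (1%:M : 'M[o]_n) = 1%:M.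
Proof. exact: (map_mx1 [the {rmorphism _ -> _} of \val : o -> F]). Qed.

Lemma det_mval n (X : 'M[o]_n) : \det (mval X) = val (\det X).
Proof. exact: (det_map_mx [the {rmorphism _ -> _} of \val : o -> F]). Qed.

Lemma mval_unit n (X : 'M[o]_n) : X \in unitmx ->
  mval X \in unitmx /\ invmx (mval X) = mval (invmx X).
Proof.
move=> Xu; have e : mval X *m mval (invmx X) = 1%:M by rewrite -mvalM mulmxV// mval1.
have [u _] := mulmx1_unit e; split=> //.
by rewrite -[LHS]mulmx1 -e mulmxA mulVmx// mul1mx.
Qed.

Lemma unit_mval n (X : 'M[o]_n) : mval X \in unitmx -> mint (invmx (mval X)) ->
  X \in unitmx.
Proof.
move=> Xu /mvalP[Y YE]; have : X *m Y = 1%:M.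
  by apply: mval_inj; rewrite mvalM -YE mulmxV// mval1.
by case/mulmx1_unit.
Qed.

(* w(x) >= m for the norm w(x) = min_i (2v(x_i) + al_i), doubled to stay in Z *)
Definition wge n (al : 'I_n -> int) (m : int) (x : 'rV[F]_n) : bool :=
  [forall i, vge2 (m - al i) (x 0 i)].

Lemma wgeP n (al : 'I_n -> int) m (x : 'rV[F]_n) :
  reflect (forall i, vge2 (m - al i) (x 0 i)) (wge al m x).
Proof. exact: forallP. Qed.

Lemma wgeD n (al : 'I_n -> int) m x y : wge al m x -> wge al m y -> wge al m (x + y).
Proof. by move=> /wgeP hx /wgeP hy; apply/wgeP => i; rewrite mxE vge2D. Qed.

Lemma wgeZ n (al : 'I_n -> int) m a c x : vge2 a c -> wge al m x -> wge al (a + m) (c *: x).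
Proof.
move=> hc /wgeP hx; apply/wgeP => i; rewrite mxE -addrA; exact: vge2M.
Qed.

Lemma wge_sum n (al : 'I_n -> int) m (I : Type) (r : seq I) (P : pred I) (E : I -> 'rV[F]_n) :
  (forall i, P i -> wge al m (E i)) -> wge al m (\sum_(i <- r | P i) E i).
Proof.
move=> h; elim/big_ind: _ => //; last exact: wgeD.
by apply/wgeP => i; rewrite mxE vge2_0.
Qed.

Lemma wge_comb n n' (al : 'I_n -> int) (al' : 'I_n' -> int) (U : 'M[F]_(n', n)) m x :
  (forall i, wge al (al' i) (row i U)) -> wge al' m x -> wge al m (x *m U).
Proof.
move=> hU /wgeP hx; rewrite mulmx_sum_row; apply: wge_sum => i _.
by rewrite -[m](subrK (al' i)); apply: wgeZ.
Qed.

Lemma wge_block_rows n (be : 'I_(1 + n) -> int) (d : 'M[F]_(n, 1)) :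
  (forall i, vge2 (be (rshift 1 i) - be (@lshift 1 n 0)) (d i 0)) ->
  forall i, wge be (be i) (row i (block_mx 1%:M 0 d 1%:M)).
Proof.
have v1 : vge2 0 1 by rewrite /vge2 expr1n vgeE ?oner_neq0// ordz1.
move=> hd i; apply/wgeP => j; rewrite mxE.
case: (split_ordP i) => i' ->; case: (split_ordP j) => j' ->.
- by rewrite block_mxEul (ord1 i') (ord1 j') mxE eqxx subrr.
- by rewrite block_mxEur mxE vge2_0.
- by rewrite block_mxEdl (ord1 j').
rewrite block_mxEdr mxE; case: eqP => [->|_]; last by rewrite vge2_0.
by rewrite subrr.
Qed.

(* Gaussian elimination on an entry minimizing 2v(A_ij) - al_i diagonalizes A by
   row operations preserving the norm and integral column operations. *)
Lemma wsmith n (A : 'M[F]_n) (al : 'I_n -> int) : A \in unitmx ->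
  exists (U : 'M[F]_n) (W : 'M[o]_n) (al' c : 'I_n -> int),
  [/\ U \in unitmx, W \in unitmx,
      \sum_i al' i = \sum_i al i /\
        (forall D : int -> Prop, (forall i, D (al i)) -> forall i, D (al' i)),
      forall m x, wge al m (x *m U) = wge al' m x
    & U *m A *m mval W = diag_mx (\row_i unif ^ c i)].
Proof.
have aux1 (p r s : int) : 2 * p - s <= 2 * r - s -> 0 <= - p + r by lia.
have aux2 (p r s t : int) : 2 * p - s <= 2 * r - t -> t - s <= 2 * (- p + r) by lia.
elim: n A al => [|n IH] A al Au.
  exists 1%:M, 1%:M, al, al; split; rewrite ?unitmx1 ?big_ord0//.
    by move=> m x; rewrite mulmx1.
  by rewrite [LHS]flatmx0 [RHS]flatmx0.
have [i1 [j1 A1]] : exists i j, A i j != 0.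
  have : A != 0.
    by apply/eqP => A0; move: Au; rewrite A0 unitmxE det0 unitr0.
  by case/matrix0Pn => i [j h]; exists i, j.
(* Within the pivot row minimality compares valuations, so the column multipliers are integral;
   within the pivot column it says that the row multipliers respect the weights. *)
pose key (p : 'I_n.+1 * 'I_n.+1) := (2 * ordz (A p.1 p.2) - al p.1)%R.
have [[i0 j0] /= A0 Amin] :=
  @Order.TotalTheory.arg_minP _ int _ (i1, j1) (fun p => A p.1 p.2 != 0) key A1.
pose B := xcol j0 0 (xrow i0 0 A) : 'M[F]_(1 + n).
pose be := al \o tperm i0 0.
have BE i j : B i j = A (tperm i0 0 i) (tperm j0 0 j) by rewrite !mxE.
have Bu : B \in unitmx by rewrite /B /xcol /xrow col_permE row_permE !unitmx_mul !unitmx_perm Au.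
pose P : 'M[F]_(1 + n) := perm_mx (tperm i0 0).
pose PW : 'M[o]_(1 + n) := perm_mx (tperm j0 0).
have Bperm : B = P *m A *m mval PW.
  rewrite /B /xcol /xrow col_permE row_permE tpermV; congr (_ *m _).
  by rewrite /mval map_perm_mx.
clearbody B.
have l0E : @lshift 1 n 0 = 0 :> 'I_n.+1 by apply: val_inj.
pose a := B 0 0; have aE : a = A i0 j0 by rewrite /a BE !tpermR.
have a0 : a != 0 by rewrite aE.
have be0 : be 0 = al i0 by rewrite /be /= tpermR.
have Bmin i j : B i j != 0 -> 2 * ordz a - be 0 <= 2 * ordz (B i j) - be i.
  by rewrite BE => h; have := Amin (_, _) h; rewrite /key /= -aE be0.
(* The unit u is divided out by the column operation G, so that the pivot becomes exactly pi^c0. *)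
pose c0 := ordz a; pose u := a / unif ^ c0.
have u0 : u != 0 by rewrite mulf_neq0// invr_neq0// unifz_neq0.
have ou : ordz u = 0.
  by rewrite /u ordzM// ?invr_neq0 ?unifz_neq0// ordzV ?unifz_neq0// ordz_unifz subrr.
have au : a * u^-1 = unif ^ c0 by rewrite /u invfM invrK mulrA mulfV// mul1r.
pose b := ursubmx B : 'M[F]_(1, n); pose d := dlsubmx B : 'M[F]_(n, 1).
pose D := drsubmx B.
have B_block : B = block_mx a%:M b d D.
  rewrite -[LHS]submxK; congr block_mx.
  by rewrite [LHS]mx11_scalar !mxE /a; congr (B _ _)%:M; apply: val_inj.
(* E need not be integral, only preserve the norm, whereas G has to be invertible over the valuation
   ring. *)
pose E := block_mx 1%:M 0 (- (a^-1 *: d)) 1%:M : 'M[F]_(1 + n).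
pose E' := block_mx 1%:M 0 (a^-1 *: d) 1%:M : 'M[F]_(1 + n).
pose G := block_mx (u^-1)%:M (- (a^-1 *: b)) 0 1%:M : 'M[F]_(1 + n).
pose G' := block_mx u%:M (u *: (a^-1 *: b)) 0 1%:M : 'M[F]_(1 + n).
pose S := D - a^-1 *: (d *m b).
have EBG : E *m B *m G = block_mx (unif ^ c0)%:M 0 0 S.
  rewrite B_block !mulmx_block !mul1mx !mul0mx !mulmx0 !mulmx1 !addr0.
  have -> : - (a^-1 *: d) *m a%:M + d = 0.
    by rewrite mul_mx_scalar scalerN scalerA mulfV// scale1r addNr.
  rewrite !mul0mx add0r -scalar_mxM au mulmxN mul_scalar_mx scalerA mulfV// scale1r.
  by rewrite addNr mulNmx -scalemxAl addrC.
have EE' : E *m E' = 1%:M.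
  rewrite mulmx_block !mulmx1 !mul1mx !mulmx0 !mul0mx !addr0 addNr add0r.
  by rewrite -scalar_mx_block.
have GG' : G *m G' = 1%:M.
  rewrite mulmx_block !mulmx1 !mul1mx !mulmx0 !mul0mx !addr0 add0r -scalar_mxM mulVf//.
  by rewrite mul_scalar_mx scalerA mulVf// scale1r subrr -scalar_mx_block.
have [Eu E'u] := mulmx1_unit EE'; have [Gu G'u] := mulmx1_unit GG'.
have Su : S \in unitmx.
  have : E *m B *m G \in unitmx by rewrite !unitmx_mul Eu Bu Gu.
  by rewrite EBG !unitmxE det_ublock unitrM => /andP[].
pose be' i := be (rshift 1 i : 'I_(1 + n)).
have [U1 [W1 [al1 [c1 [U1u W1u [al1E al1D] U1w UW]]]]] := IH S be' Su.
have Gi : mint G.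
  have bi j : vge 0 (a^-1 * b 0 j).
    have [->|bj0] := eqVneq (b 0 j) 0; first by rewrite mulr0 vge_0.
    have := Bmin (@lshift 1 n 0) (rshift 1 j).
    move: bj0; rewrite !mxE => bj0 /(_ bj0).
    rewrite vgeE ?mulf_neq0 ?invr_neq0// ordzM ?invr_neq0// ordzV//.
    by rewrite l0E; apply: aux1.
  apply/mintP => i j; rewrite -[i](@splitK 1 n) -[j](@splitK 1 n).
  case: (fintype.split i) => i'; case: (fintype.split j) => j' /=;
    rewrite ?block_mxEul ?block_mxEur ?block_mxEdl ?block_mxEdr !mxE.
  - by rewrite !ord1 eqxx mulr1n vgeE ?invr_neq0// ordzV// ou.
  - by rewrite vgeN ord1; have := bi j'; rewrite /b !mxE.
  - exact: vge_0.
  - by case: eqP => _; rewrite ?vge_0// mulr1n vgeE ?oner_neq0// ordz1.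
have G'i : mint G'.
  have bi j : vge 0 (a^-1 * b 0 j).
    by have := mintP _ Gi (@lshift 1 n 0) (rshift 1 j); rewrite block_mxEur mxE vgeN mxE.
  apply/mintP => i j; rewrite -[i](@splitK 1 n) -[j](@splitK 1 n).
  case: (fintype.split i) => i'; case: (fintype.split j) => j' /=;
    rewrite ?block_mxEul ?block_mxEur ?block_mxEdl ?block_mxEdr.
  - by rewrite mxE !ord1 eqxx mulr1n vgeE// ou.
  - rewrite mxE mxE ord1 -[0]addr0; apply: vgeM; first by rewrite vgeE// ou.
    exact: bi.
  - by rewrite mxE vge_0.
  - by rewrite mxE; case: eqP => _; rewrite ?vge_0// mulr1n vgeE ?oner_neq0// ordz1.
have [GI GIE] := (mvalP G).1 Gi.
have GIu : GI \in unitmx.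
  apply: unit_mval; rewrite -GIE//.
  by rewrite (_ : invmx G = G')// -[LHS]mulmx1 -GG' mulmxA mulVmx// mul1mx.
pose U2 := block_mx 1%:M 0 0 U1 : 'M[F]_(1 + n).
pose W2 := block_mx 1%:M 0 0 W1 : 'M[o]_(1 + n).
have W2E : mval W2 = block_mx 1%:M 0 0 (mval W1).
  by rewrite /mval map_block_mx !map_mx0 -/(mval _) -/(mval _) mval1.
pose al2 (i : 'I_(1 + n)) := match fintype.split i with inl _ => be 0 | inr j => al1 j end.
pose c2 (i : 'I_(1 + n)) := match fintype.split i with inl _ => c0 | inr j => c1 j end.
have al2l i : al2 (lshift n i) = be 0.
  by rewrite /al2; case: splitP => // j /= e; have := ltn_ord i; rewrite e ltnNge leq_addr.
have al2r i : al2 (rshift 1 i) = al1 i.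
  rewrite /al2; case: splitP => [j /= e|j [e]]; first by have := ltn_ord j; rewrite -e ltnNge leq_addr.
  by congr al1; apply: val_inj.
have c2l i : c2 (lshift n i) = c0.
  by rewrite /c2; case: splitP => // j /= e; have := ltn_ord i; rewrite e ltnNge leq_addr.
have c2r i : c2 (rshift 1 i) = c1 i.
  rewrite /c2; case: splitP => [j /= e|j [e]]; first by have := ltn_ord j; rewrite -e ltnNge leq_addr.
  by congr c1; apply: val_inj.
exists (U2 *m E *m P), (PW *m GI *m W2), al2, c2; split.
- by rewrite !unitmx_mul Eu unitmx_perm !andbT /U2 unitmx_block1.
- by rewrite !unitmx_mul GIu unitmx_perm /= /W2 unitmx_block1.
(* al' is a rearrangement of al; only its sum and the predicates it inherits are recorded. *)
- split; last first.
    move=> Dp hD i; case: (@split_ordP 1 n i) => i' ->; first by rewrite al2l; apply: hD.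
    by rewrite al2r; apply: al1D => l; apply: hD.
  rewrite [RHS](reindex_inj (@perm_inj _ (tperm i0 0))) /=.
  rewrite (@big_split_ord _ _ _ 1 n) [RHS](@big_split_ord _ _ _ 1 n) /= !big_ord1.
  rewrite al2l; congr (_ + _).
    by rewrite l0E.
  by rewrite (eq_bigr al1) => [|i _]; rewrite ?al1E ?al2r.
- move=> m x.
  have wP y : wge al m (y *m P) = wge be m y.
    have yP i : (y *m P) 0 i = y 0 (tperm i0 0 i).
      rewrite mxE (bigD1 (tperm i0 0 i)) //= !mxE tpermK eqxx mulr1 big1 ?addr0// => j ji; rewrite !mxE; case: eqP => [e|]; rewrite ?mulr0//; by move: ji; rewrite -e tpermK eqxx.
    apply/wgeP/wgeP => h i; first by have := h (tperm i0 0 i); rewrite yP tpermK.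
    by rewrite yP; have := h (tperm i0 0 i); rewrite /be /= tpermK.
  have wE (E0 : 'M[F]_(1 + n)) (d' : 'M[F]_(n, 1)) :
      E0 = block_mx 1%:M 0 d' 1%:M ->
      (forall i, vge2 (be (rshift 1 i) - be 0) (d' i 0)) -> forall i, wge be (be i) (row i E0).
    by move=> -> hd; apply: wge_block_rows => i; rewrite l0E.
  have dE i : vge2 (be (rshift 1 i) - be 0) ((a^-1 *: d) i 0).
    rewrite mxE; have [->|di0] := eqVneq (d i 0) 0; first by rewrite mulr0 vge2_0.
    have := Bmin (rshift 1 i) (@lshift 1 n 0).
    move: di0; rewrite !mxE => di0 /(_ di0).
    rewrite vge2E ?mulf_neq0 ?invr_neq0// ordzM ?invr_neq0// ordzV//.
    by rewrite ?l0E; apply: aux2.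
  have wEE y : wge be m (y *m E) = wge be m y.
    apply/idP/idP => h; last first.
      apply: wge_comb h; apply: (wE _ _ erefl) => i.
      by rewrite mxE vge2N.
    rewrite -[y]mulmx1 -EE' mulmxA; apply: wge_comb h.
    exact: (wE _ _ erefl).
  have split_wge (ga : 'I_(1 + n) -> int) y : wge ga m y =
      vge2 (m - ga (@lshift 1 n 0)) (y 0 (@lshift 1 n 0)) && wge (fun i => ga (rshift 1 i)) m (rsubmx y).
    apply/wgeP/andP => [h|[h1 /wgeP h2] i].
      by split=> //; apply/wgeP => i; rewrite mxE.
    rewrite -[i](@splitK 1 n); case: (fintype.split i) => i' /=; first by rewrite ord1.
    by have := h2 i'; rewrite mxE.
  rewrite !mulmxA wP wEE !split_wge al2l.
  have xU : x *m U2 = row_mx (lsubmx (x : 'M[F]_(1, 1 + n))) (rsubmx (x : 'M[F]_(1, 1 + n)) *m U1).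
    by rewrite -{1}[x](@hsubmxK _ 1 1 n) /U2 (@mul_row_block _ 1 1 n 1 n) !mulmx0 mulmx1 addr0 add0r.
  rewrite xU row_mxEl row_mxKr U1w mxE; congr (_ && _).
    by rewrite l0E.
  by apply/wgeP/wgeP => h i; have := h i; rewrite al2r.
- rewrite !mvalM W2E !mulmxA -GIE.
  have -> : U2 *m E *m P *m A *m mval PW *m G *m block_mx 1%:M 0 0 (mval W1) =
     U2 *m (E *m B *m G) *m block_mx 1%:M 0 0 (mval W1).
    by rewrite Bperm !mulmxA.
  rewrite EBG /U2 !mulmx_block !mulmx0 !mul0mx !mul1mx !mulmx1 !addr0 !add0r UW.
  apply/matrixP => i j.
  case: (@split_ordP 1 n i) => i' ->; case: (@split_ordP 1 n j) => j' ->.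
  - by rewrite (@block_mxEul F 1 n 1 n) !mxE c2l (ord1 i') (ord1 j') !eqxx.
  - by rewrite (@block_mxEur F 1 n 1 n) mul0mx !mxE (ord1 i') -(inj_eq val_inj).
  - by rewrite (@block_mxEdl F 1 n 1 n) !mxE (ord1 j') -(inj_eq val_inj).
  - by rewrite (@block_mxEdr F 1 n 1 n) !mxE c2r -!(inj_eq val_inj) /= eqSS.
Qed.

End Valuation.

(** * Finite structure on a type whose full set is finite *)

Section PackFinite.
Variables (T : choiceType) (h : forall x : T, x \in fset_set (setT : set T)).
Let s : seq T := fset_set (setT : set T).

Lemma seq_sub_fset_setK : cancel (fun x => SeqSub (h x) : seq_sub s) (@ssval _ s).
Proof. by []. Qed.

Definition fset_countable := CanIsCountable seq_sub_fset_setK.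
Definition fset_countType : countType := HB.pack (Choice.sort T) fset_countable.
Definition fset_finite :=
  @CanIsFinite fset_countType (seq_sub s) _ _ seq_sub_fset_setK.

End PackFinite.

(** * Quotients of the valuation ring *)

Section Quotients.
Variables (F : fieldType) (v : discrete_valuation F).
Local Notation o := (integers v).
Local Notation kappa := (residue_field v).

Definition redm (N : nat) : {rmorphism o -> int_mod v N} :=
  [the {rmorphism o -> int_mod v N} of \pi_({ideal_quot (@max_ideal_pow F v N)})%qT].

Lemma redmE N x : redm N x = reduce N x. Proof. by []. Qed.

Lemma reduce_surj N (a : int_mod v N) : exists x, reduce N x = a.
Proof. by exists (repr a); rewrite /reduce reprK. Qed.

Lemma reduce_ker0 N (x : o) : (reduce N x == 0) = vge v N.+1%:Z (val x).
Proof.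
rewrite (_ : 0 = \pi_({ideal_quot (@max_ideal_pow F v N)})%qT 0); last by rewrite piE.
by rewrite /reduce piE Quotient.equivE subr0.
Qed.

Lemma reduce_ker N (x : o) : reduce N x = 0 <-> exists y, x = piI v ^+ N.+1 * y.
Proof. by rewrite -vge_piX -reduce_ker0; split=> [->//|/eqP]. Qed.

Lemma reduce_eq N (x y : o) :
  reduce N x = reduce N y <-> exists z, x = y + piI v ^+ N.+1 * z.
Proof.
have -> : (reduce N x = reduce N y) <-> (reduce N (x - y) = 0).
  by rewrite -!redmE rmorphB; split=> [->|/eqP]; rewrite ?subrr// subr_eq0 => /eqP.
rewrite reduce_ker; split=> -[z h]; exists z; first by rewrite -h addrC subrK.
by rewrite h addrC addKr.
Qed.

Definition resm : {rmorphism o -> kappa} := redm 0.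

Lemma resm_ker x : resm x = 0 <-> exists y, x = piI v * y.
Proof. by rewrite -[piI v]expr1; apply: (reduce_ker 0). Qed.

Lemma resm_unit x : (resm x != 0) = (x \is a GRing.unit).
Proof.
rewrite redmE reduce_ker0 unit_ordz; have [x0|x0] := eqVneq (val x) 0.
  by rewrite x0 vge_0.
by rewrite vgeE//; have /= := ordz_ge0 x0; lia.
Qed.

Lemma finite_int_mod : finite_set [set: kappa] ->
  forall N, finite_set [set: int_mod v N].
Proof.
move=> hk; elim=> [|N IH]; first exact: hk.
pose g (p : kappa * int_mod v N) := reduce N.+1 (repr p.1 + piI v * repr p.2).
apply: (@sub_finite_set _ _ (g @` ([set: kappa] `*` [set: int_mod v N])%classic)).
  move=> a _; have [x <-] := reduce_surj a.
  have /resm_ker[y hy] : resm (x - repr (resm x)) = 0.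
    by rewrite rmorphB /= [X in _ - X]reprK subrr.
  exists (resm x, reduce N y) => //; rewrite /g /=.
  have /reduce_eq[z hz] : reduce N y = reduce N (repr (reduce N y)).
    by rewrite [RHS]reprK.
  apply/reduce_eq; exists (- z); set u := repr (reduce N y) in hz *.
  have -> : u = y - piI v ^+ N.+1 * z by rewrite {1}hz addrK.
  have -> : x = repr (resm x) + piI v * y by rewrite -hy addrC subrK.
  rewrite (_ : repr (resm (_ + _)) = repr (resm x)); last first.
    by rewrite -hy addrC subrK.
  by rewrite (exprS _ N.+1); ring.
by apply: finite_image; apply: finite_setX.
Qed.

End Quotients.

(** * Finiteness of the residue field *)

Section ResidueFinite.
Variables (p : nat) (p_prime : prime p).
Variables (Qp : fieldType) (vp : discrete_valuation Qp) (hQp : is_Qp p vp).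

Lemma vge_nat (E : fieldType) (w : discrete_valuation E) m : vge w 0 m%:R.
Proof.
by have := vge_val (m%:R : integers w); rewrite (rmorph_nat [the {rmorphism _ -> _} of \val : integers w -> E]).
Qed.

Lemma vge_int (E : fieldType) (w : discrete_valuation E) (z : int) : vge w 0 z%:~R.
Proof.
by case: z => m; rewrite ?NegzE ?mulrNz ?vgeN -pmulrn vge_nat.
Qed.

Lemma not_vge1 (E : fieldType) (w : discrete_valuation E) : ~~ vge w 1 1.
Proof. by rewrite vgeE ?oner_neq0// ordz1. Qed.

Lemma ordz_p : ordz vp p%:R = 1.
Proof. by case: hQp => + _ _; rewrite /ordz => ->. Qed.

Lemma vge_p : vge vp 1 p%:R.
Proof. by rewrite /vge; case: hQp => ->. Qed.

Lemma p_neq0 : p%:R != 0 :> Qp.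
Proof. by apply/eqP => e; case: hQp; rewrite e ord_0. Qed.

Lemma vge1_dvd m : (p %| m)%N -> vge vp 1 m%:R.
Proof.
case/dvdnP=> q ->; rewrite natrM mulrC -[1]addr0; apply: vgeM vge_p _.
exact: vge_nat.
Qed.

Lemma vge1_ndvd m : ~~ (p %| m)%N -> ~~ vge vp 1 m%:R.
Proof.
rewrite -prime_coprime// => cp; apply/negP => hm.
have [[u w] /= e] := coprimeP m (prime_gt0 p_prime) cp.
have : (u * p)%:R - (w * m)%:R = 1 :> Qp.
  rewrite -natrB ?e//; move: e; case: leqP => //.
  by move=> /ltnW/eqP -> //.
move=> e1; have := not_vge1 vp; rewrite -e1 vgeB//.
  by rewrite natrM -[1]add0r; apply: vgeM vge_p; apply: vge_nat.
by rewrite natrM -[1]add0r; apply: vgeM hm; apply: vge_nat.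
Qed.

Lemma natQp_neq0 m : (0 < m)%N -> m%:R != 0 :> Qp.
Proof.
move=> m0; have [r pr ->] := pfactor_coprime p_prime m0.
rewrite natrM natrX mulf_neq0 ?expf_neq0 ?p_neq0//.
have := @vge1_ndvd r; rewrite -prime_coprime// => /(_ pr).
by apply: contraNneq => ->; apply: vge_0.
Qed.

(** A rational number close to x is integral, so p does not divide its denominator in lowest terms,
    and the denominator can be inverted modulo p. *)
Lemma residue_Qp (x : Qp) : vge vp 0 x -> exists2 m, (m < p)%N & vge vp 1 (x - m%:R).
Proof.
move=> x0; have [_ dens _] := hQp; have [r hr] := dens x 1.
have r0 : vge vp 0 (ratr r).
  by rewrite -[ratr r](subKr x) vgeB//; apply: vge_le hr.
have [d dE] : exists d : nat, denq r = d%:Z.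
  by exists `|denq r|%N; rewrite gez0_abs ?denq_ge0.
have d0 : (0 < d)%N by have := denq_gt0 r; rewrite dE.
have dQ : d%:R != 0 :> Qp by apply: natQp_neq0.
have rE : ratr r * d%:R = (numq r)%:~R :> Qp.
  by rewrite /ratr dE -pmulrn mulfVK.
have pd : ~~ (p %| d)%N.
  apply/negP => pd; have : vge vp 1 `|numq r|%N%:R.
    suff : vge vp 1 (numq r)%:~R.
      by case: (numq r) => z; rewrite ?NegzE ?mulrNz ?vgeN.
    by rewrite -rE -[1]add0r; apply: vgeM r0 (vge1_dvd pd).
  apply/negP/vge1_ndvd; apply/negP => pn.
  have := coprime_num_den r; rewrite dE /= => /eqP cnd.
  have : (p %| gcdn `|numq r| d)%N by rewrite dvdn_gcd pn pd.
  by rewrite cnd dvdn1 => /eqP p1; move: p_prime; rewrite p1.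
have [[u w] /= e] : exists u : nat * nat, (u.1 * d - u.2 * p = 1)%N.
  have cd : coprime d p by rewrite coprime_sym prime_coprime.
  by have /(coprimeP _ d0)[uw e] := cd; exists uw.
have ud : (u * d)%:R = 1 + (w * p)%:R :> Qp.
  by rewrite -[1]/(1%:R) -natrD; congr (_%:R); lia.
pose z := (numq r * u%:Z)%R; pose m := `|(z %% p%:Z)%Z|%N.
have p0 : p%:Z != 0 by rewrite (eqz_nat p 0) -lt0n prime_gt0.
have mE : m%:Z = (z %% p%:Z)%Z by rewrite /m gez0_abs// modz_ge0.
exists m; first by rewrite -ltz_nat mE ltz_pmod// ltz_nat prime_gt0.
suff h : vge vp 1 (ratr r - m%:R).
  by rewrite -[x](subrK (ratr r)) -addrA vgeD.
have hz : vge vp 1 (z%:~R - m%:R).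
  rewrite {1}(divz_eq z p%:Z) -mE intrD rmorphM /= -!pmulrn addrK.
  by rewrite -[1]add0r; apply: vgeM vge_p; apply: vge_int.
rewrite -[ratr r](subrK (z%:~R)) -addrA; apply: vgeD; last exact: hz.
have du : d%:R * u%:R = 1 + (w * p)%:R :> Qp by rewrite -natrM mulnC ud.
have -> : (ratr r : Qp) - z%:~R = - (ratr r * (w * p)%:R).
  by rewrite /z intrM -rE -pmulrn -mulrA du; ring.
by rewrite vgeN -[1]add0r; apply: vgeM r0 _; rewrite vge1_dvd// dvdn_mull.
Qed.

Variables (F : fieldExtType Qp) (v : discrete_valuation F).
Hypothesis hv : forall x : Qp, (0 <= v x%:A)%E = (0 <= vp x)%E.

(** [hv] compares integrality only. As 1/p is not integral in Q_p, it is not integral in F either,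
    whence v(p) >= 1; a general y is p times an integral element. *)
Lemma vgeA1 (y : Qp) : vge vp 1 y -> vge v 1 (y%:A).
Proof.
have p1 : vge v 1 (p%:R%:A).
  have pA : p%:R%:A != 0 :> F by rewrite scaler_eq0 oner_eq0 orbF p_neq0.
  rewrite vgeE//; have : ~~ vge v 0 (p%:R^-1%:A).
    rewrite /vge hv -/(vge vp 0 _) vgeE ?invr_neq0 ?p_neq0// ordzV ?p_neq0//.
    by rewrite ordz_p.
  have -> : p%:R^-1%:A = (p%:R%:A)^-1 :> F.
    by apply: (mulfI pA); rewrite mulfV// -scalerAl mul1r scalerA mulfV ?p_neq0// scale1r.
  by rewrite vgeE ?invr_neq0// ordzV// -ltNge oppr_lt0 gtz0_ge1.
move=> hy; have -> : y%:A = p%:R%:A * (p%:R^-1 * y)%:A :> F.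
  by rewrite -scalerAl mul1r scalerA mulrA mulfV ?p_neq0// mul1r.
rewrite -[1]addr0; apply: vgeM p1 _; rewrite /vge hv.
have [->|y0] := eqVneq y 0; first by rewrite mulr0 ord_0.
have pV := invr_neq0 p_neq0.
rewrite -/(vge vp 0 _) vgeE ?mulf_neq0// ordzM// ordzV ?p_neq0//.
by rewrite ordz_p; move: hy; rewrite vgeE//; lia.
Qed.

Local Notation kappa := (residue_field v).

(** Lifts of the residues are dependent over Q_p by dimension. Dividing by a coefficient of least
    valuation makes all coefficients integral and one of them 1, so the relation survives
    reduction. *)
Lemma residue_dependent (x : 'I_(\dim {:F}).+1 -> kappa) :
  exists m : 'I_(\dim {:F}).+1 -> nat,
    [/\ forall i, (m i < p)%N, exists i, m i != 0%N & \sum_i (m i)%:R * x i = 0].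
Proof.
set d := \dim {:F}; pose X : d.+1.-tuple F := [tuple val (repr (x i)) | i < d.+1].
have XE (i : 'I_d.+1) : X`_i = val (repr (x i)) by rewrite -tnth_nth tnth_mktuple.
have [c [i1 ci1] cX] : exists2 c : 'I_d.+1 -> Qp, exists i, c i != 0 & \sum_i c i *: X`_i = 0.
  have /negP Xnf : ~~ free X.
    rewrite /free size_tuple; apply/negP => /eqP e.
    by have := dimvS (subvf <<X>>%VS); rewrite e ltnn.
  apply: contrapT => h; apply: Xnf; apply/freeP => c cX i; apply: contrapT => ci.
  by apply: h; exists c => //; exists i; apply/eqP.
have [i0 c0 cmin] := @Order.TotalTheory.arg_minP _ int _ i1 (fun i => c i != 0)
   (fun i => ordz vp (c i)) ci1.
pose c' i := c i / c i0.
have c'0 i : vge vp 0 (c' i).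
  have [e|ci] := eqVneq (c i) 0; first by rewrite /c' e mul0r vge_0.
  rewrite vgeE ?mulf_neq0 ?invr_neq0// ordzM ?invr_neq0// ordzV//.
  by rewrite subr_ge0; apply: cmin.
pose m i := projT1 (cid2 (residue_Qp (c'0 i))).
have mp i : (m i < p)%N by rewrite /m; case: cid2.
have mc i : vge vp 1 (c' i - (m i)%:R) by rewrite /m; case: cid2.
exists m; split=> //.
  exists i0; apply/eqP => e; have := mc i0; rewrite e subr0 /c' mulfV//.
  exact/negP/not_vge1.
have -> : \sum_i (m i)%:R * x i = resm v (\sum_i (m i)%:R * repr (x i)).
  rewrite rmorph_sum; apply: eq_bigr => i _; rewrite rmorphM rmorph_nat.
  by rewrite redmE /reduce reprK.
apply/eqP; rewrite redmE reduce_ker0.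
have vsum : val (\sum_i (m i)%:R * repr (x i)) = \sum_i (m i)%:R * X`_i.
  transitivity (\sum_i val ((m i)%:R * repr (x i))).
    exact: (rmorph_sum [the {rmorphism _ -> _} of \val : integers v -> F]).
  apply: eq_bigr => i _; rewrite XE val_mul; congr (_ * _).
  exact: (rmorph_nat [the {rmorphism _ -> _} of \val : integers v -> F]).
rewrite vsum; have c'X : \sum_i c' i *: X`_i = 0.
  transitivity ((c i0)^-1 *: \sum_i c i *: X`_i); last by rewrite cX scaler0.
  rewrite scaler_sumr; apply: eq_bigr => i _.
  by rewrite scalerA mulrC.
have -> : \sum_i (m i)%:R * X`_i = \sum_i ((m i)%:R * X`_i - c' i *: X`_i).
  by rewrite sumrB c'X subr0.
apply: vge_sum => i _.
have -> : (m i)%:R * X`_i - c' i *: X`_i = - ((c' i - (m i)%:R)%:A * X`_i).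
  by rewrite -scalerAl mul1r scalerBl opprB scaler_nat mulr_natl.
rewrite vgeN -[1%:Z]addr0; apply: vgeM; first exact: vgeA1.
by rewrite XE vge_val.
Qed.

Lemma residue_p : p%:R = 0 :> kappa.
Proof.
rewrite -(rmorph_nat (resm v)); apply/eqP; rewrite redmE reduce_ker0.
rewrite (rmorph_nat [the {rmorphism _ -> _} of \val : integers v -> F]).
by rewrite -[p%:R]/(1 *+ p) -scaler_nat; apply: vgeA1 vge_p.
Qed.

(* Any d + 1 residues, d being the degree of F over Qp, are dependent over {0, ..., p - 1}. *)
Lemma residue_finite : finite_set [set: kappa].
Proof.
pose dep r := forall x : 'I_r -> kappa, exists m : 'I_r -> nat,
    [/\ forall i, (m i < p)%N, exists i, m i != 0%N & \sum_i (m i)%:R * x i = 0].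
suff main r : dep r -> finite_set [set: kappa] by apply: main residue_dependent.
elim: r => [h|r IH h].
  by have [m [_ [[]]]] := h (fun=> 0).
have [/IH//|nd] := pselect (dep r).
(* With an independent r-tuple x, every residue is -u times a combination of x, u and the
   coefficients being below p: in a relation involving y and x, the coefficient of y is nonzero,
   hence invertible modulo p. *)
have [x xn] : exists x : 'I_r -> kappa, forall m : 'I_r -> nat,
    (forall i, (m i < p)%N) -> \sum_i (m i)%:R * x i = 0 -> forall i, m i = 0%N.
  apply: contrapT => hx; apply: nd => x; apply: contrapT => hm; apply: hx.
  exists x => m mp mx i; apply: contrapT => mi; apply: hm; exists m; split=> //.
  by exists i; apply/eqP.
pose g (a : 'I_p * {ffun 'I_r -> 'I_p}) : kappa :=
  - (val a.1)%:R * \sum_i (val (a.2 i))%:R * x i.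
apply: (@sub_finite_set _ _ (g @` setT)%classic); last first.
  by apply: finite_image; apply: finite_finset.
move=> y _; pose x' (i : 'I_r.+1) := if unlift ord0 i is Some j then x j else y.
have [m [mp [i1 mi1] mx]] := h x'.
move: mx; rewrite big_ord_recl /x' unlift_none.
under eq_bigr do rewrite liftK.
move=> mx; have m0 : m ord0 != 0%N.
  apply/eqP => m0; move: mx; rewrite m0 mul0r add0r.
  move=> /(xn (fun i => m (lift ord0 i)) (fun=> mp _)) mz.
  by case/negP: mi1; case: (unliftP ord0 i1) => [j ->|->]; rewrite ?mz ?m0.
have [u up um] : exists2 u : nat, (u < p)%N & (u * m ord0)%:R = 1 :> kappa.
  have cm : coprime (m ord0) p.
    rewrite coprime_sym prime_coprime//; apply/negP => /(dvdn_leq _).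
    by rewrite lt0n m0 => /(_ isT); rewrite leqNgt mp.
  have [[u w] /= e] : exists u : nat * nat, (u.1 * m ord0 - u.2 * p = 1)%N.
    have m0' : (0 < m ord0)%N by rewrite lt0n.
    by have /(coprimeP _ m0')[uw e] := cm; exists uw.
  exists (u %% p)%N; first by rewrite ltn_mod prime_gt0.
  have -> : (u %% p * m ord0)%:R = (u * m ord0)%:R :> kappa.
    rewrite [in RHS](divn_eq u p) mulnDl natrD -mulnA mulnCA !natrM residue_p.
    by rewrite mul0r add0r.
  have -> : (u * m ord0 = 1 + w * p)%N by lia.
  by rewrite natrD natrM residue_p mulr0 addr0.
exists (Ordinal up, [ffun i => Ordinal (mp (lift ord0 i))]) => //; rewrite /g /=.
under eq_bigr do rewrite ffunE /=.
move/eqP: mx; rewrite addrC addr_eq0 => /eqP ->.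
by rewrite mulrNN mulrA -natrM um mul1r.
Qed.

End ResidueFinite.

Section FiniteCard.

Lemma ncard_fin (T : finType) (S : set T) : ncard S = #|[set x | `[< S x >]]|.
Proof.
rewrite /ncard cardE; apply/perm_size/uniq_perm; rewrite ?enum_uniq ?fset_uniq//.
move=> x; rewrite mem_enum inE; transitivity (x \in fset_set S) => //.
rewrite in_fset_set; last exact: finite_finset.
by apply/idP/asboolP; rewrite inE.
Qed.

End FiniteCard.

(** * The residue field and the quotients as finite rings *)

Section Instances.
Variables (F : fieldType) (v : discrete_valuation F).
Hypothesis hfin : finite_set [set: residue_field v].
Local Notation o := (integers v).
Local Notation kappa := (residue_field v).

Lemma in_fset_setT (T : choiceType) : finite_set [set: T] ->
  forall x : T, x \in fset_set [set: T].
Proof. by move=> h x; rewrite in_fset_set// inE. Qed.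

Let hA N := in_fset_setT (finite_int_mod hfin N).
Let hK := in_fset_setT hfin.

(** Transparent, so that this finite field stays convertible with [residue_field v] and statements
    about one can be read in the other. *)
Definition Kap : finFieldType.
pose X : finFieldType := HB.pack (residue_field v)
  (@fset_countable (residue_field v) hK) (@fset_finite (residue_field v) hK).
exact X.
Defined.

Definition An (N : nat) : finComNzRingType.
pose X : finComNzRingType := HB.pack (int_mod v N)
  (@fset_countable (int_mod v N) (@hA N)) (@fset_finite (int_mod v N) (@hA N)).
exact X.
Defined.

Definition redA (N : nat) : {rmorphism o -> An N} := redm v N.
Definition resK : {rmorphism o -> Kap} := resm v.

Lemma residue_card_Kap : residue_card v = #|Kap|.
Proof.
transitivity (ncard [set: Kap]) => //.
rewrite ncard_fin -cardsT; apply: eq_card => x; rewrite !inE; exact/asboolP.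
Qed.

Definition nbk n k (Q : 'rV[kappa]_n -> kappa) : nat := #|@isoms Kap n k Q|.

Definition prim_int n m (phi : 'M[o]_(n, m)) : bool := row_free (map_mx (resm v) phi).

Lemma ncard_An N m n (S : set 'M[int_mod v N]_(m, n)) :
  ncard S = #|[set x : 'M[An N]_(m, n) | `[< S x >]]|.
Proof. exact: (@ncard_fin 'M[An N]_(m, n) S). Qed.

Lemma ncard_dsols n k (c : 'I_n -> nat) (T : 'M[o]_n) N :
  is_tri T -> (forall i j, c i + c j <= N)%N ->
  (ncard [set psi : 'M[int_mod v N]_(n, k + k) |
      gram_of psi = map_mx (redm v N) (scaled (piI v) c T) /\
      exists phi : 'M[o]_(n, k + k), prim_int phi /\
        psi = map_mx (redm v N) (dpi (piI v) c *m phi)]%classic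
   * residue_card v ^ ((k + k) * \sum_i c i) * residue_card v ^ (N * (n * n.+1)./2)
   = residue_card v ^ (n.+1 * \sum_i c i) *
     (nbk k (tform (map_mx (resm v) T)) * residue_card v ^ (N * (n * (k + k)))))%N.
Proof.
move=> Ttri cN; rewrite residue_card_Kap.
have rs : forall N (a : An N), exists x, redA N x = a by move=> M; exact: reduce_surj.
have rk : forall N x, redA N x = 0 <-> exists y, x = piI v ^+ N.+1 * y.
  by move=> M; exact: reduce_ker.
have ks : forall a : Kap, exists x, resK x = a by exact: reduce_surj.
have kk : forall x, resK x = 0 <-> exists y, x = piI v * y by exact: resm_ker.
have := @dsols_count o (piI v) Kap An redA resK rs rk ks kk (@piI_reg F v) n k c T N Ttri cN.
have -> : #|@ksols Kap n k (map_mx resK T)| = nbk k (tform (map_mx (resm v) T)).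
  have Tk : is_tri (map_mx resK T).
    by apply/is_triP => i j ji; rewrite mxE; have /is_triP/(_ i j ji) -> := Ttri; rewrite rmorph0.
  apply: eq_card => phi; apply/idP/idP.
    rewrite inE => /andP[pf /eqP hp]; apply/isomsP; split=> //.
    by apply/(gram_ofP _ Tk).
  move=> /isomsP[pf hp]; rewrite inE pf /=; apply/eqP/(gram_ofP _ Tk) => //.
move=> <-; congr (_ * _ * _)%N; rewrite ncard_An; apply: eq_card => psi.
rewrite !inE; apply/asboolP/andP => [[/eqP h1 h2]|[/eqP h1 /asboolP h2]].
  by split=> //; apply/asboolP.
by split.
Qed.

Lemma nbk_symbol (R : realType) n k (Q : 'rV[kappa]_n -> kappa)
    (W0 W1 : {vspace 'rV[kappa]_n}) :
  (0 < n)%N -> (n <= k)%N -> quadratic_form Q -> radical_decomposition Q W0 W1 ->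
  let a := \dim W0 in
  let s := if odd a || (a == 0)%N then None else Some `[< split_form Q W0 >] in
  let f : R := (residue_card v)%:R in
  (nbk k Q)%:R = f ^ ((2 * k * n)%N%:Z - (n * n.+1)./2%:Z) * ((1 - f ^ (- k%:Z)) *
   ((1 + chi R a s * f `^ (n%:R - a%:R / 2 - k%:R))
    * \prod_(1 <= i < n | i%:R < n%:R - a%:R / 2 :> R)
              (1 - f ^ (2 * i%:Z - 2 * k%:Z)))).
Proof. by rewrite residue_card_Kap; exact: (@isoms_symbol R Kap n k Q W0 W1). Qed.

Lemma nbk_basis n k (Q : 'rV[kappa]_n -> kappa) (M : 'M[kappa]_n) :
  M \in unitmx -> nbk k (fun x => Q (x *m M)) = nbk k Q.
Proof. by rewrite -row_free_unit => Mf; apply: (@card_isoms_basis Kap n n k Q M). Qed.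

Lemma eq_nbk n k (Q Q' : 'rV[kappa]_n -> kappa) : Q =1 Q' -> nbk k Q = nbk k Q'.
Proof. by move=> e; rewrite /nbk (@eq_isoms Kap n k Q Q' e). Qed.

Lemma residue_card_gt1 : (1 < residue_card v)%N.
Proof. by rewrite residue_card_Kap card_finNzRing_gt1. Qed.

Lemma isometries_finite N n k : finite_set [set: 'M[int_mod v N]_(n, k)].
Proof. exact: (@finite_finset 'M[An N]_(n, k)). Qed.

End Instances.

(** * Lattices and forms in coordinates *)

Section Coordinates.
Variables (F : fieldType) (v : discrete_valuation F).
Variables (V : vectType F).
Local Notation o := (integers v).

Definition combF n (e : n.-tuple V) (x : 'rV[F]_n) : V := \sum_i x 0 i *: tnth e i.

Lemma comb_mval n (e : n.-tuple V) (x : 'rV[o]_n) : comb e x = combF e (mval x).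
Proof. by apply: eq_bigr => i _; rewrite mxE. Qed.

Lemma combFD n (e : n.-tuple V) x y : combF e (x + y) = combF e x + combF e y.
Proof. by rewrite -big_split; apply: eq_bigr => i _; rewrite mxE scalerDl. Qed.

Lemma combFZ n (e : n.-tuple V) c x : combF e (c *: x) = c *: combF e x.
Proof. by rewrite scaler_sumr; apply: eq_bigr => i _; rewrite mxE scalerA. Qed.

Lemma combFB n (e : n.-tuple V) x y : combF e (x - y) = combF e x - combF e y.
Proof. by rewrite combFD -scaleN1r combFZ scaleN1r. Qed.

Lemma combF0 n (e : n.-tuple V) : combF e 0 = 0.
Proof. by rewrite /combF big1// => i _; rewrite mxE scale0r. Qed.

Lemma combF_sum n (e : n.-tuple V) (I : Type) (r : seq I) (G : I -> 'rV[F]_n) :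
  combF e (\sum_(i <- r) G i) = \sum_(i <- r) combF e (G i).
Proof. exact: (big_morph _ (combFD e) (combF0 e)). Qed.

Lemma combF_delta n (e : n.-tuple V) i : combF e (delta_mx 0 i) = tnth e i.
Proof.
rewrite /combF (bigD1 i)//= mxE !eqxx scale1r big1 ?addr0// => j ji.
by rewrite mxE (negPf ji) andbF scale0r.
Qed.

Definition coordF n (e : n.-tuple V) (x : V) : 'rV[F]_n := \row_i coord e i x.

Lemma coordFK n (e : n.-tuple V) : basis_of fullv e -> cancel (coordF e) (combF e).
Proof.
move=> he x; rewrite [RHS](coord_basis he (memvf x)); apply: eq_bigr => i _.
by rewrite mxE (tnth_nth 0).
Qed.

Lemma combFK n (e : n.-tuple V) : basis_of fullv e -> cancel (combF e) (coordF e).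
Proof.
move=> he x; apply/matrixP => i j; rewrite ord1 mxE /combF.
under eq_bigr do rewrite (tnth_nth 0).
by rewrite coord_sum_free// (basis_free he).
Qed.

(* P is the matrix of the family e in the family e'. *)
Definition trans n (e e' : n.-tuple V) (P : 'M[F]_n) : Prop :=
  forall x, combF e x = combF e' (x *m P).

Definition mxbasis n (e' : n.-tuple V) (P : 'M[F]_n) : n.-tuple V :=
  [tuple combF e' (row i P) | i < n].

Lemma mxbasis_trans n (e' : n.-tuple V) (P : 'M[F]_n) : trans (mxbasis e' P) e' P.
Proof.
move=> x; rewrite mulmx_sum_row combF_sum; apply: eq_bigr => i _.
by rewrite combFZ tnth_mktuple.
Qed.

Lemma trans_exists n (e e' : n.-tuple V) : basis_of fullv e' -> exists P, trans e e' P.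
Proof.
move=> he'; pose P : 'M[F]_n := \matrix_i coordF e' (tnth e i).
exists P => x; rewrite -mxbasis_trans; congr combF.
by apply: eq_from_tnth => i; rewrite tnth_mktuple rowK coordFK.
Qed.

Lemma trans_unit n (e e' : n.-tuple V) P : basis_of fullv e -> basis_of fullv e' ->
  trans e e' P -> P \in unitmx.
Proof.
move=> he he' hP; rewrite -row_free_unit; apply/inj_row_free => x xP.
by apply: (can_inj (combFK he)); rewrite hP xP !combF0.
Qed.

Lemma trans_inv n (e e' : n.-tuple V) P : P \in unitmx -> trans e e' P ->
  trans e' e (invmx P).
Proof. by move=> Pu hP x; rewrite hP mulmxKV. Qed.

Lemma trans_mul n (e e' e'' : n.-tuple V) P P' : trans e e' P -> trans e' e'' P' ->
  trans e e'' (P *m P').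
Proof. by move=> h h' x; rewrite h h' mulmxA. Qed.

Lemma trans_inj n (e e' : n.-tuple V) P P' : basis_of fullv e' ->
  trans e e' P -> trans e e' P' -> P = P'.
Proof.
move=> he' h h'; apply/row_matrixP => i; rewrite !rowE.
by apply: (can_inj (combFK he')); rewrite -h -h'.
Qed.

Lemma mxbasis_basis n (e' : n.-tuple V) (P : 'M[F]_n) :
  basis_of fullv e' -> P \in unitmx -> basis_of fullv (mxbasis e' P).
Proof.
move=> he' Pu; rewrite basisEfree; have := he'; rewrite basisEfree => /and3P[_ _ sz].
rewrite subvf size_tuple; rewrite size_tuple in sz; rewrite sz !andbT.
apply/freeP => c hc i; have : combF (mxbasis e' P) (\row_j c j) = 0.
  by rewrite -[RHS]hc; apply: eq_bigr => j _; rewrite mxE (tnth_nth 0).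
rewrite mxbasis_trans => h0.
have : (\row_j c j) *m P = 0.
  rewrite -(combFK he' (_ *m P)) h0; apply/matrixP => a b.
  by rewrite !mxE linear0.
move=> /(congr1 (mulmx^~ (invmx P))); rewrite mulmxK// mul0mx => /matrixP/(_ 0 i).
by rewrite !mxE.
Qed.

Lemma lattice_basisP n (e : n.-tuple V) (M : set V) : lattice_basis v e M ->
  forall x, M (combF e x) <-> mint v x.
Proof.
move=> [he ->] x; split=> [[y _]|/mvalP[y ->]]; last first.
  by exists y; rewrite // comb_mval.
by rewrite comb_mval => /(can_inj (combFK he)) <-; apply: mint_mval.
Qed.

Lemma lattice_basis_of n (e : n.-tuple V) (M : set V) : basis_of fullv e ->
  (forall x, M (combF e x) <-> mint v x) -> lattice_basis v e M.
Proof.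
move=> he hM; split=> //; apply/seteqP; split=> x.
  rewrite -[x](coordFK he) => /hM/mvalP[y ->]; exists y => //.
  by rewrite comb_mval.
by move=> [y _ <-]; rewrite comb_mval; apply/hM/mint_mval.
Qed.

Lemma mint_trans n (P : 'M[F]_n) (M M' : set V) (e e' : n.-tuple V) :
  lattice_basis v e M -> lattice_basis v e' M' -> trans e e' P ->
  (M `<=` M')%classic -> mint v P.
Proof.
move=> hM hM' hP MM'; apply/mintP => i j.
have /MM' : M (tnth e i).
  rewrite -combF_delta; apply/(lattice_basisP hM)/mintP => a b.
  by rewrite mxE; case: andP => _; rewrite ?vge_0// vgeE ?oner_neq0// ordz1.
rewrite -combF_delta hP -rowE => /(lattice_basisP hM')/mintP/(_ 0 j).
by rewrite mxE.
Qed.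

Variables (q : V -> F) (hq : quadratic_form q).

Definition qgram n (e : n.-tuple V) : 'M[F]_n := tri_gram q (tnth e).

Lemma q_combF n (e : n.-tuple V) x : q (combF e x) = tform (qgram e) x.
Proof. exact: (qform_sum hq). Qed.

Lemma qgram_tri n (e : n.-tuple V) : is_tri (qgram e).
Proof. exact: tri_gram_is_tri. Qed.

Lemma tnth_lattice n (e : n.-tuple V) (M : set V) i : lattice_basis v e M -> M (tnth e i).
Proof.
move=> hM; rewrite -combF_delta; apply/(lattice_basisP hM)/mintP => a b.
by rewrite mxE; case: andP => _; rewrite ?vge_0// vgeE ?oner_neq0// ordz1.
Qed.

Lemma lattice_submodule n (e : n.-tuple V) (M : set V) : lattice_basis v e M ->
  submodule v M.
Proof.
move=> hM; have [he _] := hM; split=> [|x y|c x].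
- rewrite -[0](coordFK he); apply/(lattice_basisP hM)/mintP => i j.
  by rewrite mxE linear0 vge_0.
- rewrite -[x](coordFK he) -[y](coordFK he) -combFD.
  by move=> /(lattice_basisP hM) hx /(lattice_basisP hM) hy; apply/(lattice_basisP hM)/mintD.
- rewrite -[x](coordFK he) -combFZ => /(lattice_basisP hM)/mintP hx.
  apply/(lattice_basisP hM)/mintP => i j; rewrite mxE -[0]addr0.
  by apply: vgeM; rewrite ?vge_val.
Qed.

Lemma integral_qgram n (e : n.-tuple V) (M : set V) : lattice_basis v e M ->
  integral_on v q M -> mint v (qgram e).
Proof.
move=> hM qM; apply/mintP => i j; rewrite mxE.
have Mi l := tnth_lattice l hM; have [M0 MD MZ] := lattice_submodule hM.
case: eqP => _; first exact: qM.
case: ifP => _; last exact: vge_0.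
by rewrite /polar !vgeB//; apply: qM => //; apply: MD.
Qed.

Lemma integral_polar n (e : n.-tuple V) (M : set V) x y : lattice_basis v e M ->
  integral_on v q M -> M x -> M y -> vge v 0 (polar q x y).
Proof.
move=> hM qM Mx My; have [M0 MD MZ] := lattice_submodule hM.
by rewrite /polar !vgeB//; apply: qM => //; apply: MD.
Qed.

Definition qint n (e : n.-tuple V) : 'M[o]_n := map_mx (to_int v) (qgram e).

Lemma qint_tri n (e : n.-tuple V) : is_tri (qint e).
Proof.
apply/is_triP => i j ji; rewrite mxE; have /is_triP/(_ i j ji) -> := qgram_tri e.
by apply: val_inj; rewrite vge_to_int// vge_0.
Qed.

Lemma mval_qint n (e : n.-tuple V) : mint v (qgram e) -> mval (qint e) = qgram e.
Proof. by move/mintE. Qed.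

Lemma map_tform (A B : comNzRingType) (g : {rmorphism A -> B}) n (T : 'M[A]_n) x :
  g (tform T x) = tform (map_mx g T) (map_mx g x).
Proof.
rewrite !tformE rmorph_sum; apply: eq_bigr => i _; rewrite rmorph_sum.
by apply: eq_bigr => j _; rewrite !rmorphM !mxE.
Qed.

Lemma val_tform n (T : 'M[o]_n) x : val (tform T x) = tform (mval T) (mval x).
Proof. exact: (map_tform [the {rmorphism _ -> _} of \val : o -> F]). Qed.

Lemma to_int_q n (e : n.-tuple V) x : mint v (qgram e) ->
  to_int v (q (comb e x)) = tform (qint e) x.
Proof.
move=> hT; apply: val_inj; rewrite val_tform mval_qint// -q_combF -comb_mval.
by rewrite vge_to_int// comb_mval q_combF -mval_qint// -val_tform vge_val.
Qed.

(** Reduction is onto, so testing on integral vectors is testing on all vectors of the quotient,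
    where [gram_ofP] applies. *)
Lemma isometries_modE n k (e : n.-tuple V) N : mint v (qgram e) ->
  @isometries_mod F v V q n k e N =
  [set phi | gram_of phi = map_mx (redm v N) (qint e)]%classic.
Proof.
move=> hT; have Ttri : is_tri (map_mx (redm v N) (qint e)).
  by apply/is_triP => i j ji; rewrite mxE; have /is_triP/(_ i j ji) -> := qint_tri e; rewrite rmorph0.
apply/seteqP; split=> phi /=; last first.
  move=> /(gram_ofP _ Ttri) h x; rewrite to_int_q// -redmE map_tform.
  exact: h.
move=> h; apply/(gram_ofP _ Ttri) => y.
have [x ->] : exists x : 'rV[o]_n, y = map_mx (redm v N) x.
  exists (map_mx repr y); apply/matrixP => i j.
  by rewrite !mxE redmE /reduce reprK.
by rewrite -map_tform redmE -to_int_q// -h.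
Qed.

Lemma reduced_formE n (e : n.-tuple V) : mint v (qgram e) ->
  @reduced_form F v V q n e =1 tform (map_mx (resm v) (qint e)).
Proof.
move=> hT y; rewrite /reduced_form to_int_q//.
rewrite (_ : reduce 0 _ = resm v (tform (qint e) (\row_i repr (y 0 i))))// map_tform.
congr tform; apply/matrixP => i j; rewrite !mxE redmE /reduce reprK.
by rewrite ord1.
Qed.

Definition polar_mx n (e : n.-tuple V) : 'M[F]_n := qgram e + (qgram e)^T.

Lemma polar_combF n (e : n.-tuple V) x y :
  polar q (combF e x) (combF e y) = (x *m polar_mx e *m y^T) 0 0.
Proof. by rewrite /polar_mx -tform_polar /polar -combFD !q_combF. Qed.

Lemma polar_mx_unit n (e : n.-tuple V) : basis_of fullv e -> nondegenerate_form q ->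
  polar_mx e \in unitmx.
Proof.
move=> he qn; rewrite -row_free_unit; apply/inj_row_free => x xP.
apply: (can_inj (combFK he)); rewrite combF0; apply: qn => y.
by rewrite -[y](coordFK he) polar_combF xP mul0mx mxE.
Qed.

End Coordinates.

Lemma addmxE (R : nmodType) m n (A B : 'M[R]_(m, n)) i j : (A + B) i j = A i j + B i j.
Proof. by rewrite mxE. Qed.

Lemma scalemxE (R : pzRingType) m n (a : R) (A : 'M[R]_(m, n)) i j : (a *: A) i j = a * A i j.
Proof. by rewrite mxE. Qed.

(** * Primitive matrices over the valuation ring *)

Section IntegralMatrices.
Variables (F : fieldType) (v : discrete_valuation F).
Local Notation o := (integers v).
Local Notation kappa := (residue_field v).

Definition mrepr m n (X : 'M[kappa]_(m, n)) : 'M[o]_(m, n) := map_mx repr X.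

Lemma mreprK m n (X : 'M[kappa]_(m, n)) : map_mx (resm v) (mrepr X) = X.
Proof. by apply/matrixP => i j; rewrite !mxE redmE /reduce reprK. Qed.

Lemma unit_resm n (X : 'M[o]_n) : (X \in unitmx) = (map_mx (resm v) X \in unitmx).
Proof. by rewrite !unitmxE det_map_mx unitfE resm_unit. Qed.

Lemma prim_mulU n m (Y : 'M[o]_n) (phi : 'M[o]_(n, m)) : Y \in unitmx ->
  prim_int (Y *m phi) = prim_int phi.
Proof.
rewrite unit_resm => Yu; rewrite /prim_int map_mxM /row_free eqmxMfull//.
by rewrite row_full_unit.
Qed.

Lemma prim_right_inv n m (phi : 'M[o]_(n, m)) : prim_int phi ->
  exists r : 'M[o]_(m, n), phi *m r \in unitmx.
Proof.
move=> /row_freeP[r hr]; exists (mrepr r).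
by rewrite unit_resm map_mxM mreprK hr unitmx1.
Qed.

(** A primitive matrix has an integral right inverse up to an invertible factor, so multiplication
    by it detects integrality. *)
Lemma prim_integral n m (phi : 'M[o]_(n, m)) (y : 'rV[F]_n) : prim_int phi ->
  mint v (y *m mval phi) -> mint v y.
Proof.
move=> /prim_right_inv[r u] h; have [u' uE] := mval_unit u.
rewrite -[y](mulmxK u') uE; apply: mintM; last exact: mint_mval.
by rewrite mvalM mulmxA; apply: mintM h _; apply: mint_mval.
Qed.

Lemma mint_scale_exists m n (X : 'M[F]_(m, n)) :
  exists C : nat, mint v (unif v ^ C%:Z *: X).
Proof.
exists (\sum_i \sum_j `|ordz v (X i j)|)%N; apply/mintP => i j.
rewrite mxE vge_unifM sub0r; have [->|x0] := eqVneq (X i j) 0; first exact: vge_0.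
rewrite vgeE// lerNl.
have : (`|ordz v (X i j)| <= \sum_i \sum_j `|ordz v (X i j)|)%N.
  by rewrite (bigD1 i)//= (bigD1 j)//= -addnA leq_addr.
rewrite -lez_nat; apply: le_trans; rewrite abszE.
by rewrite -normrN ler_norm.
Qed.

Lemma mint_scale_le m n (X : 'M[F]_(m, n)) (a b : int) : a <= b ->
  mint v (unif v ^ a *: X) -> mint v (unif v ^ b *: X).
Proof.
move=> ab /mintP h; apply/mintP => i j; have := h i j; rewrite !mxE !vge_unifM.
by apply: vge_le; rewrite !sub0r lerN2.
Qed.

(** The reduction is rank deficient, so row operations make the last row divisible by pi. Pulling
    out pi costs exactly 1 in the valuation of the determinant, which is the quantity maximized in
    [rel_exists]. *)
Lemma not_prim_factor n m (phi : 'M[o]_(n, m)) : (0 < n)%N -> ~~ prim_int phi ->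
  exists (P : 'M[o]_n) (psi : 'M[o]_(n, m)),
    [/\ phi = P *m psi, mval P \in unitmx & ordz v (\det (mval P)) = 1].
Proof.
case: n phi => // n phi _ np; set phib := map_mx (resm v) phi.
have rk : (\rank phib < n.+1)%N by rewrite ltn_neqAle np rank_leq_row.
pose U := mrepr (invmx (col_ebase phib)).
have Uu : U \in unitmx by rewrite unit_resm mreprK unitmx_inv col_ebase_unit.
have U0 j : resm v ((U *m phi) ord_max j) = 0.
  have -> : resm v ((U *m phi) ord_max j) = (invmx (col_ebase phib) *m phib) ord_max j.
    by rewrite -{1}(mreprK (invmx (col_ebase phib))) -map_mxM [RHS]mxE.
  rewrite -{2}(mulmx_ebase phib) !mulmxA mulVmx ?col_ebase_unit// mul1mx.
  rewrite mxE big1// => i _; rewrite mxE ltnNge -ltnS /= rk.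
  by rewrite andbF mul0r.
pose D : 'M[o]_n.+1 := diag_mx (\row_i (if i == ord_max then piI v else 1)).
have ex j : exists y, (U *m phi) ord_max j = piI v * y by apply/resm_ker.
pose psi : 'M[o]_(n.+1, m) := \matrix_(i, j)
   if i == ord_max then projT1 (cid (ex j)) else (U *m phi) i j.
have Dpsi : D *m psi = U *m phi.
  apply/matrixP => i j; rewrite mul_diag_mx mxE [(\row__ _) 0 i]mxE [psi i j]mxE.
  by case: eqP => [->|_]; rewrite ?mul1r//; case: cid.
have mU : mval (invmx U) \in unitmx by rewrite -(mval_unit Uu).2 unitmx_inv (mval_unit Uu).1.
have dD : \det (mval D) = unif v.
  rewrite det_mval det_diag (bigD1 ord_max)//= mxE eqxx big1 ?mulr1 ?val_piI//.
  by move=> i ii; rewrite mxE (negPf ii).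
have dU : ordz v (\det (mval (invmx U))) = 0.
  have : invmx U \in unitmx by rewrite unitmx_inv.
  by rewrite unitmxE unit_ordz det_mval => /andP[_ /eqP].
have du0 : \det (mval (invmx U)) != 0 by move: mU; rewrite unitmxE unitfE.
exists (invmx U *m D), psi; split.
- by rewrite -mulmxA Dpsi mulKmx.
- by rewrite mvalM unitmx_mul mU unitmxE unitfE dD unif_neq0.
- by rewrite mvalM det_mulmx ordzM// ?dD ?unif_neq0// dU ordz_unif.
Qed.

End IntegralMatrices.

(** * Partition of the isometries by overlattices *)

Section Partition.
Variables (F : fieldType) (v : discrete_valuation F) (V : vectType F).
Variables (q : V -> F) (hq : quadratic_form q) (qn : nondegenerate_form q).
Variables (n : nat) (n_gt0 : (0 < n)%N) (L : set V) (e : n.-tuple V).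
Hypotheses (he : lattice_basis v e L) (qL : integral_on v q L).
Local Notation o := (integers v).
Local Notation pF := (unif v).

Let be : basis_of fullv e := he.1.
Let Te : mint v (qgram q e) := integral_qgram he qL.

Definition is_over (M : set V) : Prop :=
  [/\ (L `<=` M)%classic, exists e' : n.-tuple V, lattice_basis v e' M & integral_on v q M].

(** pi^C clears the denominators of the inverse polar matrix, that is, of the dual lattice of L in
    the basis [e]. *)
Definition nd_const : nat :=
  projT1 (cid (mint_scale_exists v (invmx (polar_mx q e)))).
Local Notation C := nd_const.

Lemma nd_constP : mint v (pF ^ C%:Z *: invmx (polar_mx q e)).
Proof. by rewrite /nd_const; case: cid. Qed.

Let Pu : polar_mx q e \in unitmx := polar_mx_unit hq be qn.

Lemma polar_mx_bound (a : int) m (x : 'M[F]_(m, n)) :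
  mint v (pF ^ a *: (x *m polar_mx q e)) -> mint v (pF ^ (a + C%:Z) *: x).
Proof.
move=> h; have -> : pF ^ (a + C%:Z) *: x =
    (pF ^ a *: (x *m polar_mx q e)) *m (pF ^ C%:Z *: invmx (polar_mx q e)).
  by rewrite -scalemxAl -scalemxAr mulmxK// scalerA unifzD.
by apply: mintM h _; apply: nd_constP.
Qed.

(** M contains L and pairs integrally with itself, so it lies in the dual lattice of L. *)
Lemma over_bound M (x : 'rV[F]_n) : is_over M -> M (combF e x) ->
  mint v (pF ^ C%:Z *: x).
Proof.
move=> [LM [e' he'] qM] Mx; rewrite -[C%:Z]add0r; apply: polar_mx_bound.
rewrite expr0z scale1r; apply/mintP => i j; rewrite ord1.
have -> : (x *m polar_mx q e) 0 j = polar q (combF e x) (tnth e j).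
  by rewrite -[tnth e j](combF_delta e) polar_combF// trmx_delta -colE [RHS]mxE.
apply: (integral_polar he' qM) => //; apply: LM; exact: tnth_lattice he.
Qed.

Variables (k N : nat).
Hypotheses (CN : (2 * C <= N)%N).

Lemma map_hyperbolic (A B : comNzRingType) (g : {rmorphism A -> B}) (y : 'rV[A]_(k + k)) :
  g (hyperbolic_form y) = hyperbolic_form (map_mx g y).
Proof.
by rewrite /hyperbolic_form rmorph_sum; apply: eq_bigr => i _; rewrite rmorphM !mxE.
Qed.

Lemma hyp_red (P : 'M[o]_n) (phi : 'M[o]_(n, k + k)) :
  gram_of (map_mx (redm v N) (P *m phi)) = map_mx (redm v N) (qint v q e) ->
  forall z : 'rV[o]_n, exists t, hyperbolic_form (z *m P *m phi) =
      tform (qint v q e) z + piI v ^+ N.+1 * t.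
Proof.
have Ttri : is_tri (map_mx (redm v N) (qint v q e)).
  apply/is_triP => i j ji; rewrite mxE.
  by have /is_triP/(_ i j ji) -> := qint_tri v q e; rewrite rmorph0.
move=> /(gram_ofP _ Ttri) h z; apply/reduce_eq; rewrite -!redmE map_tform -h.
by rewrite -map_mxM map_hyperbolic mulmxA.
Qed.

Lemma val_polar_tform (T : 'M[o]_n) z w :
  val (polar (tform T) z w) = (mval z *m (mval T + (mval T)^T) *m (mval w)^T) 0 0.
Proof.
rewrite tform_polar; set X := z *m _ *m _.
have -> : val (X 0 0) = mval X 0 0 by rewrite [RHS]mxE.
rewrite /X !mvalM; congr ((_ *m _ *m _) _ _).
  by apply/matrixP => i j; rewrite !mxE.
by apply/matrixP => i j; rewrite !mxE.
Qed.

(** For an arbitrary P only some bound on the denominators of P^-1 is available, and it is lowered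
    one step at a time down to C. If z = pi^(C+j+1) x P^-1 is integral, the congruence for P phi
    makes the polar values of z multiples of pi^(C+1), so z is divisible by pi. *)
Lemma factor_bound (P : 'M[o]_n) (phi : 'M[o]_(n, k + k)) : mval P \in unitmx ->
  gram_of (map_mx (redm v N) (P *m phi)) = map_mx (redm v N) (qint v q e) ->
  mint v (pF ^ C%:Z *: invmx (mval P)).
Proof.
move=> Pm hP; suff row_ok (x : 'rV[o]_n) : mint v (pF ^ C%:Z *: (mval x *m invmx (mval P))).
  apply/mintP => i j; have := mintP _ _ (row_ok (delta_mx 0 i)) 0 j.
  by rewrite /mval map_delta_mx -rowE !mxE.
set X := mval x *m invmx (mval P).
have [j0] := mint_scale_exists v X.
have step j : mint v (pF ^ (C + j).+1%:Z *: X) -> mint v (pF ^ (C + j)%:Z *: X).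
  move=> /mvalP[z zE].
  have zP : z *m P = piI v ^+ (C + j).+1 *: x.
    apply: mval_inj; rewrite mvalM -zE -scalemxAl /X mulmxKV//.
    by apply/matrixP => a b; rewrite !mxE val_mul val_exp val_piI -exprnP.
  have hz := hyp_red hP.
  have pol w : vge v C.+1%:Z (val (polar (tform (qint v q e)) z w)).
    have [t1 E1] := hz (z + w); have [t2 E2] := hz z; have [t3 E3] := hz w.
    pose t := t1 - t2 - t3.
    have -> : polar (tform (qint v q e)) z w =
        polar (@hyperbolic_form o k) (z *m P *m phi) (w *m P *m phi) - piI v ^+ N.+1 * t.
      rewrite /polar -!mulmxDl E1 E2 E3 /t.
      move: (tform _ (z + w)) (tform _ z) (tform _ w) (piI v ^+ N.+1) => a1 a2 a3 b.
      by rewrite !mulrBr !opprD !opprK !addrA; clear; ring.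
    rewrite zP -scalemxAl polarZl; last exact: hyperbolic_quadratic.
    apply/vge_piX; exists (piI v ^+ j * polar (@hyperbolic_form o k) (x *m phi) (w *m P *m phi)
       - piI v ^+ (N - C) * t).
    have -> : (C + j).+1 = (C.+1 + j)%N by [].
    have -> : N.+1 = (C.+1 + (N - C))%N by rewrite addSn subnKC//; lia.
    rewrite !exprD; move: (polar _ _ _) (piI v ^+ C.+1) (piI v ^+ j) (piI v ^+ (N - C)) => a1 a2 a3 a4.
    by rewrite -!mulrA -mulrBr.
  have : mint v (pF ^ (- C.+1%:Z) *: (mval z *m polar_mx q e)).
    apply/mintP => a b; rewrite mxE vge_unifM opprK add0r ord1.
    have := pol (delta_mx 0 b); rewrite val_polar_tform mval_qint//.
    by rewrite /mval map_delta_mx trmx_delta -colE mxE.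
  move=> /polar_mx_bound; rewrite -zE scalerA -unifzD.
  by have -> : - C.+1%:Z + C%:Z + (C + j).+1%:Z = (C + j)%N%:Z by lia.
move=> hj0; have : mint v (pF ^ (C + j0)%N%:Z *: X).
  by apply: mint_scale_le hj0; lia.
elim: {hj0} j0 => [|j IH]; first by rewrite addn0.
by rewrite addnS => /step.
Qed.

(** P expresses the inclusion of L in M, so phi comes from a map on M that is injective modulo
    pi. *)
Definition rel (phi : 'M[int_mod v N]_(n, k + k)) (M : set V) : Prop :=
  exists (e' : n.-tuple V) (P : 'M[o]_n) (Phi : 'M[o]_(n, k + k)),
    [/\ lattice_basis v e' M, trans e e' (mval P), prim_int Phi
      & phi = map_mx (redm v N) (P *m Phi)].

(* A factorization phi = P Phi with v(det P) maximal has Phi primitive. *)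
Lemma rel_exists (phi : 'M[int_mod v N]_(n, k + k)) :
  gram_of phi = map_mx (redm v N) (qint v q e) -> exists2 M, is_over M & rel phi M.
Proof.
move=> hphi.
pose ok m := `[< exists (P : 'M[o]_n) (Phi : 'M[o]_(n, k + k)),
  [/\ mval P \in unitmx, phi = map_mx (redm v N) (P *m Phi)
    & ordz v (\det (mval P)) = m%:Z] >].
have ok_ex : exists m, ok m.
  exists 0%N; apply/asboolP; exists 1%:M, (map_mx repr phi).
  rewrite mval1 unitmx1 det1 ordz1; split=> //; rewrite mul1mx.
  by apply/matrixP => i j; rewrite !mxE redmE /reduce reprK.
(* The matrix pi^C P^-1 is integral, and so is its determinant. *)
have ok_bd m : ok m -> (m <= n * C)%N.
  move=> /asboolP[P [Phi [Pm hP dP]]].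
  have := factor_bound (phi := Phi) Pm; rewrite -hP => /(_ hphi)/mvalP[X XE].
  have : vge v 0 (\det (mval X)) by rewrite det_mval vge_val.
  have dP0 : \det (mval P) != 0 by move: Pm; rewrite unitmxE unitfE.
  rewrite -XE detZ det_inv [_ ^+ n]exprnP exprz_exp vge_unifM vgeE ?invr_neq0// ordzV// dP.
  by lia.
have [m okm mmax] := ex_maxnP ok_ex ok_bd.
move: okm => /asboolP[P [Phi [Pm hP dP]]].
have Pi : mint v (pF ^ C%:Z *: invmx (mval P)).
  by apply: (factor_bound Pm (phi := Phi)); rewrite -hP.
have prim : prim_int Phi.
  apply/negPn/negP => /(not_prim_factor n_gt0)[D [psi [PhiE Dm dD]]].
  have /mmax : ok m.+1; last by rewrite ltnn.
  apply/asboolP; exists (P *m D), psi; rewrite mvalM unitmx_mul Pm Dm -mulmxA -PhiE.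
  split=> //; rewrite det_mulmx ordzM ?dP ?dD; first by lia.
    by move: Pm; rewrite unitmxE unitfE.
  by move: Dm; rewrite unitmxE unitfE.
pose e' := mxbasis e (invmx (mval P)).
have te' : trans e' e (invmx (mval P)) by exact: mxbasis_trans.
have Pim : invmx (mval P) \in unitmx by rewrite unitmx_inv.
have be' : basis_of fullv e' by apply: mxbasis_basis.
have te : trans e e' (mval P) by have := trans_inv Pim te'; rewrite invmxK.
pose M := [set combF e' y | y in [set y | mint v y]]%classic.
have he' : lattice_basis v e' M.
  apply: lattice_basis_of => // x; split=> [[y yi /(can_inj (combFK be')) <-]//|xi].
  by exists x.
exists M; last by exists e', P, Phi.
split; [|by exists e'|].
  move=> x; rewrite -[x](coordFK be) => /(lattice_basisP he) xi.
  by rewrite te; apply/(lattice_basisP he'); apply: mintM xi (mint_mval _).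
(* Integrality of q on M: for x in M the vector pi^C x is in L, and its value pi^(2C) q(x) is
   congruent modulo pi^(N+1) to a multiple of pi^(2C). Here 2C <= N enters. *)
move=> _ [y /mvalP[{}y ->] <-]; rewrite te' q_combF//.
set x := mval y *m _.
have [z zE] : exists z : 'rV[o]_n, pF ^ C%:Z *: x = mval z.
  by apply/(mvalP v _); rewrite /x scalemxAr; apply: mintM (mint_mval _) Pi.
have zP : z *m P = piI v ^+ C *: y.
  apply: mval_inj; rewrite mvalM -zE -scalemxAl /x mulmxKV//.
  by apply/matrixP => a b; rewrite !mxE val_mul val_exp val_piI -exprnP.
rewrite hP in hphi; have [t ht] := hyp_red hphi z.
have := congr1 val ht; rewrite zP -scalemxAl (hyperbolic_quadratic o k).1.
rewrite -[val (_ + _)]/(_ + _) val_mul => hv.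
have tz : val (tform (qint v q e) z) = (pF ^ C%:Z) ^+ 2 * tform (qgram q e) x.
  rewrite val_tform mval_qint// -zE; exact: (tform_quadratic _).1.
have : vge v (2 * C)%N%:Z ((pF ^ C%:Z) ^+ 2 * tform (qgram q e) x).
  rewrite -tz -[X in vge _ _ X](addrK (val (piI v ^+ N.+1 * t))).
  have -> : val (tform (qint v q e) z) + val (piI v ^+ N.+1 * t) =
     val ((piI v ^+ C) ^+ 2 * hyperbolic_form (y *m Phi)) by rewrite val_mul -hv.
  apply: vgeB; first by apply/vge_piX; eexists; rewrite -exprM mulnC.
  by apply: vge_le (_ : vge v N.+1%:Z _); [lia|apply/vge_piX; eexists].
rewrite exprnP exprz_exp vge_unifM.
by have -> : (2 * C)%N%:Z - C%:Z * 2%:Z = 0 by lia.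
Qed.

(** Two lifts P1 Phi1 and P2 Phi2 of phi differ by a multiple of pi^(N+1), which absorbs the
    denominators of M1, at most pi^C. So x in M1 has an integral image under P2 Phi2, and
    primitivity of Phi2 puts x in M2. *)
Lemma rel_unique phi M1 M2 : is_over M1 -> rel phi M1 -> rel phi M2 -> (M1 `<=` M2)%classic.
Proof.
move=> oM1 [e1 [P1 [Phi1 [h1 t1 p1 E1]]]] [e2 [P2 [Phi2 [h2 t2 p2 E2]]]] x.
rewrite -[x](coordFK be); set y := coordF e x => Mx.
have yC := over_bound oM1 Mx; move: Mx.
rewrite [X in M1 X]t1 => /(lattice_basisP h1) i1; rewrite t2; apply/(lattice_basisP h2).
apply: (prim_integral p2); rewrite -mulmxA -mvalM.
have [Z ZE] : exists Z : 'M[o]_(n, k + k), P2 *m Phi2 = P1 *m Phi1 + piI v ^+ N.+1 *: Z.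
  have ex i j : exists z, (P2 *m Phi2) i j = (P1 *m Phi1) i j + piI v ^+ N.+1 * z.
    apply/reduce_eq; transitivity (map_mx (redm v N) (P2 *m Phi2) i j); first by rewrite [RHS]mxE.
    by rewrite -E2 E1 [LHS]mxE.
  exists (\matrix_(i, j) projT1 (cid (ex i j))); apply/matrixP => i j.
  by rewrite addmxE scalemxE [(\matrix_(_, _) _) i j]mxE; case: cid.
have -> : mval (P2 *m Phi2) = mval (P1 *m Phi1) + pF ^ N.+1%:Z *: mval Z.
  rewrite ZE; apply/matrixP => i j.
  by rewrite [LHS]mxE !addmxE !scalemxE [mval _ i j]mxE [mval Z i j]mxE -exprnP -val_piI -val_exp -val_mul.
rewrite mulmxDr mvalM mulmxA; apply: mintD; first by apply: mintM i1 (mint_mval _).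
rewrite -scalemxAr scalemxAl; apply: mintM (mint_mval _).
by apply: mint_scale_le yC; lia.
Qed.

Lemma basis_change (e1 g : n.-tuple V) M : lattice_basis v e1 M -> lattice_basis v g M ->
  exists2 Y : 'M[o]_n, Y \in unitmx & trans e1 g (mval Y).
Proof.
move=> h1 hg; have [Y tY] := trans_exists e1 hg.1.
have Yi := mint_trans h1 hg tY (@subset_refl _ M).
have Yu := trans_unit h1.1 hg.1 tY.
have Vi := mint_trans hg h1 (trans_inv Yu tY) (@subset_refl _ M).
have [Y' YE] := (mvalP _ Y).1 Yi; exists Y'; last by rewrite -YE.
by apply: unit_mval; rewrite -YE.
Qed.

(** Elementary divisors, from [wsmith] with all weights 0: preserving the norm then means that U is
    invertible over the valuation ring. *)
Lemma adapted_basis M (e' : n.-tuple V) : lattice_basis v e' M -> (L `<=` M)%classic ->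
  exists (g : n.-tuple V) (U P : 'M[o]_n) (c : 'I_n -> nat),
    [/\ lattice_basis v g M, U \in unitmx, trans e g (mval P) & U *m P = dpi (piI v) c].
Proof.
move=> he' LM; have [P0 tP0] := trans_exists e he'.1.
have P0i := mint_trans he he' tP0 LM.
have P0u := trans_unit be he'.1 tP0.
have [U [W [al [c [Uu Wu [_ alD] Uw UPW]]]]] := wsmith v (fun=> 0) P0u.
have al0 i : al i = 0 by apply: (alD (fun z => z = 0)).
have wE (ga : 'I_n -> int) (x : 'rV[F]_n) : (forall i, ga i = 0) -> wge v ga 0 x = mint v x.
  move=> g0; apply/wgeP/mintP => [h i j|h i].
    by have := h j; rewrite g0 subrr ord1 -[0](mulr0 2) vge2_double.
  by rewrite g0 subrr -[0](mulr0 2) vge2_double.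
have Ux (x : 'rV[F]_n) : mint v (x *m U) = mint v x by rewrite -!(wE (fun=> 0))// Uw !wE.
have dI i : mint v (delta_mx 0 i : 'rV[F]_n).
  apply/mintP => a b; rewrite mxE; case: andP => _; rewrite ?vge_0//.
  by rewrite vgeE ?oner_neq0// ordz1.
have Ui : mint v U.
  apply/mintP => i j; have := dI i; rewrite -Ux -rowE => /mintP/(_ 0 j).
  by rewrite mxE.
have Uvi : mint v (invmx U).
  apply/mintP => i j; have : mint v ((delta_mx 0 i : 'rV[F]_n) *m invmx U).
    by rewrite -Ux mulmxKV.
  by rewrite -rowE => /mintP/(_ 0 j); rewrite mxE.
have [U' UE] := (mvalP _ U).1 Ui.
have U'u : U' \in unitmx by apply: unit_mval; rewrite -UE.
have c0 i : 0 <= c i.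
  have : mint v (diag_mx (\row_i pF ^ c i)).
    by rewrite -UPW; apply: mintM (mint_mval _); apply: mintM.
  by move=> /mintP/(_ i i); rewrite !mxE eqxx mulr1n vgeE ?unifz_neq0// ordz_unifz.
pose Wm := mval W; have [Wmu WmV] := mval_unit Wu.
pose g := mxbasis e' (invmx Wm).
have tg : trans g e' (invmx Wm) by exact: mxbasis_trans.
have Wiu : invmx Wm \in unitmx by rewrite unitmx_inv.
have bg : basis_of fullv g by apply: mxbasis_basis => //; exact: he'.1.
have tge : trans e' g Wm by have := trans_inv Wiu tg; rewrite invmxK.
have hg : lattice_basis v g M.
  apply: lattice_basis_of => // x; rewrite tg; split=> [/(lattice_basisP he') xi|xi].
    by rewrite -[x](mulmxKV Wmu); apply: mintM xi (mint_mval _).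
  by apply/(lattice_basisP he'); apply: mintM xi _; rewrite WmV mint_mval.
have tP : trans e g (P0 *m Wm) by apply: trans_mul tP0 tge.
have [P PE] : exists P : 'M[o]_n, P0 *m Wm = mval P.
  by apply/(mvalP v _); apply: mintM P0i (mint_mval _).
exists g, U', P, (fun i => `|c i|%N); split=> //; first by rewrite -PE.
apply: mval_inj; rewrite mvalM -UE -PE mulmxA UPW.
apply/matrixP => i j; rewrite !mxE; case: eqP => _; rewrite ?mulr1n ?mulr0n.
  by rewrite val_exp val_piI exprnP gez0_abs.
by [].
Qed.

Lemma scaled_form M g (U P : 'M[o]_n) c : lattice_basis v g M -> integral_on v q M ->
  trans e g (mval P) -> U *m P = dpi (piI v) c -> forall x,
  tform (qint v q e) (x *m U) = tform (scaled (piI v) c (qint v q g)) x.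
Proof.
move=> hg qM tP UP x.
have Tg : mint v (qgram q g) by apply: integral_qgram qM.
have -> : tform (scaled (piI v) c (qint v q g)) x = tform (qint v q g) (x *m dpi (piI v) c).
  rewrite !tformE; apply: eq_bigr => i _; apply: eq_bigr => j _.
  by rewrite /dpi !mul_mx_diag !mxE; ring.
rewrite -UP; apply: val_inj; rewrite !val_tform !mval_qint// -!q_combF// mulmxA mvalM.
by rewrite (tP (mval x *m mval U)) !mvalM.
Qed.

(** Multiplication by U is a bijection that turns extension to M into left divisibility by
    diag(pi^c_i), the situation of [ncard_dsols]. *)
Lemma rel_adapted M g (U P : 'M[o]_n) c phi :
  is_over M -> lattice_basis v g M -> U \in unitmx -> trans e g (mval P) ->
  U *m P = dpi (piI v) c ->
  (gram_of phi = map_mx (redm v N) (qint v q e) /\ rel phi M) <->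
  (gram_of (map_mx (redm v N) U *m phi) =
     map_mx (redm v N) (scaled (piI v) c (qint v q g)) /\
   exists Phi : 'M[o]_(n, k + k), prim_int Phi /\
     map_mx (redm v N) U *m phi = map_mx (redm v N) (dpi (piI v) c *m Phi)).
Proof.
move=> [LM _ qM] hg Uu tP UP; set Ur := map_mx (redm v N) U.
pose Vr := map_mx (redm v N) (invmx U).
have VU : Vr *m Ur = 1%:M by rewrite -map_mxM mulVmx// map_mx1.
have UV : Ur *m Vr = 1%:M by rewrite -map_mxM mulmxV// map_mx1.
have tri_red (T : 'M[o]_n) : is_tri T -> is_tri (map_mx (redm v N) T).
  move=> hT; apply/is_triP => i j ji; rewrite mxE.
  by have /is_triP/(_ i j ji) -> := hT; rewrite rmorph0.
have t1 := tri_red _ (qint_tri v q e).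
have t2 : is_tri (map_mx (redm v N) (scaled (piI v) c (qint v q g))).
  apply: tri_red; apply/is_triP => i j ji; rewrite mxE.
  by have /is_triP/(_ i j ji) -> := qint_tri v q g; rewrite mulr0.
have formE y : tform (map_mx (redm v N) (qint v q e)) (y *m Ur) =
   tform (map_mx (redm v N) (scaled (piI v) c (qint v q g))) y.
  have [x ->] : exists x : 'rV[o]_n, y = map_mx (redm v N) x.
    exists (map_mx repr y); apply/matrixP => i j.
    by rewrite !mxE redmE /reduce reprK.
  by rewrite -map_mxM -!map_tform (scaled_form hg qM tP UP).
have gE : gram_of phi = map_mx (redm v N) (qint v q e) <->
    gram_of (Ur *m phi) = map_mx (redm v N) (scaled (piI v) c (qint v q g)).
  split=> [/(gram_ofP _ t1) h|/(gram_ofP _ t2) h].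
    apply/(gram_ofP _ t2) => y; by rewrite mulmxA h formE.
  apply/(gram_ofP _ t1) => y.
  by have := h (y *m Vr); rewrite -formE (mulmxA (y *m Vr)) -(mulmxA y) VU mulmx1.
split=> -[hg1 h]; (split; first by apply/gE).
  case: h => e1 [P1 [Phi1 [h1 tr1 p1 ->]]].
  have [Y Yu tY] := basis_change h1 hg.
  exists (invmx Y *m Phi1); rewrite prim_mulU ?unitmx_inv//; split=> //.
  rewrite -map_mxM; congr map_mx; rewrite !mulmxA -UP; congr (_ *m _).
  have PE : P = P1 *m Y.
    by apply: mval_inj; rewrite mvalM; apply: (trans_inj hg.1 tP); apply: trans_mul tr1 tY.
  by rewrite PE mulmxA mulmxK.
case: h => Phi [pP hPhi]; exists g, P, Phi; split=> //.
by rewrite -[phi]mul1mx -VU -mulmxA hPhi -UP -mulmxA [X in _ *m X]map_mxM mulmxA VU mul1mx.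
Qed.

Hypothesis hfin : finite_set [set: residue_field v].

Lemma rel_count M g (U P : 'M[o]_n) c :
  is_over M -> lattice_basis v g M -> U \in unitmx -> trans e g (mval P) ->
  U *m P = dpi (piI v) c -> (forall i j, c i + c j <= N)%N ->
  (ncard [set phi | gram_of phi = map_mx (redm v N) (qint v q e) /\ rel phi M]%classic
   * residue_card v ^ ((k + k) * \sum_i c i) * residue_card v ^ (N * (n * n.+1)./2)
   = residue_card v ^ (n.+1 * \sum_i c i) *
     (nbk hfin k (tform (map_mx (resm v) (qint v q g)))
      * residue_card v ^ (N * (n * (k + k)))))%N.
Proof.
move=> oM hg Uu tP UP cN; rewrite -(ncard_dsols hfin k (qint_tri v q g) cN).
congr (_ * _ * _)%N; rewrite !(ncard_An hfin).
pose Ur : 'M[An hfin N]_n := map_mx (redm v N) U.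
pose Vr : 'M[An hfin N]_n := map_mx (redm v N) (invmx U).
have VU : Vr *m Ur = 1%:M by rewrite -map_mxM mulVmx// map_mx1.
have UV : Ur *m Vr = 1%:M by rewrite -map_mxM mulmxV// map_mx1.
pose h (phi : 'M[An hfin N]_(n, k + k)) : 'M[An hfin N]_(n, k + k) := Ur *m phi.
have hb : bijective h.
  by exists (mulmx Vr) => phi; rewrite /h mulmxA ?VU ?UV mul1mx.
rewrite -[RHS](on_card_preimset (f := h)); last by apply: onW_bij.
apply: eq_card => phi; rewrite !inE; apply/asboolP/asboolP.
  by move=> H; apply/(rel_adapted phi oM hg Uu tP UP).
by move=> H; apply/(rel_adapted phi oM hg Uu tP UP).
Qed.

End Partition.

Section CoordLinear.
Variables (F : fieldType) (V : vectType F) (n : nat) (g : n.-tuple V).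

Lemma coordFD x y : coordF g (x + y) = coordF g x + coordF g y.
Proof. by apply/rowP => i; rewrite !mxE linearD. Qed.

Lemma coordFZ c x : coordF g (c *: x) = c *: coordF g x.
Proof. by apply/rowP => i; rewrite !mxE linearZ. Qed.

Lemma coordF0 : coordF g 0 = 0.
Proof. by apply/rowP => i; rewrite !mxE linear0. Qed.

End CoordLinear.

(** * The length of an overlattice from its elementary divisors *)

Section Length.
Variables (F : fieldType) (v : discrete_valuation F) (V : vectType F).
Variables (n : nat) (g : n.-tuple V).
Hypothesis bg : basis_of fullv g.
Local Notation o := (integers v).
Local Notation pF := (unif v).

Definition lat (c : 'I_n -> nat) : set V :=
  [set x | forall i, vge v (c i)%:Z (coordF g x 0 i)]%classic.

Lemma lat_submodule c : submodule v (lat c).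
Proof.
split=> [i|x y hx hy i|a x hx i].
- by rewrite coordF0 mxE vge_0.
- by rewrite coordFD mxE vgeD.
- by rewrite coordFZ mxE -[(c i)%:Z]add0r vgeM// vge_val.
Qed.

Lemma lat_comb c (x : 'rV[F]_n) : lat c (combF g x) <-> forall i, vge v (c i)%:Z (x 0 i).
Proof. by rewrite /lat /= combFK. Qed.

Lemma eq_lat c c' : c =1 c' -> lat c = lat c'.
Proof. by move=> cc; congr lat; apply/funext. Qed.

Lemma lat_chain c : strict_chain v (lat c) (lat (fun=> 0%N)) (\sum_i c i).
Proof.
move: {2}(\sum_i c i)%N (erefl (\sum_i c i)%N) => m.
elim: m c => [|m IH] c cm; rewrite cm.
  have c0 : c =1 (fun=> 0%N).
    by move=> i; move/eqP: cm; rewrite sum_nat_eq0 => /forallP/(_ i)/eqP.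
  exists (fun=> lat (fun=> 0%N)); split=> //; first by rewrite (eq_lat c0).
  by move=> i _; apply: lat_submodule.
have [i0 ci0] : exists i0, (0 < c i0)%N.
  apply/existsP; rewrite -[X in is_true X]negbK negb_exists; apply/negP => /forallP h.
  by move: cm; rewrite big1// => i _; apply/eqP; rewrite -leqn0 leqNgt h.
pose c' i := (c i - (i == i0))%N.
have cE i : (c' i + (i == i0) = c i)%N by rewrite subnK//; case: eqP => // ->.
have c'm : (\sum_i c' i)%N = m.
  have : (\sum_i c i = \sum_i c' i + \sum_i (i == i0))%N.
    by rewrite -big_split; apply: eq_bigr => i _; rewrite -[RHS]/(c' i + (i == i0))%N cE.
  have -> : (\sum_i (i == i0) = 1)%N.
    by rewrite (bigD1 i0)//= eqxx big1// => i /negPf ->.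
  by rewrite cm addn1 => -[].
have [d [d0 dm ds dlt]] := IH c' c'm; rewrite c'm in dm ds dlt.
exists (fun j => if j is j'.+1 then d j' else lat c); split=> //.
  by move=> [|i] im; [exact: lat_submodule|exact: ds].
move=> [|i] im; last exact: dlt.
rewrite d0; split=> [x hx i|sub].
  by apply: vge_le (hx i); rewrite lez_nat -(cE i) leq_addr.
have : lat c' (combF g (pF ^ (c' i0)%:Z *: delta_mx 0 i0)).
  apply/lat_comb => i; rewrite !mxE; case: (i =P i0) => [->|_] /=.
    by rewrite mulr1 vge_unif.
  by rewrite mulr0 vge_0.
move=> /sub/lat_comb/(_ i0); rewrite !mxE !eqxx mulr1 vgeE ?unifz_neq0// ordz_unifz.
by rewrite lez_nat -(cE i0) eqxx addn1 ltnn.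
Qed.

Hypothesis hfin : finite_set [set: residue_field v].
Variables (c : 'I_n -> nat) (N : nat).
Hypothesis cN : forall i, (c i <= N)%N.
Local Notation A := (An hfin N).

(** Lengths are compared with cardinalities. A module containing [lat c] contains pi^(N+1) times the
    big lattice, so its coordinates modulo pi^(N+1) determine membership. *)
Definition classes (X : set V) : {set 'rV[A]_n} :=
  [set y : 'rV[A]_n | `[< X (comb g (map_mx repr (y : 'rV[int_mod v N]_n))) >]].

Lemma classesP (X : set V) (z : 'rV[o]_n) : submodule v X -> (lat c `<=` X)%classic ->
  (map_mx (redm v N) z : 'rV[A]_n) \in classes X <-> X (comb g z).
Proof.
move=> [X0 XD XZ] cX; rewrite inE.
have [w wE] : exists w : 'rV[o]_n,
    map_mx repr (map_mx (redm v N) z) = z + piI v ^+ N.+1 *: w.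
  have ex i : exists y, repr (redm v N (z 0 i)) = z 0 i + piI v ^+ N.+1 * y.
    by apply/reduce_eq; rewrite redmE /reduce reprK.
  exists (\row_i projT1 (cid (ex i))); apply/rowP => i.
  by rewrite addmxE scalemxE !mxE; case: cid.
have piw : lat c (comb g (piI v ^+ N.+1 *: w)).
  rewrite comb_mval; apply/lat_comb => i; rewrite [mval _ _ _]mxE scalemxE.
  apply: vge_le (_ : vge v N.+1%:Z _); first by rewrite lez_nat ltnW// ltnS.
  by apply/vge_piX; eexists.
have cD (x y : 'rV[o]_n) : comb g (x + y) = comb g x + comb g y.
  by rewrite !comb_mval -combFD; congr combF; apply/matrixP => i j; rewrite !mxE.
have cN' (x : 'rV[o]_n) : comb g (- x) = - comb g x.
  rewrite !comb_mval -[RHS]scaleN1r -combFZ scaleN1r; congr combF.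
  by apply/matrixP => i j; rewrite !mxE rmorphN.
split=> [/asboolP|Xz].
  rewrite wE => h; have -> : z = (z + piI v ^+ N.+1 *: w) - piI v ^+ N.+1 *: w by rewrite addrK.
  rewrite cD cN'; apply: XD => //; rewrite -scaleN1r.
  have -> : (-1 : F) = val (-1 : o) by rewrite rmorphN rmorph1.
  by apply: XZ; apply: cX.
by apply/asboolP; rewrite wE cD; apply: XD => //; apply: cX.
Qed.

(** A vector of Y outside X, multiplied by a suitable power of pi, gives x outside X with pi x in X.
    The translates of X by a x, for a running over representatives of the residues, are disjoint and
    contained in Y. *)
Lemma classes_step (X Y : set V) : submodule v X -> submodule v Y ->
  (lat c `<=` X)%classic -> (X `<` Y)%classic -> (Y `<=` lat (fun=> 0%N))%classic ->
  (residue_card v * #|classes X| <= #|classes Y|)%N.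
Proof.
move=> sX sY cX [XY nYX] Y0; have [X0 XD XZ] := sX; have [_ YD YZ] := sY.
have [x0 [Yx0 nXx0]] : exists x0, Y x0 /\ ~ X x0.
  apply: contrapT => h; apply: nYX => y Yy; apply: contrapT => nX.
  by apply: h; exists y.
pose ok j := `[< X (pF ^+ j *: x0) >].
have okN : exists j, ok j.
  exists N; apply/asboolP/cX => i; rewrite coordFZ mxE exprnP vge_unifM.
  apply: vge_le (Y0 _ Yx0 i); rewrite subr_le0 lez_nat; exact: cN.
have [[|j] /asboolP okj jmin] := ex_minnP okN; first by move: okj; rewrite expr0 scale1r.
set x := pF ^+ j *: x0.
have nXx : ~ X x by move=> h; have /jmin : ok j by [apply/asboolP]; rewrite ltnn.
have Yx : Y x by rewrite /x -val_piI -val_exp; apply: YZ.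
have Xpx : X (pF *: x) by rewrite /x scalerA -exprS.
have [zx zxE] : exists zx : 'rV[o]_n, x = comb g zx.
  have : mint v (coordF g x) by apply/mintP => i k; rewrite ord1; apply: Y0.
  by move=> /mvalP[zx zxE]; exists zx; rewrite comb_mval -zxE coordFK.
have cDZ (s : 'rV[o]_n) (a : o) : comb g (s + a *: zx) = comb g s + val a *: x.
  rewrite zxE !comb_mval -combFZ -combFD; congr combF.
  by apply/rowP => i; rewrite addmxE scalemxE ![mval _ _ _]mxE addmxE scalemxE.
have cB (s t : 'rV[o]_n) : comb g (s - t) = comb g s - comb g t.
  by rewrite !comb_mval -combFB; congr combF; apply/rowP => i; rewrite !mxE rmorphB.
pose lft (s : 'rV[A]_n) : 'rV[o]_n := map_mx repr (s : 'rV[int_mod v N]_n).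
have lftK s : map_mx (redm v N) (lft s) = s.
  by apply/rowP => i; rewrite !mxE redmE /reduce reprK.
pose ra (a : Kap hfin) : o := repr (a : residue_field v).
have raK a : resm v (ra a) = a by rewrite redmE /reduce reprK.
pose h (u : Kap hfin * 'rV[A]_n) : 'rV[A]_n :=
  map_mx (redm v N) (lft u.2 + ra u.1 *: zx).
have memX s : s \in classes X -> X (comb g (lft s)).
  by rewrite -{1}(lftK s) => /(classesP _ sX cX).
have XN y : X y -> X (- y).
  move=> Xy; rewrite -scaleN1r; have -> : (-1 : F) = val (-1 : o) by rewrite rmorphN rmorph1.
  exact: XZ.
rewrite residue_card_Kap -(cardsT (Kap hfin)) -cardsX.
rewrite -(@card_in_imset _ _ h); last first.
  move=> [a s] [a' s']; rewrite !inE /= => sX1 sX2; rewrite /h /= => hh.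
  have aa : a = a'.
    apply/eqP; apply: contraT => naa; exfalso; apply: nXx.
    pose u := ra a - ra a'.
    have uu : u \is a GRing.unit by rewrite -resm_unit rmorphB !raK subr_eq0.
    have Xd : X (comb g (lft s - lft s' + u *: zx)).
      apply/(classesP _ sX cX).
      have -> : lft s - lft s' + u *: zx = (lft s + ra a *: zx) - (lft s' + ra a' *: zx).
        by rewrite /u scalerBl opprD !addrA; congr (_ - _); rewrite -!addrA; congr (_ + _); rewrite addrC.
      rewrite map_mxB hh subrr -(map_mx0 (redm v N)); apply/(classesP _ sX cX).
      rewrite comb_mval; have -> : mval (0 : 'rV[o]_n) = 0 by apply/rowP => i; rewrite !mxE.
      by rewrite combF0.
    have Xu : X (val u *: x).
      have -> : val u *: x = comb g (lft s - lft s' + u *: zx) - (comb g (lft s) - comb g (lft s')).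
        by rewrite cDZ cB addrC addKr.
      by apply: (XD) => //; apply: (XN); apply: (XD) => //; apply: (XN).
    have -> : x = val u^-1 *: (val u *: x).
      by rewrite scalerA -val_mul mulVr// rmorph1 scale1r.
    exact: XZ.
  rewrite -{}aa in hh *; congr (_, _).
  by move: hh; rewrite !map_mxD !lftK => /addIr.
apply/subset_leq_card/fintype.subsetP => y /imsetP[[a s]]; rewrite finset.in_setX /= => /andP[_ sX1] ->.
have cY : (lat c `<=` Y)%classic by move=> z /cX/XY.
rewrite /h /=; apply/(classesP _ sY cY); rewrite cDZ.
by apply: YD; [exact/XY/memX|exact: YZ].
Qed.

(** Multiplication by diag(pi^c_i) has its image among the classes of [lat c] and a kernel of order
    at most f^(sum c). *)
Lemma classes_lat : (#|'rV[A]_n| <= residue_card v ^ (\sum_i c i) * #|classes (lat c)|)%N.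
Proof.
pose D : 'M[A]_n := diag_mx (\row_i redm v N (piI v ^+ c i)).
pose h : {additive 'rV[A]_n -> 'rV[A]_n} := mulmxr D.
have hE y i : h y 0 i = redm v N (piI v ^+ c i) * y 0 i.
  by rewrite /h /= mul_mx_diag [LHS]mxE [(\row__ _) 0 i]mxE mulrC.
have -> : #|'rV[A]_n| = (#|[set u : 'rV[A]_n | h u == 0%R]%SET| * #|h @: predT|)%N.
  rewrite (@card_fiber _ _ h (h @: predT) _ _ 0)//.
  - by move=> y; apply: imset_f.
  - by move=> w /imsetP[y _ ->]; exists y.
  - by apply/imsetP; exists 0; rewrite ?raddf0.
apply: leq_mul.
  rewrite residue_card_Kap.
  have rs : forall N (a : An hfin N), exists x, redA hfin N x = a by move=> M; exact: reduce_surj.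
  have rk : forall N x, redA hfin N x = 0 <-> exists y, x = piI v ^+ N.+1 * y.
    by move=> M; exact: reduce_ker.
  have ks : forall a : Kap hfin, exists x, resK hfin x = a by exact: reduce_surj.
  have kk : forall x, resK hfin x = 0 <-> exists y, x = piI v * y by exact: resm_ker.
  have ann i := @card_ann o (piI v) (Kap hfin) (An hfin) (redA hfin) (resK hfin) rs rk ks kk (@piI_reg F v) N (c i) (cN i).
  apply: (@leq_trans #|[set y : 'rV[A]_n | [forall i, forall j,
     y i j \in [pred z | redA hfin N (piI v ^+ c j) * z == 0]]]|).
    apply: eq_leq; apply: eq_card => y; rewrite !inE; apply/eqP/forallP => [hy i|hy].
      by apply/forallP => j; rewrite ord1 inE -hE hy mxE.
    apply/rowP => j; have /forallP/(_ j) := hy 0; rewrite inE => /eqP hj.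
    by rewrite hE [RHS]mxE; exact: hj.
  rewrite (card_mx_family (fun _ j => [pred z | redA hfin N (piI v ^+ c j) * z == 0])).
  rewrite big_ord1 expn_sum leq_prod// => i _; by rewrite ann.
apply/subset_leq_card/fintype.subsetP => _ /imsetP[y _ ->].
have -> : h y = map_mx (redm v N) (\row_i (piI v ^+ c i * repr ((y : 'rV[int_mod v N]_n) 0 i))).
  by apply/rowP => i; rewrite hE !mxE rmorphM [redm v N (repr _)]redmE /reduce reprK.
apply/(classesP _ (lat_submodule c) (@subset_refl _ _)).
rewrite comb_mval; apply/lat_comb => i; rewrite !mxE; by apply/vge_piX; eexists.
Qed.

(** Every strict step multiplies the number of classes by at least f, and the total growth is at
    most f^(sum c). *)
Lemma lat_chain_bound m : strict_chain v (lat c) (lat (fun=> 0%N)) m -> (m <= \sum_i c i)%N.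
Proof.
move=> [d [d0 dm ds dlt]].
have sub0 j : (j <= m)%N -> (lat c `<=` d j)%classic.
  elim: j => [|j IH] jm; first by rewrite d0.
  by apply: subset_trans (IH (ltnW jm)) _; have [] := dlt j jm.
have subm j : (j <= m)%N -> (d (m - j)%N `<=` lat (fun=> 0%N))%classic.
  elim: j => [|j IH] jm; first by rewrite subn0 dm.
  apply: subset_trans (IH (ltnW jm)); have [] // := dlt (m - j.+1)%N _; last first.
    by rewrite subnSK.
  by rewrite ltn_subrL /= (leq_trans _ jm).
have step j : (j <= m)%N -> (residue_card v ^ j * #|classes (lat c)| <= #|classes (d j)|)%N.
  elim: j => [|j IH] jm; first by rewrite expn0 mul1n d0.
  rewrite expnS -mulnA; apply: (@leq_trans (residue_card v * #|classes (d j)|)).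
    by rewrite leq_mul2l IH ?orbT// ltnW.
  apply: classes_step; [exact: ds (ltnW jm)|exact: ds|exact: sub0 (ltnW jm)|exact: dlt|].
  by rewrite -(subKn jm); apply: subm; rewrite leq_subr.
have pos : (0 < #|classes (lat c)|)%N.
  apply/card_gt0P; exists (map_mx (redm v N) 0).
  apply/(classesP _ (lat_submodule c) (@subset_refl _ _)); rewrite comb_mval.
  by apply/lat_comb => i; rewrite !mxE vge_0.
have : (residue_card v ^ m * #|classes (lat c)| <= residue_card v ^ (\sum_i c i) * #|classes (lat c)|)%N.
  by apply: leq_trans classes_lat; apply: leq_trans (step m (leqnn m)) (max_card _).
by rewrite leq_pmul2r// leq_exp2l// (residue_card_gt1 hfin).
Qed.

End Length.

Section LengthAdapted.
Variables (F : fieldType) (v : discrete_valuation F) (V : vectType F).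
Hypothesis hfin : finite_set [set: residue_field v].
Variables (n : nat) (L M : set V) (e g : n.-tuple V).
Variables (U P : 'M[integers v]_n) (c : 'I_n -> nat).
Hypotheses (he : lattice_basis v e L) (hg : lattice_basis v g M).
Hypotheses (Uu : U \in unitmx) (tP : trans e g (mval P)) (UP : U *m P = dpi (piI v) c).

Lemma lat_big : M = lat v g (fun=> 0%N).
Proof.
apply/seteqP; split=> x; rewrite -[x](coordFK hg.1).
  by move=> /(lattice_basisP hg)/mintP h; apply/lat_comb; [exact: hg.1|].
by move=> /(lat_comb _ hg.1) h; apply/(lattice_basisP hg)/mintP => i j; rewrite ord1.
Qed.

Lemma lat_small : L = lat v g c.
Proof.
have [Umu UmV] := mval_unit Uu.
have key (y : 'rV[F]_n) : L (combF g (y *m mval (dpi (piI v) c))) <-> mint v y.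
  rewrite -UP mvalM mulmxA -tP; split=> [/(lattice_basisP he) h|h].
    by rewrite -[y](mulmxK Umu) UmV; apply: mintM h (mint_mval _).
  by apply/(lattice_basisP he); apply: mintM h (mint_mval _).
have dE (y : 'rV[F]_n) i : (y *m mval (dpi (piI v) c)) 0 i = unif v ^ (c i)%:Z * y 0 i.
  have -> : mval (dpi (piI v) c) = diag_mx (\row_i unif v ^ (c i)%:Z).
    apply/matrixP => a b; rewrite !mxE; case: eqP => _; rewrite ?mulr1n ?mulr0n//.
    by rewrite val_exp val_piI exprnP.
  by rewrite mul_mx_diag !mxE mulrC.
have kz (z : 'rV[F]_n) : L (combF g z) <-> forall i, vge v (c i)%:Z (z 0 i).
  have zE : z = (\row_i (unif v ^ (- (c i)%:Z) * z 0 i)) *m mval (dpi (piI v) c).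
    by apply/rowP => i; rewrite dE mxE mulrA -unifzD subrr expr0z mul1r.
  rewrite [in X in X <-> _]zE key; split=> [/mintP h i|h].
    by have := h 0 i; rewrite mxE vge_unifM opprK add0r.
  by apply/mintP => i j; rewrite mxE vge_unifM opprK add0r.
apply/seteqP; split=> x; rewrite -[x](coordFK hg.1).
  by move=> /kz h; apply/lat_comb => //; exact: hg.1.
by move=> /(lat_comb _ hg.1) /kz.
Qed.

Lemma has_lengthE b : has_length v L M b <-> b = (\sum_i c i)%N.
Proof.
have ch : strict_chain v L M (\sum_i c i) by rewrite lat_big lat_small; apply: lat_chain hg.1 c.
have bd m : strict_chain v L M m -> (m <= \sum_i c i)%N.
  rewrite lat_big lat_small; apply: (lat_chain_bound hg.1 hfin (N := \sum_i c i)) => i.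
  by rewrite (bigD1 i)//= leq_addr.
split=> [[h1 h2]|->]; last by split.
by apply/eqP; rewrite eqn_leq bd// h2.
Qed.

End LengthAdapted.

(** * Radical and nonsingular part of a form over a finite field *)

Section RadicalDecomposition.
Variables (K : finFieldType) (n : nat) (Q : 'rV[K]_n -> K).
Hypothesis Qq : quadratic_form Q.

Lemma in_radicalD c x y : in_radical Q setT x -> in_radical Q setT y ->
  in_radical Q setT (c *: x + y).
Proof.
move=> [_ x0 xp] [_ y0 yp]; split=> // [|z _].
  by rewrite qformD Qq.1 x0 mulr0 y0 !add0r polarZl// xp// mulr0.
by rewrite polarDl// polarZl// xp// yp// mulr0 addr0.
Qed.

(** The radical is a subspace, and any linear complement of it is orthogonal to it and
    nonsingular. *)
Lemma radical_decomposition_exists : exists W0 W1, radical_decomposition Q W0 W1.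
Proof.
pose S := enum [set x : 'rV[K]_n | `[< in_radical Q setT x >]].
have SP x : x \in S <-> in_radical Q setT x by rewrite mem_enum inE; split => /asboolP.
have W1P x : x \in <<S>>%VS <-> in_radical Q setT x.
  split=> [|/SP/memv_span//].
  move=> /(coord_span (X := in_tuple S)) ->; elim/big_ind: _ => [|y z hy hz|i _].
  - split=> // [|y _]; first exact: qform0.
    by have := polarZl Qq 0 0 y; rewrite scale0r mul0r.
  - by have := in_radicalD 1 hy hz; rewrite scale1r.
  - have r0 : in_radical Q setT 0.
      split=> // [|y _]; first exact: qform0.
      by have := polarZl Qq 0 0 y; rewrite scale0r mul0r.
    have := @in_radicalD (coord (in_tuple S) i x) S`_i 0; rewrite addr0; apply => //.
    by apply/SP/mem_nth; rewrite ltn_ord.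
exists (<<S>>^C)%VS, <<S>>%VS; split=> //.
- by rewrite addvC addv_complf.
- by rewrite capvC capv_compl.
- by move=> x y _ /W1P[_ _ yp]; rewrite polarC yp.
move=> x [/= xC x0 xp]; apply/eqP; rewrite -memv0 -(capv_compl <<S>>%VS) memv_cap xC andbT.
apply/W1P; split=> // y _; have := memvf y; rewrite -(addv_complf <<S>>%VS).
move=> /memv_addP[y1 /W1P[_ _ y1p] [y2 y2C ->]].
by rewrite polarDr// polarC y1p// xp// addr0.
Qed.

Lemma radical_decomposition_dim W0 W1 : radical_decomposition Q W0 W1 ->
  (\dim W0 + \dim W1 = n)%N.
Proof. by move=> [h1 h2 _ _ _]; rewrite -dimv_disjoint_sum// h1 dimvf /dim /= mul1n. Qed.

(** The image of B meets the radical only in 0, so its dimension is at most the codimension of the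
    radical. This yields n_0 <= a. *)
Lemma radical_free_dim m (B : 'M[K]_(m, n)) W0 W1 : radical_decomposition Q W0 W1 ->
  (forall x : 'rV_m, in_radical Q setT (x *m B) -> x = 0) -> (m <= \dim W0)%N.
Proof.
move=> hW hB; have dW := radical_decomposition_dim hW.
have [_ _ _ W1P _] := hW.
pose g : 'Hom('rV[K]_m, 'rV[K]_n) := linfun (mulmxr B).
have gE x : g x = x *m B by rewrite lfunE.
have rad0 : in_radical Q setT 0.
  split=> // [|y _]; first exact: qform0.
  by have := polarZl Qq 0 0 y; rewrite scale0r mul0r.
have kg : lker g = 0%VS.
  apply/eqP; rewrite -subv0; apply/subvP => x; rewrite memv_ker gE => /eqP xB.
  by rewrite (hB x) ?mem0v// xB.
have dg : \dim (limg g) = m.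
  have := limg_ker_dim g fullv; rewrite kg capv0 dimv0 add0n => ->.
  by rewrite dimvf /dim /= mul1n.
have cap : (limg g :&: W1)%VS = 0%VS.
  apply/eqP; rewrite -subv0; apply/subvP => x; rewrite memv_cap => /andP[/memv_imgP[y _ ->]].
  by rewrite gE => /W1P/hB ->; rewrite mul0mx mem0v.
have := dimvS (subvf (limg g + W1)); rewrite dimv_disjoint_sum// dg dimvf /dim /= mul1n.
by rewrite -{2}dW leq_add2r.
Qed.

Lemma radical_basis (B : 'M[K]_n) W0 W1 W0' W1' : B \in unitmx ->
  radical_decomposition Q W0 W1 ->
  radical_decomposition (fun x => Q (x *m B)) W0' W1' -> \dim W0 = \dim W0'.
Proof.
move=> Bu hW hW'; have [_ _ _ W1P _] := hW; have [_ _ _ W1P' _] := hW'.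
have dW := radical_decomposition_dim hW.
have dW' : (\dim W0' + \dim W1' = n)%N.
  by have [h1 h2 _ _ _] := hW'; rewrite -dimv_disjoint_sum// h1 dimvf /dim /= mul1n.
pose g : 'Hom('rV[K]_n, 'rV[K]_n) := linfun (mulmxr B).
have gE x : g x = x *m B by rewrite lfunE.
have kg : lker g = 0%VS.
  apply/eqP; rewrite -subv0; apply/subvP => x; rewrite memv_ker gE => /eqP xB.
  by rewrite -[x](mulmxK Bu) xB mul0mx mem0v.
have PB x y : polar (fun x => Q (x *m B)) x y = polar Q (x *m B) (y *m B).
  by rewrite /polar mulmxDl.
have gW : (g @: W1')%VS = W1.
  apply/vspaceP => x; apply/memv_imgP/idP => [[y /W1P'[_ y0 yp] ->]|/W1P[_ x0 xp]].
    rewrite gE; apply/W1P; split=> // z _.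
    by rewrite -[z](mulmxKV Bu) -PB yp.
  exists (x *m invmx B); last by rewrite gE mulmxKV.
  by apply/W1P'; split=> // [|z _]; rewrite ?PB mulmxKV// xp.
have : \dim W1 = \dim W1'.
  rewrite -gW; have := limg_ker_dim g W1'; by rewrite kg capv0 dimv0 add0n.
by move=> e; apply/eqP; rewrite -(eqn_add2r (\dim W1)) dW {1}e dW'.
Qed.

End RadicalDecomposition.

(** * Existence and uniqueness of the symbol of a lattice *)

Section Symbols.
Variables (R : realType) (F : fieldType) (v : discrete_valuation F) (V : vectType F).
Variables (q : V -> F) (hq : quadratic_form q).
Hypothesis hfin : finite_set [set: residue_field v].
Variables (n : nat) (n_gt0 : (0 < n)%N).
Local Notation o := (integers v).
Local Notation rform := (@reduced_form F v V q n).
Local Notation f := ((residue_card v)%:R : R).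

Definition symbol_val k a s : R :=
  (1 + chi R a s * f `^ (n%:R - a%:R / 2 - k%:R))
    * \prod_(1 <= i < n | i%:R < n%:R - a%:R / 2 :> R) (1 - f ^ (2 * i%:Z - 2 * k%:Z)).

Lemma reduced_form_quadratic M (e : n.-tuple V) : lattice_basis v e M ->
  integral_on v q M -> quadratic_form (rform e).
Proof.
move=> he qM; have -> : rform e = tform (map_mx (resm v) (qint v q e)).
  exact/funext/(reduced_formE hq (integral_qgram he qM)).
exact: tform_quadratic.
Qed.

Lemma reduced_form_basis M (e g : n.-tuple V) : lattice_basis v e M -> lattice_basis v g M ->
  integral_on v q M -> exists2 B : 'M[residue_field v]_n, B \in unitmx &
    rform e = fun x => rform g (x *m B).
Proof.
move=> he hg qM; have [Y Yu tY] := basis_change he hg.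
have Te := integral_qgram he qM; have Tg := integral_qgram hg qM.
exists (map_mx (resm v) Y); first by rewrite -unit_resm.
apply/funext => x; rewrite (reduced_formE hq Te) (reduced_formE hq Tg).
have [y ->] : exists y : 'rV[o]_n, x = map_mx (resm v) y.
  exists (map_mx repr x); apply/matrixP => i j; by rewrite !mxE redmE /reduce reprK.
rewrite -map_mxM -!map_tform; congr (resm v _); apply: val_inj.
by rewrite !val_tform !mval_qint// -!q_combF// mvalM tY.
Qed.

Lemma has_symbol_exists M (e : n.-tuple V) : lattice_basis v e M -> integral_on v q M ->
  exists a s, [/\ (a <= n)%N, s \in signs a & has_symbol v q n M a s].
Proof.
move=> he qM.
have [W0 [W1 hW]] := @radical_decomposition_exists (Kap hfin) n _ (reduced_form_quadratic he qM).
exists (\dim W0), (if odd (\dim W0) || (\dim W0 == 0)%N then None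
            else Some `[< split_form (rform e) (W0 : {vspace 'rV[residue_field v]_n}) >]).
split.
- apply: (leq_trans (leq_addr (\dim W1) _)).
  by rewrite (@radical_decomposition_dim (Kap hfin) n _ _ _ hW).
- by rewrite /signs; case: ifP => _; rewrite ?inE//; case: asboolP.
- by exists e; split=> //; exists W0, W1.
Qed.

Lemma has_symbol_nbk M a s (g : n.-tuple V) k : (n <= k)%N -> lattice_basis v g M ->
  integral_on v q M -> has_symbol v q n M a s ->
  (nbk hfin k (tform (map_mx (resm v) (qint v q g))))%:R =
    f ^ ((2 * k * n)%N%:Z - (n * n.+1)./2%:Z) * ((1 - f ^ (- k%:Z)) * symbol_val k a s).
Proof.
move=> nk hg qM [e [he [W0 [W1 [hW dW sW]]]]].
have Qq := reduced_form_quadratic he qM.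
subst a s; apply: etrans (@nbk_symbol F v hfin R n k _ W0 W1 n_gt0 nk Qq hW).
clear hW W0 W1.
have [B Bu eB] := reduced_form_basis he hg qM.
have E : nbk hfin k (rform e) = nbk hfin k (rform g) by rewrite eB; exact: (nbk_basis hfin k (rform g) Bu).
have E' : nbk hfin k (rform g) = nbk hfin k (tform (map_mx (resm v) (qint v q g))).
  exact: (eq_nbk hfin k (reduced_formE hq (integral_qgram hg qM))).
by rewrite -E' -E.
Qed.

(** The dimension is that of a complement of the radical. The sign is recovered from the isometry
    number at k = n, the same in all bases: its other factors are nonzero, so the values of chi
    agree. *)
Lemma has_symbol_unique M a s a' s' : integral_on v q M ->
  has_symbol v q n M a s -> has_symbol v q n M a' s' -> a = a' /\ s = s'.
Proof.
move=> qM h h'; have [e [he [W0 [W1 [hW dW sW]]]]] := h.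
have [e' [he' [W0' [W1' [hW' dW' sW']]]]] := h'.
have [B Bu eB] := reduced_form_basis he' he qM; rewrite eB in hW'.
have aa : a = a'.
  rewrite -dW -dW'.
  exact (@radical_basis (Kap hfin) n (rform e) B W0 W1 W0' W1' Bu hW hW').
split=> //; rewrite -{}aa in h' sW' dW' *.
have := has_symbol_nbk (leqnn n) he qM h'; rewrite (has_symbol_nbk (leqnn n) he qM h).
have f1 : 1 < f by rewrite ltr1n (residue_card_gt1 hfin).
have f0 : f != 0 by rewrite gt_eqF// (lt_trans ltr01).
have fz (z : int) : z < 0 -> 1 - f ^ z != 0.
  move=> z0; rewrite subr_eq0 eq_sym lt_eqF//.
  case: z z0 => // m _; rewrite NegzE -exprnN invf_lt1 ?exprn_gt0 ?(lt_trans ltr01)//.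
  by rewrite exprn_egt1.
move=> /(mulfI (expfz_neq0 _ f0))/(mulfI (fz _ _)) => /(_ _).
rewrite /symbol_val => hh.
have : 1 + chi R a s * f `^ (n%:R - a%:R / 2 - n%:R) = 1 + chi R a s' * f `^ (n%:R - a%:R / 2 - n%:R).
  apply: (mulIf _ (hh _)); last by rewrite oppr_lt0 ltz_nat.
  rewrite prodf_seq_neq0; apply/allP => i; rewrite mem_index_iota => /andP[_ iN].
  by apply/implyP => _; apply: fz; lia.
move=> /addrI/mulIf; rewrite gt_eqF ?powR_gt0 ?(lt_trans ltr01)// => /(_ isT).
have m11 : (1 : R) != -1 by rewrite -addr_eq0 -(natrD _ 1 1) pnatr_eq0.
rewrite sW sW'; case: ifP => //= _.
case: asboolP; case: asboolP => //= _ _ /eqP; first by rewrite (negPf m11).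
by rewrite eq_sym (negPf m11).
Qed.

End Symbols.

Section WeightedDeterminant.
Variables (F : fieldType) (v : discrete_valuation F).

Lemma vge2_prod (I : finType) (m : I -> int) (x : I -> F) :
  (forall i, vge2 v (m i) (x i)) -> vge2 v (\sum_i m i) (\prod_i x i).
Proof.
move=> h; elim/big_rec2: _ => [|i y z _ hy]; last exact: vge2M.
by rewrite vge2E ?oner_neq0// ordz1.
Qed.

(** Each Leibniz term uses every row and every column once. *)
Lemma vge2_det n (A : 'M[F]_n) (r s : 'I_n -> int) :
  (forall i j, vge2 v (r i + s j) (A i j)) -> vge2 v (\sum_i r i + \sum_i s i) (\det A).
Proof.
move=> h; apply: vge2_sum => sg _; rewrite mulr_sign.
suff hsg : vge2 v (\sum_i r i + \sum_i s i) (\prod_i A i (sg i)).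
  by case: ifP; rewrite ?vge2N.
rewrite (reindex_inj (@perm_inj _ sg) (F := s)) /= -big_split /=.
exact: vge2_prod.
Qed.

End WeightedDeterminant.

Lemma mulmx_entry (R : pzRingType) m n p (A : 'M[R]_(m, n)) (B : 'M[R]_(n, p)) i j :
  (A *m B) i j = (row i A *m col j B) 0 0.
Proof. by rewrite [LHS]mxE [RHS]mxE; apply: eq_bigr => l _; rewrite !mxE. Qed.

(** * The Gross-Keating invariant and the exchange of a basis vector *)

Section GrossKeatingInvariant.
Variables (F : fieldType) (v : discrete_valuation F) (V : vectType F).
Variables (q : V -> F) (hq : quadratic_form q) (qn : nondegenerate_form q).
Hypothesis two_neq0 : (2 : F) != 0.
Variables (n : nat) (L : set V) (e : n.-tuple V).
Hypotheses (he : lattice_basis v e L) (qL : integral_on v q L).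
Local Notation o := (integers v).
Local Notation pF := (unif v).

(** Membership in S(B) in terms of a basis of L: 2 b_ij is a polar value, so no halves remain. *)
Definition GKcond (f : n.-tuple V) (a : n.-tuple nat) : Prop :=
  [/\ lattice_basis v f L, sorted leq a,
      forall i, vge v (tnth a i)%:Z (q (tnth f i))
    & forall i j, vge2 v (tnth a i + tnth a j)%N%:Z (polar q (tnth f i) (tnth f j))].

Lemma lattice_mxbasis (f : n.-tuple V) M (Y : 'M[o]_n) : lattice_basis v f M ->
  Y \in unitmx -> lattice_basis v (mxbasis f (mval Y)) M.
Proof.
move=> hf Yu; have [Ym YV] := mval_unit Yu.
apply: lattice_basis_of => [|x]; first exact: mxbasis_basis hf.1 Ym.
rewrite mxbasis_trans; split=> [/(lattice_basisP hf) h|h].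
  by rewrite -[x](mulmxK Ym) YV; apply: mintM h (mint_mval _).
by apply/(lattice_basisP hf); apply: mintM h (mint_mval _).
Qed.

Lemma polar_mxE (f : n.-tuple V) i j : polar_mx q f i j = polar q (tnth f i) (tnth f j).
Proof.
by rewrite -!combF_delta polar_combF// trmx_delta -rowE -colE !mxE.
Qed.

Lemma gram_polar (f : n.-tuple V) : gram q f = 2^-1 *: polar_mx q f.
Proof.
apply/matrixP => i j; rewrite [LHS]mxE scalemxE polar_mxE; case: eqP => [->|//].
by rewrite polar_self// mulKf.
Qed.

Lemma gram_mxbasis (Y : 'M[F]_n) : Y *m gram q e *m Y^T = gram q (mxbasis e Y).
Proof.
apply/matrixP => i j; rewrite !gram_polar -scalemxAr -scalemxAl !scalemxE; congr (_ * _).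
rewrite polar_mxE !tnth_mktuple polar_combF//.
by rewrite mulmx_entry row_mul tr_row.
Qed.

Lemma GK_S_cond (f : n.-tuple V) (a : n.-tuple nat) : lattice_basis v f L ->
  GK_S v (gram q f) a <-> GKcond f a.
Proof.
move=> hf; have g2 i j : 2 * gram q f i j = polar q (tnth f i) (tnth f j).
  by rewrite gram_polar scalemxE mulVKf// polar_mxE.
have gii i : gram q f i i = q (tnth f i) by rewrite mxE eqxx.
split=> [[h1 h2 h3]|[_ h1 h2 h3]].
  split=> // [i|i j]; first by rewrite -gii; exact: h2.
  by rewrite /vge2 /vge expr2 ord_mul -g2; exact: h3.
split=> // [i|i j]; first by rewrite gii; exact: h2.
by have := h3 i j; rewrite /vge2 /vge expr2 ord_mul -g2.
Qed.

Lemma GK_unionP (a : n.-tuple nat) : GK_union v (gram q e) a <-> exists f, GKcond f a.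
Proof.
split=> [[U /= Uu]|[f hf]].
  have UT : map_mx val U = (mval U^T)^T by apply/matrixP => i j; rewrite !mxE.
  rewrite UT trmxK gram_mxbasis => h; exists (mxbasis e (mval U^T)).
  by apply/GK_S_cond => //; apply: lattice_mxbasis he _; rewrite unitmx_tr.
have [hf1 _ _ _] := hf; have [Y Yu tY] := basis_change hf1 he.
have fE : f = mxbasis e (mval Y).
  by apply: eq_from_tnth => i; rewrite tnth_mktuple -combF_delta tY -rowE.
exists Y^T; first by rewrite /= unitmx_tr.
have -> : map_mx val Y^T = (mval Y)^T by apply/matrixP => i j; rewrite !mxE.
by rewrite trmxK gram_mxbasis -fE; apply/GK_S_cond.
Qed.

(** The sum of the weights is at most the valuation of the determinant of the polar form, which is
    the same for all bases of L. *)
Lemma GKcond_bound : exists D : nat, forall f a, GKcond f a -> forall i, (tnth a i <= D)%N.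
Proof.
have Pu := polar_mx_unit hq he.1 qn.
exists `|ordz v (\det (polar_mx q e))|%N => f a [hf _ _ h] i.
have [Y Yu tY] := basis_change hf he; have [Ym _] := mval_unit Yu.
have PE : polar_mx q f = mval Y *m polar_mx q e *m (mval Y)^T.
  apply/matrixP => r s; rewrite polar_mxE -!combF_delta !tY -!rowE polar_combF//.
  by rewrite [RHS]mulmx_entry row_mul tr_row.
have d0 : \det (polar_mx q e) != 0 by move: Pu; rewrite unitmxE unitfE.
have dY : ordz v (\det (mval Y)) = 0.
  by move: Yu; rewrite unitmxE unit_ordz det_mval => /andP[_ /eqP].
have dY0 : \det (mval Y) != 0 by move: Ym; rewrite unitmxE unitfE.
have : vge2 v (\sum_i (tnth a i)%:Z + \sum_i (tnth a i)%:Z) (\det (polar_mx q f)).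
  by apply: vge2_det => r s; rewrite polar_mxE -PoszD.
rewrite PE !det_mulmx det_tr vge2E ?mulf_neq0// !ordzM ?mulf_neq0// dY add0r addr0.
have : (tnth a i)%:Z <= \sum_i (tnth a i)%:Z.
  by rewrite (bigD1 i)//= lerDl sumr_ge0.
move: (\sum_i _) (ordz v _) (tnth a i) => x y z; lia.
Qed.

Lemma sorted_tnth (a : n.-tuple nat) : sorted leq a <->
  (forall i j : 'I_n, (i <= j)%N -> (tnth a i <= tnth a j)%N).
Proof.
split=> [sa i j ij|h].
  rewrite !(tnth_nth 0%N); apply: (sorted_leq_nth leq_trans leqnn 0%N sa) => //.
    by rewrite inE size_tuple.
  by rewrite inE size_tuple.
apply/(sortedP 0%N) => i; rewrite size_tuple => i1.
have := h (Ordinal (ltnW i1)) (Ordinal i1) (leqnSn i).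
by rewrite !(tnth_nth 0%N).
Qed.

Definition GKmax f a := GKcond f a /\ forall f' a', GKcond f' a' -> lex_le a' a.

(** Bounded weights leave finitely many candidates, so the lexicographic maximum is attained and
    [GK] is not the default value of [xget]. *)
Lemma GK_max : exists f, GKmax f (GK v (gram q e)).
Proof.
have [D hD] := GKcond_bound.
pose T := n.-tuple 'I_D.+1; pose up (t : T) : n.-tuple nat := [tuple of map val t].
have upP f a : GKcond f a -> exists t, a = up t.
  move=> /hD ha; exists [tuple inord (tnth a i) | i < n]; apply: eq_from_tnth => i.
  by rewrite tnth_map tnth_mktuple /= inordK// ltnS.
pose P (t : T) := `[< exists f, GKcond f (up t) >].
have [t0 Pt0] : exists t, P t.
  exists [tuple ord0 | _ < n].
  have up0 i : tnth (up [tuple ord0 | _ < n]) i = 0%N.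
    have upE t : tnth (up t) i = val (tnth t i) by rewrite tnth_map.
    by rewrite upE tnth_mktuple.
  apply/asboolP; exists e; split=> [//||i|i j].
  - by apply/sorted_tnth => i j _; rewrite !up0.
  - by rewrite up0; apply: qL; exact: tnth_lattice he.
  - rewrite !up0 (_ : (0 + 0)%N%:Z = 2 * 0 :> int)// vge2_double.
    by apply: (integral_polar he qL); exact: tnth_lattice he.
have [t /asboolP[f hf] tmax] := @Order.TotalTheory.arg_maxP _ _ T t0 P (fun t => up t : n.-tuplelexi nat) Pt0.
have ex : exists a, GK_union v (gram q e) a /\ forall a', GK_union v (gram q e) a' -> lex_le a' a.
  exists (up t); split; first by apply/GK_unionP; exists f.
  move=> a' /GK_unionP[f' hf']; have [t' t'E] := upP _ _ hf'; rewrite t'E.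
  by apply: tmax; apply/asboolP; exists f'; rewrite -t'E.
have [/GK_unionP[g hg] gmax] := xgetPex [tuple of nseq n 0%N] ex.
exists g; split=> // f' a' hf'; apply: gmax; apply/GK_unionP; by exists f'.
Qed.

Variables (f : n.-tuple V) (a : n.-tuple nat).
Hypothesis fa : GKmax f a.
Let hf : lattice_basis v f L. Proof. by case: fa => -[]. Qed.

(* f_t is replaced by the vector y and moved to the last position s of its block *)
Lemma GK_exchange (y : 'rV[o]_n) (t s : 'I_n) (a' : 'I_n -> nat) :
  y 0 t \is a GRing.unit -> tnth a s = tnth a t ->
  (forall i j : 'I_n, (i <= j)%N -> (a' i <= a' j)%N) ->
  (forall i, i != s -> (a' i <= tnth a i)%N) ->
  vge v (a' s)%:Z (q (combF f (mval y))) ->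
  (forall i j, i != s -> tnth a j = tnth a i ->
     vge2 v (a' s + a' i)%N%:Z (polar q (combF f (mval y)) (tnth f j))) ->
  (forall i : 'I_n, (i < s)%N -> a' i = tnth a i) -> ~ (tnth a s < a' s)%N.
Proof.
move=> yt ast srt le_a' hqs hp eqs lts.
pose E : 'M[o]_n := \matrix_i (if i == t then y else delta_mx 0 i).
pose H := row_perm (tperm t s) E.
have Eu : E \in unitmx.
  rewrite unit_resm -row_free_unit; apply: inj_row_free => x xE.
  have rE j : (x *m map_mx (resm v) E) 0 j = x 0 t * resm v (y 0 j) + (if j == t then 0 else x 0 j).
    rewrite mxE (bigD1 t)//= 2!mxE eqxx; congr (_ + _).
    case: eqP => [->|/eqP jt].
      rewrite big1// => i /negPf it; rewrite 2!mxE it mxE eqxx /= eq_sym it.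
      by rewrite rmorph0 mulr0.
    rewrite (bigD1 j)//= big1 => [|i /andP[/negPf it /negPf ij]].
      by rewrite 2!mxE (negPf jt) mxE !eqxx rmorph1 mulr1 addr0.
    by rewrite 2!mxE it mxE eqxx /= eq_sym ij rmorph0 mulr0.
  have xt : x 0 t = 0.
    move: (rE t); rewrite xE mxE eqxx addr0 => /esym/eqP; rewrite mulf_eq0 => /orP[/eqP//|].
    by rewrite -[_ == 0]negbK resm_unit yt.
  apply/rowP => j; rewrite mxE; have := rE j; rewrite xE mxE xt mul0r add0r.
  by case: eqP => [->|_] //.
have Hu : H \in unitmx by rewrite /H row_permE unitmx_mul unitmx_perm.
pose h := mxbasis f (mval H); have hh : lattice_basis v h L by apply: lattice_mxbasis.
have hE i : tnth h i = if tperm t s i == t then combF f (mval y) else tnth f (tperm t s i).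
  rewrite tnth_mktuple; case: ifP => it.
    by congr combF; apply/rowP => j; rewrite !mxE it.
  by rewrite -combF_delta; congr combF; apply/rowP => j; rewrite !mxE it !mxE eqxx /=; case: eqP => _; rewrite ?rmorph1 ?rmorph0.
have ts i : (tperm t s i == t) = (i == s).
  by rewrite (can2_eq (tpermK t s) (tpermK t s)) tpermL.
have hs : tnth h s = combF f (mval y) by rewrite hE ts eqxx.
have hi i : i != s -> tnth h i = tnth f (tperm t s i) by move=> /negPf is_; rewrite hE ts is_.
have aperm i : tnth a (tperm t s i) = tnth a i.
  by case: tpermP => [->|->|//].
have [[_ _ fq fp] amax] := fa.
have a'E i : tnth [tuple a' i | i < n] i = a' i by rewrite tnth_mktuple.
have cond : GKcond h [tuple a' i | i < n].
  split=> // [|i|i j].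
  - by apply/sorted_tnth => i j ij; rewrite !a'E srt.
  - rewrite a'E; have [->|is_] := eqVneq i s; first by rewrite hs.
    by rewrite hi//; apply: vge_le (fq _); rewrite aperm lez_nat le_a'.
  - rewrite !a'E; have [->|is_] := eqVneq i s; have [->|js] := eqVneq j s.
    + rewrite hs polar_self// (_ : (a' s + a' s)%N%:Z = 2 * (a' s)%:Z); last by lia.
      rewrite vge2_double mulr_natl mulr2n vgeD//.
    + by rewrite hs (hi j)//; apply: hp; rewrite ?aperm.
    + by rewrite hs (hi i)// polarC addnC; apply: hp; rewrite ?aperm.
    + rewrite !hi//; apply: vge2_le (fp _ _).
      by rewrite !aperm lez_nat leq_add// le_a'.
(* a' agrees with a before s and exceeds it at s; later entries do not matter for the lexicographic
   order. *)
have /amax := cond; rewrite /lex_le; apply/negP; rewrite -Order.TotalTheory.ltNge.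
apply/Order.TupleLexiOrder.ltxi_tuplePlt.
exists s => [i is_|]; first by rewrite tnth_mktuple eqs.
by rewrite tnth_mktuple ltEnat.
Qed.

End GrossKeatingInvariant.

Section VgeParity.
Variables (F : fieldType) (v : discrete_valuation F).

Lemma vge2_odd m (x : F) : vge2 v (2 * m + 1) x = vge v (m + 1) x.
Proof. by rewrite vge2_vge; congr vge; lia. Qed.

(** 2 v(x) is even, so a bound by an odd number improves by 1. *)
Lemma vge2_oddS m (x : F) : ~~ (2 %| m)%Z -> vge2 v m x -> vge2 v (m + 1) x.
Proof.
move=> m2; rewrite !vge2_vge; apply: vge_le; lia.
Qed.

Lemma vge2_unifM m k (x : F) : vge2 v m (unif v ^ k * x) = vge2 v (m - 2 * k) x.
Proof. by rewrite /vge2 exprMn [_ ^+ 2]exprnP exprz_exp vge_unifM; congr vge; lia. Qed.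

Lemma wge_delta n (al : 'I_n -> int) i : wge v al (al i) (delta_mx 0 i).
Proof.
apply/wgeP => j; rewrite mxE eqxx /=; case: eqP => [->|_]; last exact: vge2_0.
by rewrite subrr vge2E ?oner_neq0// ordz1.
Qed.

Lemma resm_to_int (x : F) : vge v 0 x -> (resm v (to_int v x) == 0) = vge v 1 x.
Proof. by move=> x0; rewrite redmE reduce_ker0 vge_to_int. Qed.

Lemma ordz_prod_unif n (c : 'I_n -> int) : \prod_i unif v ^ c i = unif v ^ (\sum_i c i).
Proof. by rewrite (big_morph _ (unifzD v) (expr0z _)). Qed.

End VgeParity.

(** * Forms bounded by a weighted norm *)

Section WeightedForms.
Variables (F : fieldType) (v : discrete_valuation F) (V : vectType F).
Variables (q : V -> F) (hq : quadratic_form q).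
Variables (n : nat) (f : n.-tuple V) (al : 'I_n -> int).

Lemma polar_combFl (x : 'rV[F]_n) y : polar q (combF f x) y = \sum_i x 0 i * polar q (tnth f i) y.
Proof.
rewrite polarC// /combF polar_sumr//; apply: eq_bigr => i _.
by rewrite polarZr// polarC.
Qed.

Lemma polar_combFr (x : 'rV[F]_n) y : polar q y (combF f x) = \sum_i x 0 i * polar q y (tnth f i).
Proof. by rewrite polarC// polar_combFl; apply: eq_bigr => i _; rewrite polarC. Qed.

Lemma vge_q_sum m (x : 'rV[F]_n) :
  (forall i, vge v m (x 0 i ^+ 2 * q (tnth f i))) ->
  (forall i j, i != j -> vge v m (x 0 i * x 0 j * polar q (tnth f i) (tnth f j))) ->
  vge v m (q (combF f x)).
Proof.
move=> h1 h2; rewrite q_combF// tformE; apply: vge_sum => i _; apply: vge_sum => j _.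
rewrite mxE; case: eqP => [<-|/eqP ij]; first by rewrite -expr2.
by case: ifP => _; [exact: h2|rewrite mulr0 vge_0].
Qed.

Hypothesis fq : forall i, vge v (al i) (q (tnth f i)).
Hypothesis fp : forall i j, vge2 v (al i + al j) (polar q (tnth f i) (tnth f j)).

Lemma wge_polar m m' (x y : 'rV[F]_n) : wge v al m x -> wge v al m' y ->
  vge2 v (m + m') (polar q (combF f x) (combF f y)).
Proof.
move=> /wgeP hx /wgeP hy; rewrite polar_combFl; apply: vge2_sum => i _.
rewrite polar_combFr mulr_sumr; apply: vge2_sum => j _.
have := vge2M (hx i) (vge2M (hy j) (fp i j)); apply: vge2_le.
by move: (al i) (al j) => *; lia.
Qed.

Lemma wge_q m (x : 'rV[F]_n) : wge v al m x -> vge v m (q (combF f x)).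
Proof.
move=> /wgeP hx; apply: vge_q_sum => [i|i j _].
  by have := vgeM (hx i) (fq i); rewrite subrK.
rewrite -vge2_double; have := vge2M (vge2M (hx i) (hx j)) (fp i j); apply: vge2_le.
by move: (al i) (al j) => *; lia.
Qed.

End WeightedForms.

(** * Tightness of the Gross-Keating norm *)

Section Tightness.
Variables (F : fieldType) (v : discrete_valuation F) (V : vectType F).
Variables (q : V -> F) (hq : quadratic_form q) (two_neq0 : (2 : F) != 0).
Variables (n : nat) (L : set V) (f : n.-tuple V) (a : n.-tuple nat).
Hypothesis fa : GKmax v q L f a.
Local Notation o := (integers v).
Local Notation pF := (unif v).

Definition gk_weight (i : 'I_n) : int := (tnth a i)%:Z.
Local Notation al := gk_weight.

Lemma gk_weight_q i : vge v (al i) (q (tnth f i)).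
Proof. by have [[_ _ h _] _] := fa; exact: h. Qed.

Lemma gk_weight_polar i j : vge2 v (al i + al j) (polar q (tnth f i) (tnth f j)).
Proof. by have [[_ _ _ h] _] := fa; exact: h. Qed.

(** Raising the weight by 1 at the last place of a block keeps the sequence sorted. *)
Lemma last_in_block (t : 'I_n) : exists s : 'I_n, tnth a s = tnth a t /\
  forall j : 'I_n, (s < j)%N -> (tnth a s < tnth a j)%N.
Proof.
have [[_ /sorted_tnth sa _ _] _] := fa.
case: (@arg_maxnP _ t (fun i => tnth a i == tnth a t) (fun i => val i) (eqxx _)) => s /eqP ast smax.
exists s; split=> // j sj; rewrite ltn_neqAle sa ?andbT 1?ltnW//.
by apply/eqP => e; have := smax j; rewrite -e ast eqxx => /(_ isT) /=; rewrite leqNgt sj.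
Qed.

(* Every x <> 0 has v(q x) = w(x) or 2 v(B(x, y)) = w(x) + w(y) for some y, w being the
   norm of weights a: otherwise the part of x with 2 v(x_i) + a_i = w(x) could replace
   the basis vector of largest weight in its support, raising the last weight equal
   to it by 1. Stated contrapositively, for a lower bound W of w(x). *)
Lemma GK_tight (x : 'rV[F]_n) W : wge v al W x -> vge v (W + 1) (q (combF f x)) ->
  (forall j, vge2 v (W + al j + 1) (polar q (combF f x) (tnth f j))) -> wge v al (W + 1) x.
Proof.
have aux1 (w b : int) : w + 1 + b = w + b + 1 by lia.
have aux2 (w : int) : w + (w + 1) = 2 * w + 1 by lia.
have aux3 (w m : int) (b : nat) : 2 * m = w - b%:Z -> (b + true)%N%:Z - - m * 2%N%:Z <= w + 1 by lia.
have aux4 (w m : int) (b c : nat) : 2 * m = w - b%:Z ->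
  (b + true + (c + false))%N%:Z - 2 * - m <= w + c%:Z + 1 by lia.
move=> /[dup] xW /wgeP xWi hqx hpx; apply/wgeP => i0; apply/negPn/negP => ti0.
have [[_ /sorted_tnth sa _ _] _] := fa.
(* The coordinates where 2 v(x_i) + a_i is exactly W. *)
pose tight i := ~~ vge2 v (W + 1 - al i) (x 0 i).
have tightE i : tight i -> x 0 i != 0 /\ 2 * ordz v (x 0 i) = W - al i.
  rewrite /tight => ti; have x0 : x 0 i != 0 by apply: contraNneq ti => ->; exact: vge2_0.
  split=> //; move: ti (xWi i); rewrite !vge2E//.
  by move: (ordz v _) (al i) => *; lia.
(* Among tight coordinates the largest weight has the least valuation m, so pi^-m makes the tight
   part of x integral with a unit at t. *)
case: (@arg_maxnP _ i0 tight (fun i => tnth a i) ti0) => t tt tmax.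
have [s [ast slast]] := last_in_block t.
have [xt0 ot] := tightE t tt; set m := ordz v (x 0 t) in ot.
pose xh : 'rV[F]_n := \row_i (if tight i then x 0 i else 0).
have xhi : mint v (pF ^ (- m) *: xh).
  apply/mintP => i j; rewrite ord1 scalemxE mxE vge_unifM add0r opprK.
  case: ifP => [tj|_]; last exact: vge_0.
  have [xj0 oj] := tightE j tj; rewrite vgeE//.
  have : al j <= al t by rewrite lez_nat; exact: tmax.
  by move: (al j) (al t) (ordz v _) oj ot => *; lia.
have [y yE] := (mvalP _ _).1 xhi.
have yval : combF f (mval y) = pF ^ (- m) *: combF f xh by rewrite -yE combFZ.
have yt : y 0 t \is a GRing.unit.
  have : val (y 0 t) = pF ^ (- m) * x 0 t.
    by move/rowP/(_ t): yE; rewrite scalemxE !mxE tt => <-.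
  move=> e1; rewrite unit_ordz e1 mulf_neq0 ?unifz_neq0// ordzM ?unifz_neq0//.
  by rewrite ordz_unifz addNr.
(* The rest of x has norm at least W + 1, so the hypotheses on x pass to its tight part. *)
pose r := x - xh.
have xhE : xh = x - r by rewrite /r opprB addrC subrK.
have rW : wge v al (W + 1) r.
  apply/wgeP => i; rewrite /r !mxE; case: ifP => [_|/negbFE ti]; first by rewrite subrr vge2_0.
  by rewrite subr0.
have wp := wge_polar hq gk_weight_polar; have wq := wge_q hq gk_weight_q gk_weight_polar.
have hqh : vge v (W + 1) (q (combF f xh)).
  rewrite xhE combFB qformD (qformN hq) (polarNr hq); apply: vgeB; first by apply: vgeD => //; exact: wq.
  rewrite -vge2_odd; by have := wp _ _ _ _ xW rW; rewrite aux2.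
have hph j : vge2 v (W + al j + 1) (polar q (combF f xh) (tnth f j)).
  rewrite xhE combFB polarC// (polarDr hq) (polarNr hq) polarC//; apply: vge2D => //.
  rewrite vge2N polarC// -[tnth f j]combF_delta.
  by have := wp _ _ _ _ rW (wge_delta v al j); rewrite aux1.
have ats : al t = al s by rewrite /al ast.
pose a' i := (tnth a i + (i == s))%N.
have hv : combF f (mval y) = pF ^ (- m) *: combF f xh := yval.
have h1 (i j : 'I_n) : (i <= j)%N -> (a' i <= a' j)%N.
  move=> ij; rewrite /a'; have [is_|is_] := eqVneq i s; last first.
    by rewrite addn0 (leq_trans (sa _ _ ij))// leq_addr.
  have [js|js] := eqVneq j s; first by rewrite is_ js.
  rewrite addn1 addn0 is_; apply: slast; rewrite ltn_neqAle -is_ ij andbT.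
  by apply: contraNneq js => /val_inj <-; rewrite is_.
have h2 i : i != s -> (a' i <= tnth a i)%N by move=> /negPf is_; rewrite /a' is_ addn0.
have h3 : vge v (a' s)%:Z (q (combF f (mval y))).
  rewrite hv hq.1 exprnP exprz_exp vge_unifM /a' eqxx.
  by apply: vge_le hqh; apply: aux3; rewrite ot ats.
have h4 i j : i != s -> tnth a j = tnth a i ->
    vge2 v (a' s + a' i)%N%:Z (polar q (combF f (mval y)) (tnth f j)).
  move=> /negPf is_ aji; rewrite hv polarZl// vge2_unifM /a' eqxx is_.
  by apply: vge2_le (hph j); rewrite /al aji; apply: aux4; rewrite ot ats.
have h5 (i : 'I_n) : (i < s)%N -> a' i = tnth a i.
  by move=> is_; rewrite /a' -(inj_eq val_inj) /= (ltn_eqF is_) addn0.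
apply: (GK_exchange hq two_neq0 fa yt ast h1 h2 h3 h4 h5).
by rewrite /a' eqxx addn1.
Qed.

End Tightness.

(** * Two combinatorial tools *)

Section LayerCake.

Lemma sum_ltn_ord S m : (\sum_(s < S) (s < m) = minn m S)%N.
Proof.
elim: S => [|S IH]; first by rewrite big_ord0 minn0.
by rewrite big_ord_recr /= IH; case: (ltnP S m); lia.
Qed.

(** Layer-cake formula: d is the sum over s >= 0 of [s < d] - [d < -s], truncated at a common bound
    S. *)
Lemma sum_le0_of_layers (I : finType) (d : I -> int) :
  (forall s : nat, (#|[set i | (s%:Z < d i)%R]| <= #|[set i | (d i < - s%:Z)%R]|)%N) ->
  \sum_i d i <= 0.
Proof.
move=> h; pose S := (\sum_i `|d i|)%N.
have dS i : (`|d i| <= S)%N by rewrite /S (bigD1 i)//= leq_addr.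
have dE i : d i = \sum_(s < S) ((s%:Z < d i)%R%:Z - (d i < - s%:Z)%R%:Z).
  have := dS i; case: (d i) => m; rewrite ?absz_nat => mS.
    transitivity (\sum_(s < S) (s < m)%N%:Z).
      by rewrite -[RHS](big_morph Posz PoszD erefl) sum_ltn_ord; congr Posz; lia.
    by apply: eq_bigr => s _; rewrite ltz_nat; case: (ltnP s m) => _; rewrite (_ : Posz m < - s%:Z = false) ?subr0//; lia.
  transitivity (- \sum_(s < S) (s < m.+1)%N%:Z).
    by rewrite -[X in - X](big_morph Posz PoszD erefl) sum_ltn_ord; lia.
  rewrite -sumrN; apply: eq_bigr => s _.
  have -> : (s%:Z < Negz m) = false by lia.
  by rewrite NegzE ltrN2 ltz_nat; case: (s < m.+1)%N.
rewrite (eq_bigr _ (fun i _ => dE i)) exchange_big /=; apply: sumr_le0 => s _.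
rewrite sumrB subr_le0 -!(big_morph Posz PoszD erefl) lez_nat.
have cE (p : pred I) : (#|[set i | p i]| = \sum_i p i)%N.
  rewrite -sum1_card big_mkcond /=; apply: eq_bigr => i _; rewrite inE.
  by case: (p i).
by have := h s; rewrite !cE.
Qed.

End LayerCake.

(** The block with rows I and columns J has more rows than columns; a vector of its left kernel is
    extended by 0. *)
Lemma left_kernel_supported (K : fieldType) n (P : 'M[K]_n) (I J : {set 'I_n}) :
  (#|J| < #|I|)%N -> exists la : 'I_n -> K,
  [/\ exists i, la i != 0, forall i, la i != 0 -> i \in I
    & forall j, j \in J -> \sum_i la i * P i j = 0].
Proof.
move=> JI; pose A : 'M[K]_(#|I|, #|J|) := \matrix_(r, s) P (enum_val r) (enum_val s).
have : kermx A != 0.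
  rewrite kermx_eq0 /row_free neq_ltn (leq_ltn_trans (rank_leq_col A))//.
move=> /rowV0Pn[u /sub_kermxP uA u0].
pose la i := \sum_(r | enum_val r == i) u 0 r.
have laE r : la (enum_val r) = u 0 r.
  by rewrite /la (big_pred1 r)// => r'; rewrite (inj_eq enum_val_inj).
have la0 i : i \notin I -> la i = 0.
  by move=> iI; rewrite /la big_pred0// => r; apply: contraNF iI => /eqP <-; exact: enum_valP.
exists la; split.
- move: u0 => /rV0Pn[r ur]; by exists (enum_val r); rewrite laE.
- by move=> i; apply: contraNT => /la0 ->.
move=> j jJ; rewrite (bigID (mem I))/= [X in _ + X]big1 ?addr0; last first.
  by move=> i /la0 ->; rewrite mul0r.
rewrite big_enum_val /=; have /rowP/(_ (enum_rank_in jJ j)) := uA.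
rewrite [RHS]mxE [LHS]mxE => uj; rewrite -[RHS]uj; apply: eq_bigr => r _.
by rewrite laE mxE enum_rankK_in.
Qed.

(** * Comparison of the Gross-Keating norm with an overlattice *)

Section OverlatticeBound.
Variables (F : fieldType) (v : discrete_valuation F) (V : vectType F).
Variables (q : V -> F) (hq : quadratic_form q) (two_neq0 : (2 : F) != 0).
Variables (n : nat) (L M : set V) (f g : n.-tuple V) (a : n.-tuple nat).
Hypothesis fa : GKmax v q L f a.
Hypotheses (hg : lattice_basis v g M) (qM : integral_on v q M).
Variable P : 'M[integers v]_n.
Hypothesis tP : trans f g (mval P).
Local Notation o := (integers v).
Local Notation pF := (unif v).
Local Notation al := (gk_weight a).

Let hf : lattice_basis v f L. Proof. by case: fa => -[]. Qed.

(* phi splits both norms: that of weights a on f, and the one that M defines. *)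
Lemma adapted_frame : exists (phi gam : n.-tuple V) (be c : 'I_n -> int),
  [/\ [/\ \sum_i be i = \sum_i al i, ordz v (\det (mval P)) = \sum_i c i
        & forall i j, vge2 v (be i + be j) (polar q (tnth phi i) (tnth phi j))],
      forall i, M (tnth gam i), forall i, tnth phi i = pF ^ c i *: tnth gam i
    & forall x W, wge v be W x -> vge v (W + 1) (q (combF phi x)) ->
        (forall j, vge2 v (W + be j + 1) (polar q (combF phi x) (tnth phi j))) ->
        wge v be (W + 1) x].
Proof.
have Pu : mval P \in unitmx by apply: trans_unit hf.1 hg.1 tP.
have [U [W [be [c [Uu Wu [sbe _] Uw UPW]]]]] := wsmith v al Pu.
have [Wm WV] := mval_unit Wu.
pose phi := mxbasis f U; pose gam := mxbasis g (mval (invmx W)).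
have tphi : trans phi f U by exact: mxbasis_trans.
have phiE i : tnth phi i = combF f (row i U) by rewrite tnth_mktuple.
have rowU i : wge v al (be i) (row i U) by rewrite rowE Uw wge_delta.
have rowUV i : wge v be (al i) (row i (invmx U)).
  by rewrite -Uw rowE mulmxKV// wge_delta.
exists phi, gam, be, c; split; first split=> //.
(* U and its inverse respect two norms of equal total weight, so v(det U) = 0 and v(det P) is the
   sum of the c_i. *)
- have dU0 : \det U != 0 by move: Uu; rewrite unitmxE unitfE.
  have dU1 : 0 <= ordz v (\det U).
    have : vge2 v (\sum_i be i + \sum_i - al i) (\det U).
      by apply: vge2_det => i j; have /wgeP/(_ j) := rowU i; rewrite mxE.
    by rewrite sumrN sbe subrr vge2E// pmulr_rge0.
  have dU2 : 0 <= - ordz v (\det U).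
    have : vge2 v (\sum_i al i + \sum_i - be i) (\det (invmx U)).
      by apply: vge2_det => i j; have /wgeP/(_ j) := rowUV i; rewrite mxE.
    by rewrite sumrN sbe subrr det_inv vge2E ?invr_neq0// ordzV// pmulr_rge0.
  have dP0 : \det (mval P) != 0 by move: Pu; rewrite unitmxE unitfE.
  have dW0 : \det (mval W) != 0 by move: Wm; rewrite unitmxE unitfE.
  have dW : ordz v (\det (mval W)) = 0.
    by move: Wu; rewrite unitmxE unit_ordz det_mval => /andP[_ /eqP].
  have := congr1 (fun X => ordz v (\det X)) UPW; rewrite !det_mulmx !ordzM ?mulf_neq0// dW addr0.
  rewrite det_diag (eq_bigr (fun i => pF ^ c i)) => [|i _]; last by rewrite mxE.
  rewrite ordz_prod_unif ordz_unifz => <-.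
  by move: (ordz v (\det U)) dU1 dU2 => d h1 h2; rewrite (_ : d = 0) ?add0r//; lia.
- move=> i j; rewrite !phiE; exact: (wge_polar hq (gk_weight_polar fa)).
- move=> i; rewrite tnth_mktuple; apply/(lattice_basisP hg)/mintP => r s.
  by rewrite !mxE vge_val.
- move=> i; rewrite phiE tP tnth_mktuple -combFZ; congr combF.
  have -> : row i U *m mval P = row i (U *m mval P) by rewrite row_mul.
  have -> : U *m mval P = diag_mx (\row_i pF ^ c i) *m mval (invmx W).
    by rewrite -UPW -WV mulmxK.
  by apply/rowP => j; rewrite mul_diag_mx !mxE.
move=> x w xw hqx hpx; rewrite -Uw; apply: (GK_tight hq two_neq0 fa).
- by rewrite Uw.
- by rewrite -tphi.
move=> j; rewrite -tphi.
have -> : tnth f j = combF phi (row j (invmx U)).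
  by rewrite tphi rowE mulmxKV// combF_delta.
rewrite polar_combFr//; apply: vge2_sum => i _.
have /wgeP/(_ i) h1 := rowUV j; have := vge2M h1 (hpx i).
by congr vge2; move: (al j) (be i) => *; lia.
Qed.

(* Put d_i = 2 c_i - be_i. The reductions of the B(phi_i, phi_j), divided by their
   expected power of pi, vanish when d_i + d_j > 0, while tightness makes the rows with
   d_i > 0 independent; so at least as many d_j are < -s as are > s, for all s >= 0. *)
Lemma frame_bound : 2 * ordz v (\det (mval P)) <= \sum_i al i.
Proof.
have [phi [gam [be [c [[<- -> pphi] Mgam phiE tight]]]]] := adapted_frame.
pose de i := 2 * c i - be i.
suff : \sum_i de i <= 0 by rewrite sumrB -mulr_sumr subr_le0.
have cq i : vge v (2 * c i) (q (tnth phi i)).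
  rewrite phiE hq.1 exprnP exprz_exp vge_unifM mulrC subrr.
  exact: qM.
have cp i j : vge v (c i + c j) (polar q (tnth phi i) (tnth phi j)).
  rewrite !phiE polarZl// polarZr// !vge_unifM (_ : c i + c j - c i - c j = 0).
    exact: (integral_polar hg qM).
  by move: (c i) (c j) => *; lia.
apply: sum_le0_of_layers => s; rewrite leqNgt; apply/negP => JI.
pose I := [set i | s%:Z < de i]; pose J := [set i | de i < - s%:Z].
pose ev i j := (2 %| be i + be j)%Z.
pose tt i j : o := if ev i j then
   to_int v (pF ^ (- ((be i + be j) %/ 2)%Z) * polar q (tnth phi i) (tnth phi j)) else 0.
have tt_int i j : ev i j ->
    vge v 0 (pF ^ (- ((be i + be j) %/ 2)%Z) * polar q (tnth phi i) (tnth phi j)).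
  rewrite /ev => e2; rewrite vge_unifM add0r opprK -vge2_double.
  have -> : 2 * ((be i + be j) %/ 2)%Z = be i + be j by move: (be i + be j) e2 => z; lia.
  exact: pphi.
have [la [[i0 la_i0] laI laJ]] := left_kernel_supported (\matrix_(i, j) resm v (tt i j)) JI.
(* For i in I and j outside J one has de_i > s and de_j >= -s, so the polar value exceeds its
   expected order and the entry vanishes. *)
have laP j : \sum_i la i * resm v (tt i j) = 0.
  have [jJ|jJ] := boolP (j \in J).
    by rewrite -[RHS](laJ j jJ); apply: eq_bigr => i _; rewrite mxE.
  apply: big1 => i _; have [->|li] := eqVneq (la i) 0; first by rewrite mul0r.
  have iI := laI i li; rewrite !inE in iI jJ; rewrite /tt; case: ifP => e2; last first.
    by rewrite rmorph0 mulr0.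
  have /eqP -> : resm v (to_int v (pF ^ (- ((be i + be j) %/ 2)%Z)
      * polar q (tnth phi i) (tnth phi j))) == 0; last by rewrite mulr0.
  rewrite resm_to_int; last exact: tt_int.
  rewrite vge_unifM opprK; apply: vge_le (cp i j).
  move: iI jJ; rewrite /de; move: (be i) (be j) (c i) (c j) e2; rewrite /ev; lia.
pose li i : o := if la i == 0 then 0 else repr (la i).
have liE i : resm v (li i) = la i.
  rewrite /li; case: eqP => [->|_]; first exact: rmorph0.
  by rewrite redmE /reduce reprK.
pose W := be i0.
(* x lifts the kernel vector to norm exactly W = be_i0; only indices with be_i of the parity of W
   can satisfy 2 v(x_i) + be_i = W. *)
pose x : 'rV[F]_n := \row_i (if ev i0 i then val (li i) * pF ^ ((W - be i) %/ 2)%Z else 0).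
have evE i : ev i0 i -> 2 * ((W - be i) %/ 2)%Z = W - be i.
  by rewrite /ev /W; move: (be i0) (be i) => *; lia.
have xw : wge v be W x.
  apply/wgeP => i; rewrite mxE; case: ifP => [/evE e2|_]; last exact: vge2_0.
  by rewrite mulrC vge2_unifM e2 subrr -[0](mulr0 2) vge2_double vge_val.
have nxw : ~~ wge v be (W + 1) x.
  apply/negP => /wgeP/(_ i0); rewrite mxE.
  have -> : ev i0 i0 by rewrite /ev; move: (be i0) => z; lia.
  have u : li i0 \is a GRing.unit by rewrite -resm_unit liE.
  move: u; rewrite unit_ordz => /andP[u0 /eqP u1].
  rewrite (_ : W - be i0 = 0) ?subrr// expr0z mulr1 vge2E// u1.
  by rewrite /W; move: (be i0) => z; lia.
move/negP: nxw; apply; apply: tight => //.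
  (* On the support of [la], de_i >= 1 gives 2 (k + c_i) >= W + 1; for a zero coordinate any large k
     will do. *)
  have xk i : exists k, vge v k (x 0 i) /\ W + 1 <= 2 * (k + c i).
    rewrite mxE; case: ifP => [e2|_]; last first.
      exists (`|W| + 1 + `|c i|); split; first exact: vge_0.
      by move: (W) (c i) => *; lia.
    have [l0|l0] := eqVneq (la i) 0.
      rewrite /li l0 eqxx rmorph0 mul0r; exists (`|W| + 1 + `|c i|); split; first exact: vge_0.
      by move: (W) (c i) => *; lia.
    exists ((W - be i) %/ 2)%Z; rewrite mulrC vge_unifM subrr vge_val; split=> //.
    have := laI i l0; rewrite inE /de; have := evE i e2.
    by move: (W) (be i) (c i) => *; lia.
  apply: vge_q_sum => // [i|i j _].
    have [k [k1 k2]] := xk i; have := vgeM (vgeM k1 k1) (cq i); rewrite -expr2; apply: vge_le.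
    by move: (c i) k2 => *; lia.
  have [k [k1 k2]] := xk i; have [k' [k1' k2']] := xk j.
  have := vgeM (vgeM k1 k1') (cp i j); apply: vge_le.
  by move: (c i) (c j) k2 k2' => *; lia.
move=> j; rewrite polar_combFl//.
have xj i : vge2 v (W - be i) (x 0 i) by have /wgeP := xw.
have base : vge2 v (W + be j) (\sum_i x 0 i * polar q (tnth phi i) (tnth phi j)).
  apply: vge2_sum => i _; have := vge2M (xj i) (pphi i j); congr vge2.
  by move: (W) (be i) (be j) => *; lia.
(* For W + be_j odd the bound improves by parity; for W + be_j even the leading coefficient is the
   kernel relation in column j. *)
have [e2|e2] := boolP (2 %| W + be j)%Z; last exact: vge2_oddS.
have -> : \sum_i x 0 i * polar q (tnth phi i) (tnth phi j) =
    pF ^ ((W + be j) %/ 2)%Z * val (\sum_i li i * tt i j).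
  rewrite rmorph_sum mulr_sumr; apply: eq_bigr => i _; rewrite mxE; case: ifP => e1; last first.
    rewrite /tt (_ : ev i j = false) ?mulr0 ?rmorph0 ?mul0r ?mulr0//.
    by move: e1 e2; rewrite /ev /W; move: (be i0) (be i) (be j) => *; lia.
  have e3 : ev i j by move: e1 e2; rewrite /ev /W; move: (be i0) (be i) (be j) => *; lia.
  rewrite -[X in _ = _ * X]/(val (li i * tt i j)) val_mul /tt e3 vge_to_int; last exact: tt_int.
  rewrite -[LHS]mulrA [RHS]mulrCA; congr (_ * _); rewrite mulrA -unifzD; congr (_ ^ _ * _).
  by move: e1 e2 e3; rewrite /ev /W; move: (be i0) (be i) (be j) => *; lia.
rewrite vge2_unifM (_ : W + be j + 1 - 2 * ((W + be j) %/ 2)%Z = 2 * 0 + 1); last first.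
  by move: (W + be j) e2 => z; lia.
have key (z : o) : vge v 1 (val z) = (resm v z == 0) by rewrite redmE reduce_ker0.
rewrite vge2_odd add0r key; apply/eqP; rewrite rmorph_sum -[RHS](laP j).
apply: eq_bigr => i _.
by rewrite rmorphM liE.
Qed.

End OverlatticeBound.

(** * The ranges of the length and of the rank *)

Section GrossKeatingBounds.
Variables (F : fieldType) (v : discrete_valuation F) (V : vectType F).
Variables (q : V -> F) (hq : quadratic_form q) (qn : nondegenerate_form q).
Hypothesis two_neq0 : (2 : F) != 0.
Hypothesis hfin : finite_set [set: residue_field v].
Variables (n : nat) (L : set V) (e : n.-tuple V).
Hypotheses (he : lattice_basis v e L) (qL : integral_on v q L).
Local Notation o := (integers v).
Local Notation kappa := (residue_field v).
Local Notation gk := (GK v (gram q e)).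

(** The length is the valuation of the determinant of the inclusion, which [frame_bound]
    controls. *)
Lemma GK_length_bound M b : is_over v q n L M -> has_length v L M b -> (b <= (sumn gk)./2)%N.
Proof.
move=> [LM [g0 hg0] qM]; have [f fa] := GK_max hq qn two_neq0 he qL.
have hf : lattice_basis v f L by case: (fa) => -[].
have [g [U [P [c [hg Uu tP UP]]]]] := adapted_basis hf hg0 LM.
move=> /(has_lengthE hfin hf hg Uu tP UP) ->.
have := frame_bound hq two_neq0 fa hg qM tP.
have Pu : mval P \in unitmx by apply: trans_unit hf.1 hg.1 tP.
have [Um _] := mval_unit Uu.
have dU : ordz v (\det (mval U)) = 0.
  by move: Uu; rewrite unitmxE unit_ordz det_mval => /andP[_ /eqP].
have -> : ordz v (\det (mval P)) = (\sum_i c i)%N%:Z.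
  have := congr1 (fun X => ordz v (\det (mval X))) UP.
  rewrite mvalM det_mulmx ordzM; last 2 first.
  - by move: Um; rewrite unitmxE unitfE.
  - by move: Pu; rewrite unitmxE unitfE.
  rewrite dU add0r => ->; rewrite det_mval /dpi det_diag.
  rewrite (eq_bigr (fun i => piI v ^+ c i)) => [|i _]; last by rewrite mxE.
  rewrite -(big_morph _ (exprD (piI v)) (expr0 _)) val_exp val_piI ordzX ?unif_neq0// ordz_unif.
  by rewrite -mulr_natr mul1r natz.
have -> : \sum_i gk_weight gk i = (sumn gk)%:Z.
  by rewrite sumnE big_tuple (big_morph Posz PoszD erefl).
by rewrite -(PoszM 2) lez_nat => h; rewrite -(doubleK (\sum_i c i)) half_leq// -mul2n.
Qed.

Lemma map_polar_tform (A B : comNzRingType) (h : {rmorphism A -> B}) (T : 'M[A]_n) x y :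
  h (polar (tform T) x y) = polar (tform (map_mx h T)) (map_mx h x) (map_mx h y).
Proof. by rewrite /polar -map_mxD -!map_tform -!rmorphB. Qed.

(* A combination of the weight-0 basis vectors in the radical of M mod pi could replace
   one of them, making (0, ..., 0, 1, ..., 1) with one 0 less admissible. *)
Lemma GK_zeros_bound M d s : is_over v q n L M -> has_symbol v q n M d s ->
  (count_mem 0%N gk <= d)%N.
Proof.
move=> [LM _ qM] [g [hg [W0 [W1 [hW <- _]]]]].
have [f fa] := GK_max hq qn two_neq0 he qL.
have hf : lattice_basis v f L by case: (fa) => -[].
have [P0 tP0] := trans_exists f hg.1.
have [P PE] := (mvalP _ _).1 (mint_trans hf hg tP0 LM); rewrite {}PE in tP0.
have Tg := integral_qgram hg qM.
set a := gk in fa *; pose Z := [set i | tnth a i == 0%N].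
have -> : count_mem 0%N a = #|Z|.
  rewrite -sum1_count big_tuple -sum1_card; apply: eq_bigl => i.
  by rewrite [in RHS]inE.
pose ev : 'I_#|Z| -> 'I_n := enum_val.
pose B : 'M[kappa]_(#|Z|, n) := rowsub ev (map_mx (resm v) P).
apply: (@radical_free_dim (Kap hfin) n _ (reduced_form_quadratic hq hg qM) _ B _ _ hW).
move=> x; set rad := in_radical _ _ _ => hrad.
have {}hrad : @in_radical kappa _ (@reduced_form F v V q n g) setT ((x : 'rV[kappa]_#|Z|) *m B) by [].
apply: contrapT => /eqP/rV0Pn[r xr].
pose X : 'rV[o]_n := map_mx repr (x : 'rV[kappa]_#|Z|) *m rowsub ev 1%:M.
have XE : map_mx (resm v) (X *m P) = (x : 'rV[kappa]_#|Z|) *m B.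
  rewrite /X -mulmxA mul_rowsub_mx mul1mx map_mxM; congr (_ *m _).
    by apply/rowP => i; rewrite !mxE redmE /reduce reprK.
  by apply/matrixP => i j; rewrite !mxE.
pose t := ev r.
have Xt : X 0 t = repr (x 0 r : kappa).
  rewrite /X mxE (bigD1 r)//= !mxE eqxx mulr1 big1 ?addr0// => r' r'r.
  by rewrite !mxE (inj_eq enum_val_inj) (negPf r'r) mulr0.
have ut : X 0 t \is a GRing.unit.
  rewrite Xt -resm_unit redmE /reduce reprK; exact: xr.
have at0 : tnth a t = 0%N by have := enum_valP r; rewrite inE => /eqP.
have [s0 [ast slast]] := last_in_block fa t.
have [[_ /sorted_tnth sa _ _] _] := fa.
have qE y : q (combF f (mval y)) = val (tform (qint v q g) (y *m P)).
  by rewrite tP0 -mvalM q_combF// val_tform mval_qint.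
have hX : vge v 1 (q (combF f (mval X))).
  have [_ h0 _] := hrad; move: h0; rewrite (reduced_formE hq Tg) -XE -map_tform => h0.
  by rewrite qE -(reduce_ker0 0) -redmE h0.
have hp j : vge v 1 (polar q (combF f (mval X)) (tnth f j)).
  pose y : 'rV[o]_n := delta_mx 0 j.
  have -> : tnth f j = combF f (mval y) by rewrite /mval map_delta_mx combF_delta.
  have -> : polar q (combF f (mval X)) (combF f (mval y)) =
      val (polar (tform (qint v q g)) (X *m P) (y *m P)).
    rewrite /polar -combFD (_ : mval X + mval y = mval (X + y)); last first.
      by apply/rowP => i; rewrite !mxE.
    by rewrite !qE mulmxDl.
  rewrite -(reduce_ker0 0) -redmE map_polar_tform XE.
  have [_ _ /(_ (map_mx (resm v) (y *m P)) I)] := hrad.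
  have -> : @reduced_form F v V q n g = tform (map_mx (resm v) (qint v q g)).
    exact/funext/(reduced_formE hq Tg).
  by move=> ->.
(* a' is 0 before s0 and 1 from s0 on, so it first exceeds a at s0. *)
pose a' (i : 'I_n) : nat := (tnth a i != 0%N) || (i == s0).
have s00 : tnth a s0 = 0%N by rewrite ast.
have a's : a' s0 = 1%N by rewrite /a' eqxx orbT.
have h1 (i j : 'I_n) : (i <= j)%N -> (a' i <= a' j)%N.
  move=> ij; rewrite /a'; have [aj|_] /= := eqVneq (tnth a j) 0%N; last exact: leq_b1.
  have -> /= : tnth a i == 0%N by rewrite -leqn0 -aj sa.
  have [is_|_] := eqVneq i s0; last by [].
  suff -> : j == s0 by [].
  apply/negPn/negP => js; have : (s0 < j)%N.
    by move: ij js; rewrite is_ ltn_neqAle => -> js; rewrite andbT eq_sym; exact: js.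
  by move/slast; rewrite aj.
have h2 i : i != s0 -> (a' i <= tnth a i)%N.
  by move=> /negPf is_; rewrite /a' is_ orbF; case: (tnth a i).
have h3 : vge v (a' s0)%:Z (q (combF f (mval X))) by rewrite a's.
have h4 i j : i != s0 -> tnth a j = tnth a i ->
    vge2 v (a' s0 + a' i)%N%:Z (polar q (combF f (mval X)) (tnth f j)).
  move=> _ _; apply: (@vge2_le _ _ _ (2 * 1)); last by rewrite vge2_double.
  by rewrite a's lez_nat ltnS leq_b1.
have h5 (i : 'I_n) : (i < s0)%N -> a' i = tnth a i.
  move=> is_; have ai : tnth a i = 0%N by apply/eqP; rewrite -leqn0 -s00 sa// ltnW.
  rewrite ai /a' ai eqxx /=; case: eqP => // E.
  by move: is_; rewrite E ltnn.
by apply: (GK_exchange hq two_neq0 fa ut ast h1 h2 h3 h4 h5); rewrite a's s00.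
Qed.

End GrossKeatingBounds.

Section IndicatorSums.

Lemma sum_indicator (R : pzSemiRingType) (T : eqType) (r : seq T) (x : T) (E : T -> R) :
  uniq r -> x \in r -> \sum_(y <- r) (y == x)%:R * E y = E x.
Proof.
move=> ur xr; rewrite (bigD1_seq x)//= eqxx mul1r big1 ?addr0// => y /negPf ->.
by rewrite mul0r.
Qed.

Lemma ncard_sub (T : choiceType) (X : {fset T}) (A : set T) :
  (forall x, A x -> x \in X) -> ncard A = (\sum_(x <- X) `[< A x >])%N.
Proof.
move=> AX; have fA : finite_set A.
  by apply: (@sub_finite_set _ _ [set` X]%classic); [move=> x /AX|exact: finite_fset].
rewrite /ncard -[RHS]big_mkcond /= sum1_count -size_filter.
apply/perm_size/uniq_perm; rewrite ?fset_uniq ?filter_uniq//.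
move=> x; rewrite mem_filter; transitivity (x \in fset_set A) => //.
rewrite in_fset_set//; apply/idP/andP => [/set_mem Ax|[/asboolP Ax _]]; last exact: mem_set.
by split; [apply/asboolP|exact: AX].
Qed.

End IndicatorSums.

(** * Summation over overlattices *)

Section Counting.
Variables (R : realType) (F : fieldType) (v : discrete_valuation F) (V : vectType F).
Variables (q : V -> F) (hq : quadratic_form q) (qn : nondegenerate_form q).
Hypothesis two_neq0 : (2 : F) != 0.
Hypothesis hfin : finite_set [set: residue_field v].
Variables (n k : nat) (n_gt0 : (0 < n)%N) (nk : (n <= k)%N).
Variables (L : set V) (e : n.-tuple V).
Hypotheses (he : lattice_basis v e L) (qL : integral_on v q L).
Local Notation o := (integers v).
Local Notation f := ((residue_card v)%:R : R).
Local Notation gk := (GK v (gram q e)).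
Local Notation over := (is_over v q n L).

Let f_gt1 : 1 < f. Proof. by rewrite ltr1n (residue_card_gt1 hfin). Qed.
Let f_neq0 : f != 0. Proof. by rewrite gt_eqF// (lt_trans ltr01). Qed.

(** For a^- the factor 1 - f^(n - a/2 - k) is nonzero because a > 0 and n <= k. Nonvanishing is what
    gives every overlattice an isometry. *)
Lemma symbol_val_neq0 a (s : option bool) : s \in signs a -> symbol_val R v n k a s != 0 :> R.
Proof.
have fz (z : int) : z < 0 -> 1 - f ^ z != 0.
  move=> z0; rewrite subr_eq0 eq_sym lt_eqF//.
  case: z z0 => // m _; rewrite NegzE -exprnN invf_lt1 ?exprn_gt0 ?(lt_trans ltr01)//.
  by rewrite exprn_egt1.
move=> sa; rewrite mulf_neq0//; last first.
  rewrite prodf_seq_neq0; apply/allP => i; rewrite mem_index_iota => /andP[_ iN].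
  by apply/implyP => _; apply: fz; lia.
have fp (x : R) : 0 < f `^ x by rewrite powR_gt0// (lt_trans ltr01).
move: sa; rewrite /signs; case: ifP => [_|/negbT].
  rewrite inE => /eqP -> /=; case: ifP => _; first by rewrite mul0r addr0 oner_neq0.
  by rewrite mul1r gt_eqF// addr_gt0.
rewrite negb_or => /andP[_ a0]; rewrite !inE => /orP[] /eqP -> /=.
  by rewrite mul1r gt_eqF// addr_gt0.
rewrite mulN1r subr_eq0 eq_sym lt_eqF// /powR (negPf f_neq0) -[ltRHS]expR0 ltr_expR.
rewrite nmulr_rlt0 ?ln_gt0//.
rewrite addrAC subr_lt0 (@le_lt_trans _ _ 0) ?subr_le0 ?ler_nat//.
by rewrite divr_gt0 ?ltr0n// lt0n.
Qed.

(** The ranges are included so that the triple of an overlattice is always an index of the triple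
    sum. *)
Definition invariants M (t : nat * (nat * option bool)) : Prop :=
  [/\ has_length v L M t.1, has_symbol v q n M t.2.1 t.2.2,
      (t.1 <= (sumn gk)./2)%N, (count_mem 0%N gk <= t.2.1 <= n)%N & t.2.2 \in signs t.2.1].

Lemma over_adapted M : over M -> exists (g : n.-tuple V) (U P : 'M[o]_n) (c : 'I_n -> nat),
  [/\ lattice_basis v g M, U \in unitmx, trans e g (mval P), U *m P = dpi (piI v) c
    & forall b, has_length v L M b <-> b = (\sum_i c i)%N].
Proof.
move=> [LM [g0 hg0] qM]; have [g [U [P [c [hg Uu tP UP]]]]] := adapted_basis he hg0 LM.
exists g, U, P, c; split=> // b; exact: (has_lengthE hfin he hg Uu tP UP b).
Qed.

Lemma invariants_exist M : over M -> exists t, invariants M t.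
Proof.
move=> oM; have [g [U [P [c [hg Uu tP UP lenE]]]]] := over_adapted oM.
have [_ _ qM] := oM; have [a [s [an ss hs]]] := has_symbol_exists hq hfin hg qM.
have len : has_length v L M (\sum_i c i) by apply/lenE.
exists ((\sum_i c i)%N, (a, s)); split=> //=.
  exact: (GK_length_bound hq qn two_neq0 hfin he qL oM len).
by rewrite an andbT; exact: (GK_zeros_bound hq qn two_neq0 hfin he qL oM hs).
Qed.

Definition invt M : nat * (nat * option bool) :=
  xget (0%N, (0%N, None)) (invariants M).

Lemma invP M : over M -> invariants M (invt M).
Proof. by move=> /invariants_exist; exact: xgetPex. Qed.

Lemma overlattices_inv M a s b : over M ->
  overlattices v q n L a s b M <-> (b, (a, s)) = invt M.
Proof.
move=> oM; have [h1 h2 _ _ _] := invP oM; have [LM hM qM] := oM.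
split=> [[_ _ _ hb hs]|E]; last by split=> //; [rewrite -[b]/((b, (a, s)).1) E|rewrite -[a]/((b, (a, s)).2.1) -[X in has_symbol _ _ _ _ _ X]/((b, (a, s)).2.2) E].
have [g [U [P [c [_ _ _ _ lenE]]]]] := over_adapted oM.
have eb : b = (invt M).1 by rewrite ((lenE b).1 hb) ((lenE _).1 h1).
have [ea es] := has_symbol_unique R hq hfin n_gt0 qM hs h2.
by rewrite eb ea es; case: (invt M) => x [].
Qed.

Variable N : nat.
Hypotheses (CN : (2 * nd_const v q e <= N)%N) (DN : (sumn gk <= N)%N).

Definition fiber M : set 'M[int_mod v N]_(n, k + k) :=
  [set phi | gram_of phi = map_mx (redm v N) (qint v q e) /\ rel e phi M]%classic.

(** [rel_count] solved for the cardinality. Its condition c_i + c_j <= N holds because 2b <= |GK(L)|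
    <= N. *)
Lemma ncard_fiber M : over M ->
  (ncard (fiber M))%:R = f ^ (N.+1%:Z * ((2 * k * n)%N%:Z - (n * n.+1)%N./2%:Z)) *
   ((1 - f ^ (- k%:Z)) * (f ^ ((invt M).1%:Z * (n%:Z + 1 - 2 * k%:Z)) *
       symbol_val R v n k (invt M).2.1 (invt M).2.2)) :> R.
Proof.
have comm1 (A B C D y z : R) : A * (y * (B * z)) * C * D = A * B * C * D * (y * z) by ring.
have comm2 (A B C y z : R) : A * (B * (y * z) * C) = A * B * C * (y * z) by ring.
have exps b : (n.+1 * b)%N%:Z + ((2 * k * n)%N%:Z - (n * n.+1)./2%:Z) + (N * (n * (k + k)))%N%:Z =
    N.+1%:Z * ((2 * k * n)%N%:Z - (n * n.+1)./2%:Z) + b%:Z * (n%:Z + 1 - 2 * k%:Z)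
    + ((k + k) * b)%N%:Z + (N * (n * n.+1)./2)%N%:Z.
  move: (n * n.+1)./2 => w; rewrite -(addn1 n) -(addn1 N) !PoszM !PoszD; ring.
move=> oM; have [g [U [P [c [hg Uu tP UP lenE]]]]] := over_adapted oM.
have [h1 h2 bD _ _] := invP oM; have [_ _ qM] := oM.
have cN i j : (c i + c j <= N)%N.
  apply: leq_trans DN; have ble : (\sum_i c i <= (sumn gk)./2)%N by rewrite -((lenE _).1 h1).
  have ci l : (c l <= \sum_i c i)%N by rewrite (bigD1 l)//= leq_addr.
  by have := ci i; have := ci j; move: ble; move: (\sum_i c i)%N (sumn gk) => x y; lia.
have := rel_count hq he qL k hfin oM hg Uu tP UP cN.
move=> /(congr1 (fun m : nat => m%:R : R)); rewrite !natrM !natrX.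
rewrite (has_symbol_nbk R hq hfin n_gt0 nk hg qM h2) -((lenE _).1 h1) -/(fiber M).
set b := (invt M).1; set sv := symbol_val _ _ _ _ _ _.
move: (ncard _)%:R (1 - _) sv => x y z; rewrite !exprnP => hx.
have fD (i j : int) : f ^ (i + j) = f ^ i * f ^ j by rewrite expfzDr.
have fne (i : int) : f ^ i != 0 by rewrite expfz_neq0.
apply: (mulIf (fne ((k + k) * b)%N%:Z)); apply: (mulIf (fne (N * (n * n.+1)./2)%N%:Z)); rewrite hx.
rewrite comm2 comm1 -!fD; congr (f ^ _ * _); exact: exps.
Qed.

(** Each overlattice has a nonempty fiber, its cardinality being nonzero, and an isometry determines
    its overlattice; so finitely many isometries cover all of them. Finiteness matters because
    [ncard] is 0 on infinite sets. *)
Lemma finite_over : finite_set [set M | over M]%classic.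
Proof.
pose h (phi : 'M[int_mod v N]_(n, k + k)) : set V := xget set0 (fun M => over M /\ rel e phi M).
apply: (@sub_finite_set _ _ (h @` setT)%classic); last first.
  by apply: finite_image; exact: (isometries_finite hfin N n (k + k)).
move=> M /= oM; have [phi [hphi hrel]] : exists phi, fiber M phi.
  apply: contrapT => /forallNP h0.
  have f0 : fiber M = set0 by apply/seteqP; split=> // x /h0.
  have := ncard_fiber oM; rewrite f0 /ncard fset_set0 cardfs0 => /esym/eqP.
  have [_ _ _ _ ss] := invP oM; apply/negP; apply: mulf_neq0; first exact: expfz_neq0.
  apply: mulf_neq0; last by apply: mulf_neq0; [exact: expfz_neq0|exact: symbol_val_neq0].
  rewrite subr_eq0 eq_sym lt_eqF// -exprnN invf_lt1 ?exprn_gt0 ?(lt_trans ltr01)//.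
  by rewrite exprn_egt1// -lt0n (leq_trans n_gt0).
have hM : over (h phi) /\ rel e phi (h phi).
  by have := xgetPex set0 (ex_intro (fun M => over M /\ rel e phi M) M (conj oM hrel)).
exists phi => //; apply/seteqP; split.
  exact: (rel_unique hq qn n_gt0 he qL CN hM.1 hM.2 hrel).
exact: (rel_unique hq qn n_gt0 he qL CN oM hrel hM.2).
Qed.

Local Notation Fs := (fset_set [set M | over M]%classic).

Lemma mem_Fs M : M \in Fs <-> over M.
Proof. by rewrite in_fset_set; [split=> [/set_mem|/mem_set]|exact: finite_over]. Qed.

Lemma ncard_isometries : ncard (@isometries_mod F v V q n k e N) =
  (\sum_(M <- Fs) ncard (fiber M))%N.
Proof.
rewrite (isometries_modE hq k N (integral_qgram he qL)) (ncard_An hfin).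
set S := [set _ | _]%SET; pose T M : {set 'M[An hfin N]_(n, k + k)} := [set phi : 'M[An hfin N]_(n, k + k) | `[< fiber M phi >]].
have TE M phi : (phi \in T M) = `[< fiber M (phi : 'M[int_mod v N]_(n, k + k)) >] by rewrite inE.
have -> : (\sum_(M <- Fs) ncard (fiber M) = \sum_(M <- Fs) \sum_(phi : 'M[An hfin N]_(n, k + k)) (phi \in T M))%N.
  apply: eq_bigr => M _; rewrite (ncard_An hfin) -sum1_card big_mkcond.
  by apply: eq_bigr => phi _; rewrite -/(T M); case: (phi \in T M).
rewrite exchange_big -sum1_card big_mkcond; apply: eq_bigr => phi _ /=.
have -> : (phi \in S) = `[< gram_of (phi : 'M[int_mod v N]_(n, k + k)) = map_mx (redm v N) (qint v q e) >].
  by rewrite inE.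
case: asboolP => [/= hphi|nphi]; last first.
  by rewrite big1// => M _; rewrite TE; case: asboolP => // -[].
have [M oM hM] := rel_exists hq qn n_gt0 he qL CN hphi.
rewrite (bigD1_seq M) ?fset_uniq//=; last by apply/mem_Fs.
have -> : phi \in T M by rewrite TE; apply/asboolP.
rewrite big1_seq ?addn0// => M' /andP[M'M /mem_Fs oM']; rewrite TE; case: asboolP => // -[_ hM'].
case/eqP: M'M; apply/seteqP; split.
  exact: (rel_unique hq qn n_gt0 he qL CN oM' hM' hM).
exact: (rel_unique hq qn n_gt0 he qL CN oM hM hM').
Qed.

Lemma density_seqE : density_seq v q R k e N = (1 - f ^ (- k%:Z)) *
  \sum_(M <- Fs) (f ^ ((invt M).1%:Z * (n%:Z + 1 - 2 * k%:Z)) *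
       symbol_val R v n k (invt M).2.1 (invt M).2.2).
Proof.
rewrite /density_seq ncard_isometries natr_sum.
rewrite (eq_big_seq _ (fun M hM => ncard_fiber ((mem_Fs M).1 hM))).
rewrite -mulr_sumr [LHS]mulrA -[X in X * _]expfzDr// addNr expr0z mul1r.
by rewrite -mulr_sumr.
Qed.

(** Cardinalities are expanded into indicators over the overlattices and the sums exchanged; each
    overlattice then contributes at a single triple. *)
Lemma sum_overlattices (G : nat -> nat -> option bool -> R) :
  \sum_(0 <= b < (sumn gk)./2.+1) \sum_(count_mem 0%N gk <= a < n.+1) \sum_(s <- signs a)
    (ncard (overlattices v q n L a s b))%:R * G b a s =
  \sum_(M <- Fs) G (invt M).1 (invt M).2.1 (invt M).2.2.
Proof.
have cE b a s : (ncard (overlattices v q n L a s b))%:R =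
    \sum_(M <- Fs) (b == (invt M).1)%:R * ((a == (invt M).2.1)%:R * (s == (invt M).2.2)%:R) :> R.
  rewrite (ncard_sub (X := Fs)) => [|M [LM hM qM _ _]]; last by apply/mem_Fs.
  rewrite natr_sum; apply: eq_big_seq => M /mem_Fs oM; rewrite -!natrM !mulnb; congr (nat_of_bool _)%:R.
  apply/asboolP/and3P => [/(overlattices_inv _ _ _ oM) <- //|[/eqP eb /eqP ea /eqP es]].
  by apply/(overlattices_inv _ _ _ oM); rewrite eb ea es; case: (invt M) => x [].
under eq_bigr do under eq_bigr do under eq_bigr do rewrite cE mulr_suml.
under eq_bigr do under eq_bigr do rewrite exchange_big /=.
under eq_bigr do rewrite exchange_big /=.
rewrite exchange_big /=; apply: eq_big_seq => M /mem_Fs oM.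
have [_ _ hb /andP[ha1 ha2] hs] := invP oM.
rewrite -[RHS](sum_indicator (fun b => G b (invt M).2.1 (invt M).2.2) (iota_uniq 0 _) (x := (invt M).1)
   (r := index_iota 0 (sumn gk)./2.+1)); last by rewrite mem_index_iota.
apply: eq_bigr => b _; rewrite -(sum_indicator (fun a => G b a (invt M).2.2) (iota_uniq _ _) (x := (invt M).2.1)
   (r := index_iota (count_mem 0%N gk) n.+1)); last by rewrite mem_index_iota ha1.
rewrite mulr_sumr; apply: eq_bigr => a _; have [aE|_] := eqVneq a (invt M).2.1; last first.
  by rewrite mul0r mulr0 big1// => s _; rewrite mul0r mulr0 mul0r.
rewrite -(sum_indicator (fun s => G b a s) (x := (invt M).2.2) (r := signs a)); last 2 first.
- by rewrite /signs; case: ifP.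
- by rewrite aE.
by rewrite mul1r mulr_sumr; apply: eq_bigr => s _; rewrite mul1r mulrA.
Qed.

End Counting.

Local Open Scope classical_set_scope.

Theorem theorem3p14 (R : realType)
    (p : nat) (p_prime : prime p)
    (Qp : fieldType) (vp : discrete_valuation Qp) (hQp : is_Qp p vp)
    (F : fieldExtType Qp) (v : discrete_valuation F)
    (hv : forall x : Qp, (0 <= v x%:A)%E = (0 <= vp x)%E)
    (n k : nat) (n_gt0 : (0 < n)%N) (le_nk : (n <= k)%N)
    (V : vectType F) (q : V -> F)
    (hq : quadratic_form q) (q_nondeg : nondegenerate_form q)
    (L : set V) (e : n.-tuple V)
    (he : lattice_basis v e L) (q_int : integral_on v q L) :
  let f : R := (residue_card v)%:R in
  let gk := GK v (gram q e) in
  cvgn (density_seq v q R k e) /\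
  local_density v q R k e =
    (1 - f ^ (- k%:Z)) *
    \sum_(0 <= b < (sumn gk)./2.+1)
      \sum_(count_mem 0%N gk <= a < n.+1)
        \sum_(s <- signs a)
          (ncard (overlattices v q n L a s b))%:R
          * f ^ (b%:Z * (n%:Z + 1 - 2 * k%:Z))
          * (1 + chi R a s * f `^ (n%:R - a%:R / 2 - k%:R))
          * \prod_(1 <= i < n | i%:R < n%:R - a%:R / 2 :> R)
              (1 - f ^ (2 * i%:Z - 2 * k%:Z)).
Proof.
move=> f gk; have hfin := residue_finite p_prime hQp hv.
(* Q_p has characteristic 0 even when p = 2; this makes the Gram matrix with halves meaningful over
   F. *)
have two_neq0 : (2 : F) != 0.
  have := natQp_neq0 p_prime hQp (m := 2) isT.
  by rewrite -(fmorph_eq0 (in_alg F)) rmorph_nat.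
set l : R := RHS.
have ev : \forall N \near \oo, density_seq v q R k e N = l.
  (* 2C is needed to sort isometries by overlattice, |GK(L)| to ensure c_i + c_j <= N in every
     fiber. *)
  exists (2 * nd_const v q e + sumn gk)%N => // N /= hN.
  have CN : (2 * nd_const v q e <= N)%N by rewrite (leq_trans _ hN)// leq_addr.
  have DN : (sumn gk <= N)%N by rewrite (leq_trans _ hN)// leq_addl.
  rewrite (density_seqE R hq q_nondeg two_neq0 hfin n_gt0 le_nk he q_int CN DN) /l; congr (_ * _).
  rewrite -(sum_overlattices hq q_nondeg two_neq0 hfin n_gt0 le_nk he q_int CN DN
     (fun b a s => f ^ (b%:Z * (n%:Z + 1 - 2 * k%:Z)) * symbol_val R v n k a s)).
  apply: eq_bigr => b _; apply: eq_bigr => a _; apply: eq_bigr => s _.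
  by rewrite /symbol_val !mulrA.
have cv : density_seq v q R k e @ \oo --> l by apply: cvg_near_cst.
split; first by apply/cvg_ex; exists l.
by apply: cvg_lim => //; exact: cvg_near_cst.
Qed.
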